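(* Let $l\in L(\kappa)$ be regular, let $T\in[V_\kappa\otimes V_\gamma]^M$ with $\|T\|=1$, and let $\sigma\in V(l,\kappa,\gamma,T)$. 1. $\sigma$ is $M$-invariant with respect to the action on states of $A_\gamma=C(\Gamma\backslash G)\otimes\mathrm{End}(V_\gamma)$ induced by duality from the $K$-action $(kf)(\Gamma g)=\gamma(k)f(\Gamma gk)\gamma(k)^{-1}$ on $A_\gamma$; i.e. $\sigma(mf)=\sigma(f)$ for all $m\in M$, $f\in A_\gamma$. 2. For each $f\in A_\gamma$ one has $\sigma(P_TfP_T)=\sigma(f)$, where $P_T=1\otimes\dim(V_\kappa)\,TT^*\in A_\gamma$ and $T$ is regarded as an element of $\mathrm{Hom}_M(V_{\tilde\kappa},V_\gamma)$, $\tilde\kappa$ being the dual representation of $\kappa$ (so that $\dim(V_\kappa)TT^*\in\mathrm{End}(V_\gamma)$ is an $M$-equivariant projection).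
   Context: Setting. $G$ is a semisimple Lie group, $K\subset G$ a maximal compact subgroup, $\Gamma\subset G$ a cocompact torsion-free discrete subgroup; $\Gamma\backslash G$ carries a $G$-invariant measure and $K$ the Haar measure of total mass $1$. $G=KAN$, $g=k(g)a(g)n(g)$, is an Iwasawa decomposition; $M=Z_K(A)$; $\mathfrak{a},\mathfrak{n}$ are the Lie algebras of $A,N$; $\rho(H)=\frac12\mathrm{Tr}(\mathrm{ad}(H)|_{\mathfrak n})$; $a^\nu=\exp(\nu(\log a))$. $(\gamma,V_\gamma)$ is a finite-dimensional unitary representation of $K$ and $(\kappa,V_\kappa)$ an irreducible unitary representation of $M$. Inner products are antilinear in the first variable. Principal series. For $\lambda\in\mathfrak{a}^*$, $H^{\kappa,i\lambda}=L^2(K\times_MV_\kappa)$ is the space of $L^2$-functions $\phi:K\to V_\kappa$ with $\phi(km)=\kappa(m)^{-1}\phi(k)$, with the unitary $G$-action $(\pi^{\kappa,i\lambda}(g)\phi)(k)=\phi(k(g^{-1}k))\,a(g^{-1}k)^{i\lambda-\rho}$. $C^K(K\times_MV_\kappa)$ is its subspace of $K$-finite vectors. Functionals. A unitary embedding $\xi:H^{\kappa,i\lambda}\to L^2(\Gamma\backslash G)$ is an isometric $G$-map (for right translation); we write $\xi$ also for $\xi\otimes\mathrm{id}_{V_\gamma}$. For smooth $\phi,\psi\in H^{\kappa,i\lambda}_\infty\otimes V_\gamma$ and $f\in A_\gamma$ put $\sigma^\xi_{\phi,\psi}(f)=\int_{\Gamma\backslash G}\langle\xi(\phi)(\Gamma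 g),f(\Gamma g)\xi(\psi)(\Gamma g)\rangle$. $A_{\gamma,K}\subset A_\gamma$ is the subalgebra of elements that are $K$-finite under right translation. Convenient sequences. The Weyl group $N_K(A)/M$ acts on $\mathfrak a^*$; $\lambda\in\mathfrak a^*$ is regular if it is fixed by no nontrivial Weyl group element. $S(\mathfrak a^* )=(\mathfrak a^*\setminus\{0\})/\mathbb R^+$ is the space of rays, identified with the unit sphere of $\mathfrak a^*$ for the Killing form metric; $[\lambda]$ is the ray of $\lambda$. $L(\kappa)\subset S(\mathfrak a^* )$ is the set of $l$ for which there are unitary embeddings $\xi_n:H^{\kappa,i\lambda_n}\to L^2(\Gamma\backslash G)$ with $\lambda_n\to\infty$, $[\lambda_n]\to l$. Such a sequence is $l$-conveniently arranged if all $\lambda_n$ are regular and for all $\phi,\psi\in C^K(K\times_MV_\kappa)\otimes V_\gamma$ the functionals $\sigma^{\xi_n}_{\phi,\psi}$ on $A_\gamma$ converge weakly; the limit is denoted $\sigma_{\phi,\psi}$. Representation theoretic lifts. For $T\in[V_\kappa\otimes V_\gamma]^M$, $\psi_T(k)=(1\otimes\gamma(k))T$ defines an element of $[C^\infty(K\times_MV_\kappa)\otimes V_\gamma]^K$, and $\delta_T$ is the distribution $\phi\mapsto\langle T,\phi(1)\rangle$. For $\mu\in\hat K$ let $\delta_{T,\mu}$ be its $\mu$-isotypic component, i.e. the unique element of the ($\mu$-isotypic subspace of $C^{-\infty}(K\times_MV_\kappa)$)$\,\otimes V_\gamma$ with $\langle\delta_{T,\mu},\phi\rangle=\langle T,\phi(1)\rangle$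 for all $\phi$ in this finite-dimensional space. For $f\in A_{\gamma,K}$ put $\sigma_T(f)=\sum_{\mu\in\hat K}\sigma_{\psi_T,\delta_{T,\mu}}(f)$ (a finite sum). The functional $\sigma_T$ extends continuously to a state on $A_\gamma$, also denoted $\sigma_T$. $V(l,\kappa,\gamma,T)$ is the set of states $\sigma_T$ arising in this way from the various $l$-conveniently arranged sequences $(\xi_n)$. *)

(* Defs.v *)
(* The complex numbers over [R : realType] are [R[i]], topologized by the norm. *)
From HB Require Import structures.
From mathcomp Require Import all_boot all_order all_algebra.
From mathcomp Require Import all_classical all_reals all_analysis.
From mathcomp Require Import generic_quotient complex.

Set Implicit Arguments.
Unset Strict Implicit.
Unset Printing Implicit Defensive.

Import Order.TTheory GRing.Theory Num.Theory.
Import numFieldNormedType.Exports.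

Local Open Scope classical_set_scope.
Local Open Scope ring_scope.
Local Open Scope quotient_scope.
Local Open Scope complex_scope.

HB.instance Definition _ (R : realType) :=
  PseudoPointedMetric.copy R[i] (R[i])^o.

HB.mixin Record isTopologicalGroup G & PointedTopological G & Group G := {
  mulg_continuous : continuous (fun x : G * G => (x.1 * x.2)%g) ;
  invg_continuous : continuous (fun x : G => (x^-1)%g) ;
}.

#[short(type="topologicalGroupType")]
HB.structure Definition TopologicalGroup :=
  {G of PointedTopological G & Group G & isTopologicalGroup G}.

Definition subgroup (G : groupType) (S : set G) : Prop :=
  [/\ S 1%g, (forall x y, S x -> S y -> S (x * y)%g)
    & (forall x, S x -> S (x^-1)%g)].

Section Cosets.
Variables (G : topologicalGroupType) (Gam : set G).

Definition left_coset (g : G) : set G := [set (c * g)%g | c in Gam].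

Definition coset_rel (g h : G) : bool := `[< left_coset g = left_coset h >].

Lemma coset_rel_refl : reflexive coset_rel.
Proof. by move=> g; apply/asboolP. Qed.
Lemma coset_rel_sym : symmetric coset_rel.
Proof. by move=> g h; apply/asboolP/asboolP => ->. Qed.
Lemma coset_rel_trans : transitive coset_rel.
Proof. by move=> h g k /asboolP gh /asboolP hk; apply/asboolP; rewrite gh. Qed.

Canonical coset_equiv :=
  EquivRel coset_rel coset_rel_refl coset_rel_sym coset_rel_trans.

(* The space of cosets [Gam g], with the quotient topology. *)
Definition coset_space := quotient_topology {eq_quot coset_rel}.
HB.instance Definition _ := PointedTopological.on coset_space.
HB.instance Definition _ := Quotient.on coset_space.

(* Right translation [Gam h |-> Gam h g]. *)
Definition rtrans (g : G) (x : coset_space) : coset_space :=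
  (\pi_coset_space (repr x * g)%g).

End Cosets.

Definition borel (T : ptopologicalType) : Type := g_sigma_algebraType (@open T).
HB.instance Definition _ (T : ptopologicalType) :=
  Measurable.on (borel T).

Section Smooth.
Variables (R : realType) (n : nat).

(* [f] is of class C^k on the open set [U]. *)
Fixpoint class_C (k : nat) (U : set 'rV[R]_n) (f : 'rV[R]_n -> R) : Prop :=
  (forall x, U x -> {for x, continuous f}) /\
  if k is k'.+1 then
    forall v : 'rV[R]_n,
      (forall x, U x -> derivable f x v) /\ class_C k' U (fun x => 'D_v f x)
  else True.

Definition smooth_on (U : set 'rV[R]_n) (f : 'rV[R]_n -> R) : Prop :=
  forall k, class_C k U f.

End Smooth.

Record chart (R : realType) (G : topologicalType) (n : nat) := Chart {
  chart_dom : set G;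
  coord_of : G -> 'rV[R]_n;
  point_of : 'rV[R]_n -> G }.

Section Charts.
Variables (R : realType) (G : topologicalType) (n : nat).
Implicit Types c d : chart R G n.

Definition chart_image c : set 'rV[R]_n := coord_of c @` chart_dom c.

(* [coord_of c] is a homeomorphism from the open set [chart_dom c] onto the
   open set [chart_image c], with inverse [point_of c]. *)
Definition chart_ok c : Prop :=
  [/\ open (chart_dom c), open (chart_image c),
      (forall x, chart_dom c x ->
         {for x, continuous (coord_of c)} /\ point_of c (coord_of c x) = x)
    & (forall y, chart_image c y -> {for y, continuous (point_of c)})].

Definition chart_compatible c d : Prop :=
  forall i, smooth_on (coord_of c @` (chart_dom c `&` chart_dom d))
                      (fun y => coord_of d (point_of c y) 0 i).

End Charts.

Record lieGroup (R : realType) := LieGroup {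
  lie_carrier :> topologicalGroupType;
  lie_dim : nat;
  lie_atlas : set (chart R lie_carrier lie_dim);
  lie_hausdorff : hausdorff_space lie_carrier;
  lie_second_countable : @second_countable lie_carrier;
  lie_chart_ok : forall c, lie_atlas c -> chart_ok c;
  lie_cover : forall x, exists2 c, lie_atlas c & chart_dom c x;
  lie_compatible : forall c d,
    lie_atlas c -> lie_atlas d -> chart_compatible c d;
  lie_mul_smooth : forall c d e,
    lie_atlas c -> lie_atlas d -> lie_atlas e ->
    forall i, smooth_on
      [set z : 'rV[R]_(lie_dim + lie_dim) |
         [/\ chart_image c (lsubmx z), chart_image d (rsubmx z)
           & chart_dom e (point_of c (lsubmx z) * point_of d (rsubmx z))%g]]
      (fun z => coord_of e
         (point_of c (lsubmx z) * point_of d (rsubmx z))%g 0 i);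
  lie_inv_smooth : forall c d, lie_atlas c -> lie_atlas d ->
    forall i, smooth_on
      [set y | chart_image c y /\ chart_dom d ((point_of c y)^-1)%g]
      (fun y => coord_of d ((point_of c y)^-1)%g 0 i) }.

Section VectorFields.
Variables (R : realType) (G : lieGroup R).

Definition smooth (f : G -> R) : Prop :=
  forall c, lie_atlas c -> smooth_on (chart_image c) (f \o point_of c).

Definition smooth_map (F : G -> G) : Prop :=
  continuous F /\ forall f, smooth f -> smooth (f \o F).

(* A left-invariant derivation of the algebra of smooth functions.  Only the
   values on smooth functions are meaningful. *)
Definition left_invariant_field (D : (G -> R) -> G -> R) : Prop :=
  [/\ (forall f, smooth f -> smooth (D f)),
      (forall (c : R) f h, smooth f -> smooth h ->
         D (fun x => c * f x + h x) = (fun x => c * D f x + D h x)),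
      (forall f h, smooth f -> smooth h ->
         D (fun x => f x * h x) = (fun x => f x * D h x + D f x * h x))
    & (forall (a : G) f, smooth f ->
         D (fun x => f (a * x)%g) = (fun x => D f (a * x)%g))].

End VectorFields.

(* A finite-dimensional vector space [la_space] identified by [la_field] with
   the space of all left-invariant vector fields, the commutator bracket, and
   the exponential map. *)
Record lieAlgebra (R : realType) (G : lieGroup R) := LieAlgebra {
  la_space :> vectType R;
  la_field : la_space -> (G -> R) -> G -> R;
  la_bracket : la_space -> la_space -> la_space;
  la_exp : la_space -> G;
  la_field_invariant : forall X, left_invariant_field (la_field X);
  la_field_linear : forall (c : R) X Y f x, smooth f ->
    la_field (c *: X + Y) f x = c * la_field X f x + la_field Y f x;
  la_field_inj : forall X Y,
    (forall f, smooth f -> la_field X f = la_field Y f) -> X = Y;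
  la_field_surj : forall D, left_invariant_field D ->
    exists X, forall f, smooth f -> D f = la_field X f;
  la_bracketE : forall X Y f x, smooth f ->
    la_field (la_bracket X Y) f x =
    la_field X (la_field Y f) x - la_field Y (la_field X f) x;
  la_expD : forall X (s t : R),
    la_exp ((s + t) *: X) = (la_exp (s *: X) * la_exp (t *: X))%g;
  la_exp_flow : forall X (t : R) f, smooth f ->
    is_derive t 1 (fun s : R => f (la_exp (s *: X)))
      (la_field X f (la_exp (t *: X))) }.

Section Semisimple.
Variables (R : realType) (G : lieGroup R) (g : lieAlgebra G).

(* The trace on [U] of an endomorphism preserving [U]. *)
Definition trace_on (U : {vspace g}) (f : g -> g) : R :=
  \sum_(i < \dim U) coord (vbasis U) i (f (vbasis U)`_i).

Definition killing (X Y : g) : R :=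
  trace_on fullv (fun Z => la_bracket X (la_bracket Y Z)).

Definition semisimple : Prop :=
  forall X, (forall Y, killing X Y = 0) -> X = 0.

Definition maximal_compact (K : set G) : Prop :=
  [/\ subgroup K, compact K
    & forall L : set G, subgroup L -> compact L -> K `<=` L -> L `<=` K].

Definition lie_of (K : set G) : set g :=
  [set X | forall t : R, K (la_exp (t *: X))].

Definition killing_perp (S : set g) : set g :=
  [set X | forall Y, S Y -> killing X Y = 0].

(* The connected Lie subgroup with Lie algebra [U]: generated by [exp U]. *)
Definition analytic_subgroup (U : {vspace g}) : set G :=
  [set x | forall S : set G, subgroup S ->
     (forall X, X \in U -> S (la_exp X)) -> S x].

Definition abelian_subspace (U : {vspace g}) : Prop :=
  forall X Y, X \in U -> Y \in U -> la_bracket X Y = 0.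

(* [lie_of K] and its orthogonal are the +1 and -1 eigenspaces of a Cartan
   involution. *)
Definition cartan_decomposition (K : set G) : Prop :=
  let k := lie_of K in let p := killing_perp k in
  [/\ (forall X, exists Y Z, [/\ k Y, p Z & X = Y + Z]),
      (forall X Y, k X -> p Y -> p (la_bracket X Y)),
      (forall X Y, p X -> p Y -> k (la_bracket X Y)),
      (forall X, k X -> X != 0 -> killing X X < 0)
    & (forall X, p X -> X != 0 -> 0 < killing X X)].

(* Restricted root spaces; only the values of [alpha] on [a] matter. *)
Definition root_space (a : {vspace g}) (alpha : g -> R) : set g :=
  [set X | forall H, H \in a -> la_bracket H X = alpha H *: X].

Definition root (a : {vspace g}) (alpha : g -> R) : Prop :=
  (exists2 H, H \in a & alpha H != 0) /\
  (exists2 X, root_space a alpha X & X != 0).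

(* [n] is the sum of the root spaces of the roots that are positive on some
   regular element [H0] of [a]. *)
Definition positive_nilradical (a n : {vspace g}) : Prop :=
  exists H0, [/\ H0 \in a, (forall alpha, root a alpha -> alpha H0 != 0)
    & forall X, X \in n <->
        exists s : seq g, X = \sum_(Y <- s) Y /\
          forall Y, Y \in s -> exists alpha,
            [/\ root a alpha, 0 < alpha H0 & root_space a alpha Y]].

End Semisimple.

(* An Iwasawa decomposition G = K A N.  The A-component of [x] is
   [exp (iw_log x)]. *)
Record iwasawa (R : realType) (G : lieGroup R) (g : lieAlgebra G) (K : set G) :=
Iwasawa {
  iw_a : {vspace g};
  iw_n : {vspace g};
  iw_k : G -> G;
  iw_log : G -> subvs_of iw_a;
  iw_nn : G -> G;
  iw_cartan : cartan_decomposition g K;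
  iw_a_sub : forall H, H \in iw_a -> killing_perp (lie_of K) H;
  iw_a_abelian : abelian_subspace iw_a;
  iw_a_maximal : forall b : {vspace g}, abelian_subspace b ->
    (forall H, H \in b -> killing_perp (lie_of K) H) ->
    (iw_a <= b)%VS -> b = iw_a;
  iw_positive : positive_nilradical iw_a iw_n;
  iw_kK : forall x, K (iw_k x);
  iw_nN : forall x, analytic_subgroup iw_n (iw_nn x);
  iw_decomp : forall x,
    x = (iw_k x * la_exp (vsval (iw_log x)) * iw_nn x)%g;
  iw_unique : forall (k n : G) (H : subvs_of iw_a), K k -> analytic_subgroup iw_n n ->
    let x := (k * la_exp (vsval H) * n)%g in
    [/\ iw_k x = k, iw_log x = H & iw_nn x = n];
  iw_k_smooth : smooth_map iw_k;
  iw_nn_smooth : smooth_map iw_nn;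
  iw_log_smooth : forall lam : 'Hom(subvs_of iw_a, R^o),
    continuous (fun x => lam (iw_log x) : R) /\
    smooth (fun x => lam (iw_log x) : R) }.

Section Iwasawa.
Variables (R : realType) (G : lieGroup R) (g : lieAlgebra G) (K : set G).
Variable I : iwasawa g K.

Definition iw_A : set G := analytic_subgroup (iw_a I).

Definition iw_M : set G :=
  [set k | K k /\ forall a, iw_A a -> (k * a)%g = (a * k)%g].

Definition normalizer_KA : set G :=
  [set k | K k /\ forall a, iw_A (k * a * k^-1)%g <-> iw_A a].

Definition adual : Type := 'Hom(subvs_of (iw_a I), R^o).

Definition rho (H : subvs_of (iw_a I)) : R :=
  2^-1 * trace_on (iw_n I) (la_bracket (vsval H)).

(* The action of [k] in N_K(A), i.e. of its Weyl group element. *)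
Definition weyl_act (k : G) (lam : adual) : subvs_of (iw_a I) -> R :=
  fun H => lam (iw_log I (k^-1 * la_exp (vsval H) * k)%g).

Definition regular (lam : adual) : Prop :=
  forall k, normalizer_KA k -> weyl_act k lam =1 lam -> iw_M k.

(* The norm of [adual] for the metric induced by the Killing form. *)
Definition killing_rep (lam : adual) : subvs_of (iw_a I) :=
  xget 0 [set H | forall H', lam H' = killing (vsval H) (vsval H')].

Definition adual_norm (lam : adual) : R :=
  Num.sqrt (killing (vsval (killing_rep lam)) (vsval (killing_rep lam))).

(* [a^(i lam - rho)] for [a = exp H]. *)
Definition apow (lam : adual) (H : subvs_of (iw_a I)) : R[i] :=
  (expR (- rho H))%:C * (cos (lam H : R) +i* sin (lam H : R)).

End Iwasawa.

Section Reps.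
Variables (R : realType) (G : lieGroup R).
Local Notation C := R[i].
Implicit Type S : set G.

(* The inner product of C^m (x) C^n, antilinear in the first variable. *)
Definition cdot m n (A B : 'M[C]_(m, n)) : C :=
  \sum_i \sum_j (A i j)^*%R * B i j.

Definition cnorm m n (A : 'M[C]_(m, n)) : R := Num.sqrt (complex.Re (cdot A A)).

Definition adjmx m n (A : 'M[C]_(m, n)) : 'M[C]_(n, m) := map_mx Num.conj A^T.

(* A unitary representation of the subgroup [S] on the column vectors C^d; only
   the restriction of [r] to [S] matters. *)
Definition unitary_rep S d (r : G -> 'M[C]_d) : Prop :=
  [/\ r 1%g = 1%:M,
      (forall x y, S x -> S y -> r (x * y)%g = r x *m r y),
      (forall x, S x -> r x *m adjmx (r x) = 1%:M)
    & {within S, continuous r}].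

(* Subspaces of columns are encoded as row spaces, hence the transpose. *)
Definition irreducible_rep S d (r : G -> 'M[C]_d) : Prop :=
  (0 < d)%N /\ forall U : 'M[C]_d, (forall x, S x -> stablemx U (r x)^T) ->
    \rank U = 0%N \/ \rank U = d.

Record irrep S := Irrep {
  irr_dim : nat;
  irr_rep : G -> 'M[C]_irr_dim;
  irr_unitary : unitary_rep S irr_rep;
  irr_irreducible : irreducible_rep S irr_rep }.

HB.instance Definition _ S := gen_eqMixin (irrep S).
HB.instance Definition _ S := gen_choiceMixin (irrep S).

Definition irrep_iso S (mu nu : irrep S) : Prop :=
  exists (A : 'M[C]_(irr_dim nu, irr_dim mu)) (B : 'M[C]_(irr_dim mu, irr_dim nu)),
    [/\ A *m B = 1%:M, B *m A = 1%:M
      & forall x, S x -> A *m irr_rep mu x = irr_rep nu x *m A].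

Definition irrep_eq S (mu nu : irrep S) : bool := `[< irrep_iso mu nu >].

Lemma irrep_eq_refl S : reflexive (@irrep_eq S).
Proof.
move=> mu; apply/asboolP; exists 1%:M, 1%:M.
by split=> [||x _]; rewrite !mul1mx ?mulmx1.
Qed.

Lemma irrep_eq_sym S : symmetric (@irrep_eq S).
Proof.
suff H (mu nu : irrep S) : irrep_iso mu nu -> irrep_iso nu mu.
  by move=> mu nu; apply/asboolP/asboolP; exact: H.
move=> [A [B [AB BA Ac]]]; exists B, A; split => // x Sx.
rewrite -[LHS]mulmx1 -AB mulmxA -(mulmxA B) -Ac //.
by rewrite [B *m (A *m _)]mulmxA BA mul1mx.
Qed.

Lemma irrep_eq_trans S : transitive (@irrep_eq S).
Proof.
move=> nu mu la /asboolP[A [B [AB BA Ac]]] /asboolP[A' [B' [AB' BA' Ac']]].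
apply/asboolP; exists (A' *m A), (B *m B'); split => [||x Sx].
- by rewrite mulmxA -(mulmxA A') AB mulmx1.
- by rewrite mulmxA -(mulmxA B) BA' mulmx1.
- by rewrite -mulmxA Ac // !mulmxA Ac'.
Qed.

Canonical irrep_equiv S :=
  EquivRel (@irrep_eq S) (@irrep_eq_refl S) (@irrep_eq_sym S)
    (@irrep_eq_trans S).

(* The unitary dual of [S]: isomorphism classes of irreducible unitary
   representations. *)
Definition unitary_dual S := {eq_quot (@irrep_eq S)}.
HB.instance Definition _ S := Quotient.on (unitary_dual S).
HB.instance Definition _ S := Choice.on (unitary_dual S).

(* The family [F] spans, as functions on [D], a finite-dimensional space. *)
Definition finite_span (T : Type) (V : lmodType C) (D : set T)
    (F : set (T -> V)) : Prop :=
  exists N (b : 'I_N -> T -> V), forall f, F f ->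
    exists c : 'I_N -> C, forall x, D x -> f x = \sum_i c i *: b i x.

End Reps.

Section ComplexIntegral.
Variables (R : realType) (d : measure_display) (T : measurableType d).

Definition cmeasurable (D : set T) (u : T -> R[i]) : Prop :=
  measurable_fun D (fun x => complex.Re (u x)) /\
  measurable_fun D (fun x => complex.Im (u x)).

Definition cintegral (mu : {measure set T -> \bar R}) (D : set T)
    (u : T -> R[i]) : R[i] :=
  (\int[mu]_(x in D) complex.Re (u x)) +i* (\int[mu]_(x in D) complex.Im (u x)).

End ComplexIntegral.

(* The Haar measure of total mass 1 on the compact group [K], as a Borel measure
   on [G] carried by [K]. *)
Definition haar_measure (R : realType) (G : lieGroup R) (K : set G)
    (mK : {measure set (borel G) -> \bar R}) : Prop :=
  [/\ mK K = 1%E, mK (~` K) = 0%E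
    & forall k (B : set (borel G)), K k -> measurable B ->
        mK [set x : borel G | B (k * x : G)%g] = mK B].

(* A nonzero finite Borel measure on [Gam \ G] invariant under right
   translations. *)
Definition invariant_measure (R : realType) (G : lieGroup R) (Gam : set G)
    (nu : {measure set (borel (coset_space Gam)) -> \bar R}) : Prop :=
  [/\ (0 < nu setT)%E, (nu setT < +oo)%E
    & forall (x : G) (B : set (borel (coset_space Gam))), measurable B ->
        nu (@rtrans G Gam x @^-1` B) = nu B].

Definition discrete_torsion_free (G : topologicalGroupType) (Gam : set G) :=
  [/\ subgroup Gam,
      (exists2 U : set G, open U & U `&` Gam = [set 1%g])
    & forall x n, Gam x -> (0 < n)%N -> (x ^+ n)%g = 1%g -> x = 1%g].

Definition cocompact (G : topologicalGroupType) (Gam : set G) : Prop :=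
  compact [set: coset_space Gam].

Section PrincipalSeries.
Variables (R : realType) (G : lieGroup R) (g : lieAlgebra G) (K : set G).
Variable I : iwasawa g K.
Variable mK : {measure set (borel G) -> \bar R}.
Variables (q : nat) (kappa : G -> 'M[R[i]]_q).
Local Notation C := R[i].
Local Notation V := 'cV[R[i]]_q.

(* Sections are functions on [G] of which only the restriction to [K] matters.
   [in_H] is the common space H^{kappa, i lambda} = L^2(K x_M V_kappa), a class
   modulo equality a.e. being given by any M-equivariant representative. *)
Definition in_H (phi : G -> V) : Prop :=
  [/\ (forall i, cmeasurable (K : set (borel G)) (fun x => phi x i 0)),
      (\int[mK]_(x in K) ((cnorm (phi x)) ^+ 2)%:E < +oo)%E
    & forall k m, K k -> iw_M I m -> phi (k * m)%g = invmx (kappa m) *m phi k].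

Definition ps_act (lam : adual I) (x : G) (phi : G -> V) : G -> V :=
  fun k => apow lam (iw_log I (x^-1 * k)%g) *: phi (iw_k I (x^-1 * k)%g).

(* K-finite vectors, each represented by its continuous representative; [K]
   acts by left translation. *)
Definition in_CK (phi : G -> V) : Prop :=
  [/\ in_H phi, {within K, continuous phi}
    & finite_span K [set f | exists2 k, K k & f = (fun x => phi (k^-1 * x)%g)]].

(* The isotypic component: the sum of the images of all K-homomorphisms from
   [mu]. *)
Definition isotypic (mu : unitary_dual K) (phi : G -> V) : Prop :=
  let r := irr_rep (repr mu) in
  exists N (J : 'I_N -> 'cV[C]_(irr_dim (repr mu)) -> G -> V)
         (w : 'I_N -> 'cV[C]_(irr_dim (repr mu))),
    [/\ (forall i v, in_CK (J i v)),
        (forall i (c : C) u v x, K x ->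
           J i (c *: u + v) x = c *: J i u x + J i v x),
        (forall i k v x, K k -> K x -> J i (r k *m v) x = J i v (k^-1 * x)%g)
      & forall x, K x -> phi x = \sum_i J i (w i) x].

(* Elements of V_kappa (x) C^p are q x p matrices, [v (x) w] being [v *m w^T], so
   that [A (x) B] acts by [T |-> A *m T *m B^T].  A section of V_kappa (x) V_gamma
   lies in E (x) V_gamma iff all its columns lie in E. *)
Definition columns_in p (E : (G -> V) -> Prop) (Phi : G -> 'M[C]_(q, p)) :=
  forall j, E (fun x => col j (Phi x)).

Variable Gam : set G.
Variable nu : {measure set (borel (coset_space Gam)) -> \bar R}.
Local Notation X := (coset_space Gam).

Definition in_L2 (u : X -> C) : Prop :=
  cmeasurable [set: borel X] u /\
  (\int[nu]_x ((complex.Re `|u x|) ^+ 2)%:E < +oo)%E.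

Definition unitary_embedding (lam : adual I) (xi : (G -> V) -> X -> C) : Prop :=
  [/\ (forall phi, in_H phi -> in_L2 (xi phi)),
      (forall (c : C) phi psi, in_H phi -> in_H psi ->
         {ae nu, forall x : borel X,
            xi (fun k => c *: phi k + psi k) x = c * xi phi x + xi psi x}),
      (forall phi, in_H phi ->
         (\int[nu]_x ((complex.Re `|xi phi x|) ^+ 2)%:E =
          \int[mK]_(k in K) ((cnorm (phi k)) ^+ 2)%:E)%E)
    & (forall y phi, in_H phi ->
         {ae nu, forall x : borel X,
            xi (ps_act lam y phi) x = xi phi (rtrans y x)})].

Variables (p : nat) (gamma : G -> 'M[C]_p).

(* [xi (x) id] on V_gamma. *)
Definition ext_xi (xi : (G -> V) -> X -> C) (Phi : G -> 'M[C]_(q, p))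
    (x : X) : 'cV[C]_p :=
  \col_j xi (fun k => col j (Phi k)) x.

Definition sigma_xi (xi : (G -> V) -> X -> C) (Phi Psi : G -> 'M[C]_(q, p))
    (f : X -> 'M[C]_p) : C :=
  cintegral nu setT
    (fun x : borel X => cdot (ext_xi xi Phi x) (f x *m ext_xi xi Psi x)).

(* A_gamma = C(Gam \ G) (x) End(V_gamma) is the algebra of continuous functions
   from [X] to matrices. *)
Definition in_A (f : X -> 'M[C]_p) : Prop := continuous f.

Definition in_AK (f : X -> 'M[C]_p) : Prop :=
  in_A f /\
  finite_span setT
    [set h | exists2 k, K k & h = (fun x : X => f (rtrans k x))].

(* The positive linear functionals of norm 1. *)
Definition state (s : (X -> 'M[C]_p) -> C) : Prop :=
  [/\ (forall (c : C) f h, in_A f -> in_A h ->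
         s (fun x => c *: f x + h x) = c * s f + s h),
      (forall f, in_A f -> 0 <= s (fun x => adjmx (f x) *m f x)),
      s (fun=> 1%:M) = 1
    & forall f (B : R), in_A f ->
        (forall x (v : 'cV[C]_p), cnorm (f x *m v) <= B * cnorm v) ->
        `|s f| <= B%:C].

Definition K_act (k : G) (f : X -> 'M[C]_p) : X -> 'M[C]_p :=
  fun x => gamma k *m f (rtrans k x) *m invmx (gamma k).

Definition goes_to (lam : nat -> adual I) (l : adual I) : Prop :=
  (adual_norm (lam n) @[n --> \oo] --> +oo) /\
  forall H, ((lam n H : R) / adual_norm (lam n)) @[n --> \oo] --> (l H : R).

(* The set L(kappa), rays being represented by unit vectors. *)
Definition in_L (l : adual I) : Prop :=
  adual_norm l = 1 /\
  exists (lam : nat -> adual I) (xi : nat -> (G -> V) -> X -> C),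
    (forall n, unitary_embedding (lam n) (xi n)) /\ goes_to lam l.

Definition convenient (l : adual I) (lam : nat -> adual I)
    (xi : nat -> (G -> V) -> X -> C) : Prop :=
  [/\ (forall n, unitary_embedding (lam n) (xi n)), goes_to lam l,
      (forall n, regular (lam n))
    & forall Phi Psi, columns_in in_CK Phi -> columns_in in_CK Psi ->
        forall f, in_A f -> cvg (sigma_xi (xi n) Phi Psi f @[n --> \oo])].

Definition sigma_lim (xi : nat -> (G -> V) -> X -> C)
    (Phi Psi : G -> 'M[C]_(q, p)) (f : X -> 'M[C]_p) : C :=
  lim (sigma_xi (xi n) Phi Psi f @[n --> \oo]).

Definition M_invariant (T : 'M[C]_(q, p)) : Prop :=
  forall m, iw_M I m -> kappa m *m T *m (gamma m)^T = T.

Definition psi_T (T : 'M[C]_(q, p)) : G -> 'M[C]_(q, p) :=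
  fun k => T *m (gamma k)^T.

(* The [mu]-isotypic distributions are K-finite functions, paired with sections
   by the L^2 inner product. *)
Definition is_delta (T : 'M[C]_(q, p)) (mu : unitary_dual K)
    (D : G -> 'M[C]_(q, p)) : Prop :=
  columns_in (isotypic mu) D /\
  forall Phi, columns_in (isotypic mu) Phi ->
    cintegral mK K (fun k : borel G => cdot (D k) (Phi k)) = cdot T (Phi 1%g).

Definition delta_T (T : 'M[C]_(q, p)) (mu : unitary_dual K) :
    G -> 'M[C]_(q, p) :=
  xget (fun=> 0) [set D | is_delta T mu D].

(* The set V(l, kappa, gamma, T). *)
Definition in_V (l : adual I) (T : 'M[C]_(q, p))
    (s : (X -> 'M[C]_p) -> C) : Prop :=
  state s /\
  exists (lam : nat -> adual I) (xi : nat -> (G -> V) -> X -> C),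
    convenient l lam xi /\
    forall f, in_AK f ->
      s f = \sum_(mu \in [set: unitary_dual K])
              sigma_lim xi (psi_T T) (delta_T T mu) f.

(* [T] as a map from the dual of V_kappa to V_gamma, in the dual basis. *)
Definition hom_of (T : 'M[C]_(q, p)) : 'M[C]_(p, q) := T^T.

Definition P_T (T : 'M[C]_(q, p)) : 'M[C]_p :=
  q%:R *: (hom_of T *m adjmx (hom_of T)).

End PrincipalSeries.

(* Main.v *)
Require Import Defs.
From HB Require Import structures.
From mathcomp Require Import all_boot all_order all_algebra.
From mathcomp Require Import all_classical all_reals all_analysis.
From mathcomp Require Import generic_quotient complex.
From mathcomp Require Import measurable_realfun ring lra.

Set Implicit Arguments.
Unset Strict Implicit.
Unset Printing Implicit Defensive.

Import Order.TTheory GRing.Theory Num.Theory.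
Import numFieldNormedType.Exports.

Local Open Scope classical_set_scope.
Local Open Scope ring_scope.
Local Open Scope complex_scope.

(* For [f = P_T] and [f = 1] the pairings defining [s] agree: [P_T] fixes [T] by
   Schur's lemma, so [1 (x) P_T] fixes the isotypic components of [delta_T], which
   are determined by [T] up to null functions.  Hence [s P_T = s 1 = 1], and
   positivity of [s] then gives [s (P_T f P_T) = s f] for every [f].

   For [m] in [M], right translation by [m] together with [gamma m] fixes both
   [psi_T] and the isotypic components of [delta_T], whence [s (m f) = s f] for
   K-finite [f].  For general [f], put [L h = Re (s (m h) - s h)] and consider
   the continuous function [c k = L (R_k f)] on [K].  Integrated against a
   function with finite-dimensional span of translates, it gives the value of
   [L] on a K-finite element, that is [0]; a Peter-Weyl argument then shows
   [c 1 = 0].  Namely, if [c 1 <> 0], let [A] be convolution with [c] and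
   [T = A^* A], a positive operator with a continuous kernel.  The functions
   [T^n k_1 / lam^n], with [k_1] the kernel of [T] at [1], converge to an
   eigenfunction for the eigenvalue [lam > 0]; its eigenspace is finite
   dimensional by Bessel's inequality, hence consists of K-finite functions, and
   these are orthogonal to [c], which forces [A w = 0], a contradiction. *)

(** The expansion of [s] over [mu] is available on K-finite elements only. Constants are K-finite,
    so for [P_T] two evaluations of [s] suffice; M-invariance concerns arbitrary continuous [f],
    which is why a density argument is needed there. [P_T] is inserted on the [delta_T] side alone,
    since [psi_T] is in general not fixed by it; the two-sided compression therefore has to come
    from positivity. Both comparisons are made for each [xi n] and each [mu], before any limit or
    sum.

    [L] is a bounded functional with no measure attached to it, so its exchange with a Haar integral
    is proved by hand.

    The spectral theorem is replaced by the moments of [T] at [k_1]. They are log-convex, so their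
    ratios increase to a limit [lam]. For a general positive operator the moments divided by
    [lam ^+ n] may still tend to 0, when the spectral measure has no atom at [lam]; the continuous
    kernel gives a submultiplicativity that excludes this, and so does the work of compactness. *)

Lemma bernoulli_ineq (R : realType) (t : R) n : 0 <= t <= 1 ->
  1 - n%:R * t <= (1 - t) ^+ n.
Proof.
move=> /andP[t0 t1]; elim: n => [|n IH]; first by rewrite mul0r subr0 expr0.
have n0 : 0 <= n%:R :> R by rewrite ler0n.
rewrite exprS; apply: le_trans (_ : (1 - t) * (1 - n%:R * t) <= _).
  by rewrite -natr1; nra.
by rewrite ler_wpM2l // subr_ge0.
Qed.

Lemma geometric_lt (R : realType) (y D : R) : 0 <= y < 1 -> 0 < D ->
  \forall j \near \oo, y ^+ j < D.
Proof.
move=> /andP[y0 y1] D0.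
have /(_ 1) h := @cvg_geometric R ^~ y.
have {}h := h ltac:(by rewrite ger0_norm).
have /cvgrPdist_lt /(_ D D0) := h.
apply: filterS => j; rewrite /= sub0r normrN mul1r ger0_norm //.
exact: exprn_ge0.
Qed.

(** * A limit for log-convex sequences *)

Section LogConvex.
Variables (R : realType) (b : nat -> R).
Hypothesis b_gt0 : forall n, 0 < b n.
Hypothesis b_convex : forall n, b n.+1 ^+ 2 <= b n * b n.+2.
Hypothesis b_submul : forall n m, b (n + m).+1.*2 <= b n.*2 * b m.*2.

Let r n := b n.+1 / b n.

Let r_gt0 n : 0 < r n. Proof. by rewrite divr_gt0. Qed.

Let r_homo n m : (n <= m)%N -> r n <= r m.
Proof.
suff /nondecreasing_seqP : forall k, r k <= r k.+1 by exact.
move=> k; rewrite /r ler_pdivrMr // mulrAC ler_pdivlMr // -expr2 mulrC.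
exact: b_convex.
Qed.

Let bS n : b n.+1 = r n * b n. Proof. by rewrite /r divfK // gt_eqF. Qed.

(** With [m = 0] submultiplicativity reads [r n.*2.+1 * r n.*2 <= b 0]; the smaller factor thus has
    square at most [b 0], so it is at most [1 + b 0]. *)
Let r_ub n : r n <= 1 + b 0.
Proof.
apply: le_trans (r_homo (leq_addr n n)) _; rewrite addnn.
have := b_submul n 0; rewrite addn0 doubleS double0 !bS mulrA => h.
have {}h : r n.*2.+1 * r n.*2 <= b 0.
  by rewrite -(ler_pM2r (b_gt0 n.*2)) (le_trans h) // mulrC.
have h2 := r_homo (leqnSn n.*2).
have := r_gt0 n.*2; have := b_gt0 0; nra.
Qed.

(* [lam] is the limit of the nondecreasing ratios [b n.+1 / b n]; if [b n] were
   [o (lam ^+ n)], submultiplicativity would make it decay at a smaller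
   exponential rate. *)
Lemma log_convex_limit : exists lam beta : R,
  [/\ 0 < lam, 0 < beta, (forall n, beta * lam ^+ n <= b n),
      (forall n, b n.+1 <= lam * b n)
    & (fun n => b n / lam ^+ n) @ \oo --> beta].
Proof.
pose lam := sup (range r).
have rsup : has_sup (range r).
  split; first by exists (r 0), 0.
  by exists (1 + b 0) => _ [n _ <-].
have r_le n : r n <= lam by apply: ub_le_sup; [case: rsup|exists n].
have lam0 : 0 < lam by apply: lt_le_trans (r_le 0).
have bound n : lam ^+ (n.*2.+2) / 2 <= b n.*2.
  set N := n.*2.+2; set x := b n.*2.
  rewrite leNgt; apply/negP => xlt.
  have x0 : 0 < x by exact: b_gt0.
  have N0 : 0 < N%:R :> R by rewrite ltr0n.
  have N1 : 1 <= N%:R :> R by rewrite ler1n.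
  (* Bernoulli with [N * t = 1/2] gives [(1 - t) ^+ N >= 1/2], so the assumed [x < lam ^+ N / 2]
     becomes [x < mu ^+ N] for a rate [mu < lam]. *)
  pose t : R := (2 * N%:R)^-1.
  have Nt : N%:R * t = 2^-1 by rewrite /t; field; rewrite gt_eqF.
  have t0 : 0 < t by rewrite invr_gt0 mulr_gt0.
  have t1 : t <= 2^-1 by nra.
  pose mu := lam * (1 - t).
  have mu0 : 0 < mu by rewrite mulr_gt0 //; lra.
  have mulam : mu < lam by rewrite /mu; nra.
  have xmu : x < mu ^+ N.
    apply: lt_le_trans xlt _; rewrite exprMn ler_pM2l ?exprn_gt0 //.
    by apply: le_trans (bernoulli_ineq N _); rewrite ?Nt; lra.
  have [_ [k0 _ <-] muk0] := sup_gt (proj1 rsup) mulam.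
  have grow i : mu ^+ i * b k0 <= b (k0 + i)%N.
    elim: i => [|i IH]; first by rewrite expr0 mul1r addn0.
    rewrite addnS bS exprS -mulrA; apply: ler_pM => //.
    - exact: ltW.
    - by rewrite mulr_ge0 ?exprn_ge0 // ltW.
    - by rewrite (le_trans (ltW muk0)) // r_homo // leq_addr.
  (* Each use of submultiplicativity advances the index by [N = n.+1.*2] and costs a factor
     [x < mu ^+ N], whereas [grow] gives at least [mu ^+ N] per such step. *)
  have decay j : b (j * n.+1 + n).*2 <= x ^+ j.+1.
    elim: j => [|j IH]; first by rewrite mul0n add0n expr1.
    rewrite exprS [in leLHS](_ : _ + n = (n + (j * n.+1 + n)).+1)%N; last first.
      by rewrite mulSn -addnA addSn.
    by apply: le_trans (b_submul _ _) _; rewrite ler_pM2l.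
  (* Together [grow] and [decay] at the index [(j * n.+1 + n).*2] say [D <= (x / mu ^+ N) ^+ j].
     Adding [k0] to [j1] keeps this index above [k0], so the subtraction below is a true one. *)
  pose D := mu ^+ n.*2 * b k0 / (mu ^+ k0 * x).
  have D0 : 0 < D by rewrite divr_gt0 // mulr_gt0 // exprn_gt0.
  have y01 : 0 <= x / mu ^+ N < 1.
    by rewrite divr_ge0 ?ltr_pdivrMr ?exprn_gt0 ?mul1r // ltW // exprn_gt0.
  have [j1 _ hj1] := geometric_lt y01 D0.
  pose j := (j1 + k0)%N.
  have := hj1 j (leq_addr _ _); apply/negP; rewrite -leNgt.
  have k0j : (k0 <= (j * n.+1 + n).*2)%N.
    rewrite -addnn; apply: leq_trans (leq_addr _ _).
    apply: leq_trans (leq_addr _ _); apply: leq_trans (leq_addl j1 k0) _.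
    exact: leq_pmulr.
  have := grow ((j * n.+1 + n).*2 - k0)%N; rewrite subnKC // => h.
  have {}h := le_trans h (decay j).
  have e : mu ^+ k0 * mu ^+ ((j * n.+1 + n).*2 - k0) =
           mu ^+ n.*2 * (mu ^+ N) ^+ j.
    rewrite -exprD subnKC // -exprM -exprD; congr (_ ^+ _).
    by rewrite /N -doubleS -doubleMl -doubleD addnC [(n.+1 * j)%N]mulnC.
  rewrite /D expr_div_n ler_pdivrMr ?mulr_gt0 ?exprn_gt0 //.
  rewrite mulrAC ler_pdivlMr ?exprn_gt0 // ?exprn_gt0 //.
  rewrite mulrAC -e [leRHS](_ : _ = mu ^+ k0 * x ^+ j.+1).
    by rewrite -mulrA ler_pM2l // exprn_gt0.
  by rewrite exprS; ring.
pose be n := b n / lam ^+ n.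
have beS n : be n.+1 <= be n.
  rewrite /be exprS invfM mulrA ler_pM2r ?invr_gt0 ?exprn_gt0 //.
  by rewrite ler_pdivrMr // bS mulrC ler_pM2l.
have behomo : {homo be : n m / (n <= m)%N >-> m <= n} by apply/nonincreasing_seqP.
(* [bound] covers even indices; monotonicity of [be] from [n] to [n.*2] covers the others. *)
have belb n : lam ^+ 2 / 2 <= be n.
  apply: le_trans (behomo n n.*2 _); last by rewrite -addnn leq_addr.
  rewrite /be ler_pdivlMr ?exprn_gt0 // mulrAC -exprD addnC addn2.
  exact: bound.
have bhas : has_lbound (range be) by exists (lam ^+ 2 / 2) => _ [n _ <-].
exists lam, (inf (range be)); split => //.
- apply: (@lt_le_trans _ _ (lam ^+ 2 / 2)); first by rewrite divr_gt0 // exprn_gt0.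
  by apply: lb_le_inf; [exists (be 0), 0|move=> _ [n _ <-]].
- move=> n; rewrite -ler_pdivlMr ?exprn_gt0 //.
  by apply: ge_inf => //; exists n.
- by move=> n; rewrite bS ler_pM2r.
- exact: nonincreasing_cvgn.
Qed.

End LogConvex.

(** * Limits with squared error bounds, and uniformity over compact sets *)

Lemma sqr_lt_norm (R : realType) (x d : R) : 0 < d -> x ^+ 2 < d ^+ 2 -> `|x| < d.
Proof.
move=> d0 h; rewrite -(ltr_pXn2r (n := 2)) ?nnegrE ?normr_ge0 ?(ltW d0) //.
by rewrite real_normK ?num_real.
Qed.

Lemma cvg_sqr_dist (R : realType) (x e : nat -> R) (l : R) :
  (forall n, (x n - l) ^+ 2 <= e n) -> e @ \oo --> 0 -> x @ \oo --> l.
Proof.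
move=> xe e0; apply/cvgrPdist_lt => d d0.
have d2 : 0 < d ^+ 2 by rewrite exprn_gt0.
have /cvgrPdist_lt /(_ _ d2) := e0; apply: filterS => n.
rewrite sub0r normrN => /(le_lt_trans (ler_norm _)) /(le_lt_trans (xe n)).
by rewrite distrC; exact: sqr_lt_norm.
Qed.

(** The rate [e] survives in the conclusion because the eigenfunction argument needs convergence
    uniform over [K]. Errors are squared since they come from Cauchy-Schwarz. *)
Lemma cauchy_sqr_dist (R : realType) (x e : nat -> R) :
  (forall N n m, (N <= n)%N -> (N <= m)%N -> (x n - x m) ^+ 2 <= e N) ->
  e @ \oo --> 0 ->
  exists l, forall N n, (N <= n)%N -> (x n - l) ^+ 2 <= e N.
Proof.
move=> xe e0.
have cx : cvg (x @ \oo).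
  apply/cauchy_cvgP/cauchy_exP => d d0.
  have d2 : 0 < d ^+ 2 by rewrite exprn_gt0.
  have /cvgrPdist_lt /(_ _ d2) [N _ hN] := e0.
  exists (x N); exists N => // n /= Nn.
  rewrite -ball_normE /=.
  have := hN N (leqnn N); rewrite /= sub0r normrN => /(le_lt_trans (ler_norm _)).
  move=> /(le_lt_trans (xe N N n (leqnn N) Nn)).
  exact: sqr_lt_norm.
exists (lim (x @ \oo)) => N n Nn.
have h : (fun m => (x n - x m) ^+ 2) @ \oo --> (x n - lim (x @ \oo)) ^+ 2.
  have h1 : (fun m => x n - x m) @ \oo --> x n - lim (x @ \oo).
    by apply: cvgB => //; exact: cvg_cst.
  by under eq_fun do rewrite expr2; rewrite expr2; exact: cvgM.
have <- := cvg_lim _ h; last exact: norm_hausdorff.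
apply: limr_le; first by apply/cvg_ex; eexists; exact: h.
by exists N => // m /= Nm; exact: xe.
Qed.

(** Tolerance [e / (N + 1)] against a constant [N] that may be 0. *)
Lemma ler_mul_div_add1 (R : realType) (N e : R) :
  0 <= N -> 0 <= e -> N * (e / (N + 1)) <= e.
Proof. by move=> N0 e0; rewrite mulrA ler_pdivrMr ?ltr_wpDl //; nra. Qed.

Lemma continuous_distP (R : realType) (Y : topologicalType) (u : Y -> R) :
  continuous u <->
  forall x (e : R), 0 < e -> \forall y \near x, `|u y - u x| <= e.
Proof.
split=> [cu x e e0|h x].
  have /cvgrPdist_le /(_ e e0) := cu x.
  by apply: filterS => y; rewrite distrC.
apply/cvgrPdist_le => e e0; apply: filterS (h x e e0) => y.
by rewrite distrC.
Qed.

(** Tube argument: on a product neighbourhood of [(x, y0)] both [F x' y] and [F x' y0] are within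
    [e / 2] of [F x y0], and compactness makes the neighbourhood of [y0] uniform in [x]. *)
Lemma compact_near_dist (R : realType) (X Y : topologicalType)
    (C : set X) (F : X -> Y -> R) :
  compact C -> continuous (fun z : X * Y => F z.1 z.2) ->
  forall (y0 : Y) (e : R), 0 < e ->
    \forall y \near y0, forall x, C x -> `|F x y - F x y0| <= e.
Proof.
move=> cC cF y0 e e0.
apply: ((compact_near_coveringP C).1 cC Y (nbhs y0)
  (fun y x => `|F x y - F x y0| <= e)) => x Cx.
have e2 : 0 < e / 2 by rewrite divr_gt0.
have /continuous_distP /(_ (x, y0) _ e2) [[A B] /= [nA nB] AB] := cF.
exists (A, B) => // -[x' y'] /= [Ax By].
rewrite (le_trans (ler_distD (F x y0) _ _)) // [leRHS]splitr.
apply: lerD; first exact: (AB (x', y')).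
rewrite distrC; apply: (AB (x', y0)); split => //=.
exact: nbhs_singleton.
Qed.

Lemma continuous_curryl (X Y Z : topologicalType) (F : X * Y -> Z) (x : X) :
  continuous F -> continuous (fun y => F (x, y)).
Proof.
move=> cF y; apply: (@continuous_comp _ _ _ (fun y => (x, y)) F); last exact: cF.
by apply: cvg_pair => //=; exact: cvg_cst.
Qed.

Lemma continuous_curryr (X Y Z : topologicalType) (F : X * Y -> Z) (y : Y) :
  continuous F -> continuous (fun x => F (x, y)).
Proof.
move=> cF x; apply: (@continuous_comp _ _ _ (fun x => (x, y)) F); last exact: cF.
by apply: cvg_pair => //=; exact: cvg_cst.
Qed.

Lemma continuous_realD (R : realType) (Y : topologicalType) (u v : Y -> R) :
  continuous u -> continuous v -> continuous (fun y => u y + v y).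
Proof. by move=> cu cv y; apply: cvgD; [exact: cu|exact: cv]. Qed.

Lemma continuous_realB (R : realType) (Y : topologicalType) (u v : Y -> R) :
  continuous u -> continuous v -> continuous (fun y => u y - v y).
Proof. by move=> cu cv y; apply: cvgB; [exact: cu|exact: cv]. Qed.

Lemma continuous_realM (R : realType) (Y : topologicalType) (u v : Y -> R) :
  continuous u -> continuous v -> continuous (fun y => u y * v y).
Proof. by move=> cu cv y; apply: cvgM; [exact: cu|exact: cv]. Qed.

(** * Borel measurability and integrals under measure-preserving maps *)

Lemma within_continuous_borel_measurable (R : realType) (G : ptopologicalType)
    (D : set G) (u : G -> R) :
  measurable (D : set (borel G)) -> {within D, continuous u} ->
  measurable_fun (D : set (borel G)) (u : borel G -> R).
Proof.
move=> mD /continuousP cu.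
apply: (measurability _ (RGenOpens.measurableE R)).
move=> _ [_ [a [b ->] <-]] /=.
have /open_subspaceP [V oV] : open ((u : subspace D -> R) @^-1` `]a, b[).
  by apply: cu; exact: interval_open.
rewrite setIC => VD; rewrite setIC in VD.
rewrite [X in measurable X](_ : _ = (V : set (borel G)) `&` D); last first.
  by rewrite VD setIC.
by apply: measurableI => //; exact: sub_sigma_algebra.
Qed.

Lemma continuous_borel_measurable (R : realType) (G : ptopologicalType)
    (u : G -> R) :
  continuous u -> measurable_fun [set: borel G] (u : borel G -> R).
Proof.
move=> cu; apply: within_continuous_borel_measurable; first exact: measurableT.
exact: continuous_subspaceT.
Qed.

Lemma continuous_borel (X Y : ptopologicalType) (f : X -> Y) :
  continuous f -> measurable_fun [set: borel X] (f : borel X -> borel Y).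
Proof.
move=> /continuousP cf; apply: (@measurability _ _ (borel X) (borel Y) _ _ (@open Y)) => //.
move=> _ [U oU <-]; rewrite setTI; apply: sub_sigma_algebra.
exact: cf.
Qed.

Lemma compact_borel (G : ptopologicalType) (K : set G) :
  hausdorff_space G -> compact K -> measurable (K : set (borel G)).
Proof.
move=> hG cK; rewrite -(setCK K); apply: measurableC.
by apply: sub_sigma_algebra; apply: closed_openC; exact: compact_closed.
Qed.

(** Pushforward settles nonnegative functions; positive and negative parts then agree separately, so
    the identity also covers infinite integrals. *)
Lemma Rintegral_invariant (R : realType) d (T : measurableType d)
    (mu : {measure set T -> \bar R}) (f : T -> T) (u : T -> R) :
  measurable_fun setT f -> measurable_fun setT u ->
  (forall B, measurable B -> mu (f @^-1` B) = mu B) ->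
  \int[mu]_x u (f x) = \int[mu]_x u x.
Proof.
move=> mf mu' inv; rewrite /Rintegral; congr fine.
have pos (h : T -> \bar R) : measurable_fun setT h -> (forall x, (0 <= h x)%E) ->
    (\int[mu]_x h (f x) = \int[mu]_x h x)%E.
  move=> mh h0.
  have := @ge0_integral_pushforward _ _ _ _ _ f mf mu setT h measurableT mh (fun y _ => h0 y).
  rewrite preimage_setT => <-; apply: eq_measure_integral => A mA _ /=.
  by rewrite /pushforward inv.
have mE : measurable_fun setT (EFin \o u) by exact/measurable_EFinP.
rewrite integralE [RHS]integralE; congr (_ - _)%E.
- transitivity (\int[mu]_x ((EFin \o u)^\+%E (f x)))%E.
    by apply: eq_integral => x _; rewrite !funeposE.
  by apply: pos => //; exact: measurable_funepos.
- transitivity (\int[mu]_x ((EFin \o u)^\-%E (f x)))%E.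
    by apply: eq_integral => x _; rewrite !funenegE.
  by apply: pos => //; exact: measurable_funeneg.
Qed.

(** * Haar integrals on a compact group *)

Section Haar.
Variables (R : realType) (G : lieGroup R) (K : set G).
Variable mK : {measure set (borel G) -> \bar R}.
Hypothesis K_subgroup : subgroup K.
Hypothesis K_compact : compact K.
Hypothesis K_haar : haar_measure K mK.

Definition haar_mean (u : G -> R) : R :=
  \int[mK]_(x in (K : set (borel G))) u x.
Local Notation J := haar_mean.

(** Larger than the continuous functions because the exchange argument below cuts functions by
    indicators of open sets. Bounds are asked on [K] only, the region seen by the integral. *)
Definition bounded_borel (u : G -> R) : Prop :=
  measurable_fun [set: borel G] (u : borel G -> R) /\
  exists B, forall x, K x -> `|u x| <= B.
Local Notation bm := bounded_borel.

Lemma K_borel : measurable (K : set (borel G)).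
Proof. by apply: compact_borel => //; exact: lie_hausdorff. Qed.

Let K1 : K 1%g. Proof. by case: K_subgroup. Qed.

Lemma continuous_bounded_borel u : continuous u -> bm u.
Proof.
move=> cu; split; first exact: continuous_borel_measurable.
have [||c cK h] := @compact_EVT_max _ R (fun x => `|u x|) K _ K_compact.
- by exists 1%g.
- apply: continuous_subspaceT => x; apply: cvg_norm; exact: cu.
by exists `|u c| => x Kx; apply: h; rewrite inE.
Qed.

Lemma bounded_borel_cst c : bm (fun=> c).
Proof. by apply: continuous_bounded_borel; exact: cst_continuous. Qed.

Lemma bounded_borelD u v : bm u -> bm v -> bm (fun x => u x + v x).
Proof.
move=> [mu [B uB]] [mv [C vC]]; split; first exact: measurable_funD.
exists (B + C) => x Kx; apply: le_trans (ler_normD _ _) _.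
by apply: lerD; [exact: uB|exact: vC].
Qed.

Lemma bounded_borelM u v : bm u -> bm v -> bm (fun x => u x * v x).
Proof.
move=> [mu [B uB]] [mv [C vC]]; split; first exact: measurable_funM.
by exists (B * C) => x Kx; rewrite normrM ler_pM // ?uB ?vC.
Qed.

Lemma bounded_borelZ c u : bm u -> bm (fun x => c * u x).
Proof. by move=> bu; apply: bounded_borelM => //; exact: bounded_borel_cst. Qed.

Lemma bounded_borelB u v : bm u -> bm v -> bm (fun x => u x - v x).
Proof.
move=> bu bv; rewrite (_ : (fun x => _) = (fun x => u x + -1 * v x)).
  by apply: bounded_borelD => //; exact: bounded_borelZ.
by apply/funext => x; rewrite mulN1r.
Qed.

Lemma bounded_borel_norm u : bm u -> bm (fun x => `|u x|).
Proof.
move=> [mu [B uB]]; split; last by exists B => x Kx; rewrite normr_id uB.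
exact: measurableT_comp.
Qed.

Lemma bounded_borel_indic (U : set G) : open U -> bm (\1_U).
Proof.
move=> oU; split; first by apply: measurable_indic; exact: sub_sigma_algebra.
by exists 1 => x _; rewrite indicE; case: (_ \in _); rewrite ?normr1 ?normr0.
Qed.

Let haar_fin : (mK K < +oo)%E. Proof. by case: K_haar => -> _ _; rewrite ltry. Qed.

Lemma haar_integrable u : bm u -> mK.-integrable (K : set (borel G)) (EFin \o (u : borel G -> R)).
Proof.
move=> [mu [B uB]]; apply: measurable_bounded_integrable => //.
- exact: K_borel.
- exact: measurable_funTS.
exists B; split; first exact: num_real.
by move=> M BM x Kx; exact: le_trans (uB _ Kx) (ltW BM).
Qed.

Lemma eq_haar_mean u v : (forall x, K x -> u x = v x) -> J u = J v.
Proof. by move=> uv; apply: eq_Rintegral => x /set_mem /uv. Qed.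

Lemma haar_meanD u v : bm u -> bm v -> J (fun x => u x + v x) = J u + J v.
Proof.
by move=> bu bv; rewrite /haar_mean RintegralD //;
  [exact: K_borel|exact: haar_integrable|exact: haar_integrable].
Qed.

Lemma haar_meanB u v : bm u -> bm v -> J (fun x => u x - v x) = J u - J v.
Proof.
by move=> bu bv; rewrite /haar_mean RintegralB //;
  [exact: K_borel|exact: haar_integrable|exact: haar_integrable].
Qed.

Lemma haar_meanZ c u : bm u -> J (fun x => c * u x) = c * J u.
Proof.
by move=> bu; rewrite /haar_mean RintegralZl //; [exact: K_borel|exact: haar_integrable].
Qed.

Lemma haar_mean_cst c : J (fun=> c) = c.
Proof.
by rewrite /haar_mean Rintegral_cst; [case: K_haar => -> _ _; rewrite mulr1|exact: K_borel].
Qed.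

Lemma haar_mean_ge0 u : (forall x, K x -> 0 <= u x) -> 0 <= J u.
Proof. by move=> u0; apply: Rintegral_ge0. Qed.

Lemma le_haar_mean u v : bm u -> bm v -> (forall x, K x -> u x <= v x) -> J u <= J v.
Proof.
by move=> bu bv uv; apply: le_Rintegral => //;
  [exact: K_borel|exact: haar_integrable|exact: haar_integrable].
Qed.

Lemma haar_mean_norm u : bm u -> `|J u| <= J (fun x => `|u x|).
Proof.
by move=> bu; apply: le_normr_Rintegral; [exact: K_borel|exact: haar_integrable].
Qed.

Lemma haar_mean_le_norm u v : bm u -> bm v -> (forall x, K x -> `|u x| <= v x) ->
  `|J u| <= J v.
Proof.
move=> bu bv uv; apply: le_trans (haar_mean_norm bu) _.
by apply: le_haar_mean => //; exact: bounded_borel_norm.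
Qed.

Lemma bounded_borel_sum (I : Type) (s : seq I) (u : I -> G -> R) :
  (forall i, bm (u i)) -> bm (fun x => \sum_(i <- s) u i x).
Proof.
move=> bu; elim: s => [|i s IH].
  rewrite (_ : (fun x => _) = fun=> 0); first exact: bounded_borel_cst.
  by apply/funext => x; rewrite big_nil.
rewrite (_ : (fun x => _) = fun x => u i x + \sum_(j <- s) u j x).
  exact: bounded_borelD.
by apply/funext => x; rewrite big_cons.
Qed.

Lemma haar_mean_sum (I : Type) (s : seq I) (u : I -> G -> R) :
  (forall i, bm (u i)) ->
  J (fun x => \sum_(i <- s) u i x) = \sum_(i <- s) J (u i).
Proof.
move=> bu; elim: s => [|i s IH].
  rewrite big_nil -[RHS](haar_mean_cst 0); apply: eq_haar_mean => x _.
  by rewrite big_nil.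
rewrite big_cons -IH -haar_meanD //; last exact: bounded_borel_sum.
by apply: eq_haar_mean => x _; rewrite big_cons.
Qed.

Lemma mulg_left_continuous (a : G) : continuous (fun x : G => (a * x)%g).
Proof.
exact: (continuous_curryl (x := a) mulg_continuous).
Qed.

Lemma K_mull a x : K a -> K (a * x)%g <-> K x.
Proof.
move=> Ka; case: K_subgroup => _ KM KV; split=> [Kax|Kx]; last exact: KM.
by rewrite -(mulKg a x); apply: KM => //; exact: KV.
Qed.

(** [mK] is a measure on [G], so the integral over [K] is rewritten as one over [G] of the extension
    by zero, which commutes with translation by [a] in [K]. Measurability on [K] alone suits
    sections, which are controlled only there. *)
Lemma haar_mean_measurable_mull a (u : G -> R) : K a ->
  measurable_fun (K : set (borel G)) (u : borel G -> R) ->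
  J (fun x => u (a * x)%g) = J u.
Proof.
move=> Ka mu; rewrite /haar_mean [LHS]Rintegral_mkcond [RHS]Rintegral_mkcond.
have mu' : measurable_fun [set: borel G] ((u : borel G -> R) \_ (K : set (borel G))).
  by apply/(measurable_restrictT (u : borel G -> R) K_borel).
rewrite -(Rintegral_invariant (f := fun x : borel G => ((a : G) * x)%g) _ mu').
- apply: eq_Rintegral => x _; rewrite !patchE.
  have e : (x \in (K : set (borel G))) = ((a * x)%g \in (K : set (borel G))).
    by apply/idP/idP; rewrite !inE /= => /(K_mull _ Ka).
  by rewrite e.
- by apply: continuous_borel; exact: mulg_left_continuous.
- by move=> B mB; case: K_haar => _ _; exact.
Qed.

Lemma haar_mean_mull a u : K a -> bm u -> J (fun x => u (a * x)%g) = J u.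
Proof.
by move=> Ka [mu _]; apply: haar_mean_measurable_mull => //; exact: measurable_funTS.
Qed.

Lemma haar_mean_CS u v : bm u -> bm v ->
  J (fun x => u x * v x) ^+ 2 <= J (fun x => u x ^+ 2) * J (fun x => v x ^+ 2).
Proof.
move=> bu bv.
set a := J (fun x => u x ^+ 2); set b := J (fun x => u x * v x).
set c := J (fun x => v x ^+ 2).
have buu : bm (fun x => u x ^+ 2) by exact: bounded_borelM.
have bvv : bm (fun x => v x ^+ 2) by exact: bounded_borelM.
have buv : bm (fun x => u x * v x) by exact: bounded_borelM.
have q s t : 0 <= s ^+ 2 * a + 2 * s * t * b + t ^+ 2 * c.
  have -> : s ^+ 2 * a + 2 * s * t * b + t ^+ 2 * c =
      J (fun x => (s * u x + t * v x) ^+ 2).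
    rewrite /a /b /c -!haar_meanZ // -!haar_meanD //; first last.
    all: repeat (apply: bounded_borelD || apply: bounded_borelZ); rewrite //.
    by apply: eq_haar_mean => x _; ring.
  by apply: haar_mean_ge0 => x _; exact: sqr_ge0.
have a0 : 0 <= a by apply: haar_mean_ge0 => x _; exact: sqr_ge0.
have c0 : 0 <= c by apply: haar_mean_ge0 => x _; exact: sqr_ge0.
have [a_eq0|a_neq0] := eqVneq a 0.
  (* For [a = 0] the form at this point equals [- b ^+ 2 * (c + 2)]. *)
  have := q (- (c + 1)) b; rewrite a_eq0 mul0r => h.
  have : b ^+ 2 * (c + 2) <= 0 by rewrite -oppr_ge0 (le_trans h) //; lra.
  by rewrite pmulr_lle0 //; lra.
have a1 : 0 < a by rewrite lt_def a_neq0.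
have := q b (- a).
have -> : b ^+ 2 * a + 2 * b * - a * b + (- a) ^+ 2 * c = a * (a * c - b ^+ 2).
  by ring.
by rewrite pmulr_rge0 // subr_ge0.
Qed.

Lemma compact_nbhs_cover (U : G -> set G) : (forall x, nbhs x (U x)) ->
  exists s : seq G, (forall x, x \in s -> K x) /\
    forall y, K y -> exists2 x, x \in s & U x y.
Proof.
move=> nU; have := K_compact; rewrite compact_cover.
move=> /(_ G K (fun x => (U x)°)) [|x Kx|D DK cD].
- by move=> x _; exact: open_interior.
- by exists x => //; exact: nU.
exists (finmap.enum_fset D); split=> [x xD|y Ky]; first by apply/set_mem/DK.
have [x /= xD /interior_subset Uxy] := cD _ Ky.
by exists x.
Qed.

(** Finitely many translates of the set where [u] exceeds [u 1 / 2] cover [K]. The sum of the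
    corresponding translates of [u] has mean at least [u 1 / 2], and by invariance each of them has
    mean [J u]. *)
Lemma haar_mean_gt0 (u : G -> R) : continuous u -> (forall x, K x -> 0 <= u x) ->
  0 < u 1%g -> 0 < J u.
Proof.
move=> cu u0 u1.
pose U (k : G) := [set x : G | u 1%g / 2 < u (k^-1 * x)%g].
have cuk k : continuous (fun x => u (k^-1 * x)%g).
  move=> x; apply: continuous_comp; last exact: cu.
  exact: mulg_left_continuous.
have nU k : nbhs k (U k).
  have : (fun x => u (k^-1 * x)%g) x @[x --> k] --> u 1%g.
    by rewrite -[in X in _ --> u X](mulVg k); exact: cuk.
  move/cvgrPdist_lt => /(_ (u 1%g / 2)) h.
  apply: filterS (h _) => [x|]; last by rewrite divr_gt0.
  by rewrite /U /= ltr_distlC; lra.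
have [s [sK sU]] := compact_nbhs_cover nU.
have bmk k : bm (fun x => u (k^-1 * x)%g) by exact: continuous_bounded_borel.
have : u 1%g / 2 <= J (fun x => \sum_(k <- s) u (k^-1 * x)%g).
  rewrite -[leLHS](haar_mean_cst (u 1%g / 2)); apply: le_haar_mean.
  - exact: bounded_borel_cst.
  - exact: bounded_borel_sum.
  move=> x Kx; have [k ks] := sU x Kx; rewrite /U /= => /ltW ukx.
  rewrite (big_rem k ks) /=; apply: le_trans ukx _; rewrite lerDl.
  rewrite big_seq; apply: sumr_ge0 => j /mem_rem js; apply: u0.
  by apply/K_mull => //; case: K_subgroup => _ _; apply; exact: sK.
rewrite haar_mean_sum // big_seq.
under eq_bigr => k ks.
  have Kk : K k^-1%g by case: K_subgroup => _ _; apply; exact: sK.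
  rewrite (haar_mean_mull Kk (continuous_bounded_borel cu)).
  over.
rewrite lt_def haar_mean_ge0 // andbT => h; apply: contraL h => /eqP ->.
by rewrite big1 // -ltNge divr_gt0.
Qed.

Lemma haar_mean_continuous (Y : topologicalType) (phi : G -> R)
    (F : Y -> G -> R) :
  bm phi -> continuous (fun z : Y * G => F z.1 z.2) ->
  continuous (fun y => J (fun k => phi k * F y k)).
Proof.
move=> bphi cF.
have cFy y : continuous (F y) by exact: (continuous_curryl (x := y) cF).
have bFy y : bm (F y) by exact: continuous_bounded_borel.
apply/continuous_distP => y0 e e0.
pose C := J (fun k => `|phi k|).
have C0 : 0 <= C by exact: haar_mean_ge0.
have cF' : continuous (fun z : G * Y => F z.2 z.1).
  move=> z; apply: (@continuous_comp _ _ _ (fun z => (z.2, z.1)) (fun z => F z.1 z.2)).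
    by apply: cvg_pair => //=; [exact: cvg_snd|exact: cvg_fst].
  exact: cF.
have := @compact_near_dist R G Y K (fun k y => F y k) K_compact cF' y0 (e / (C + 1)) _.
move=> /(_ ltac:(by rewrite divr_gt0 // ltr_wpDl)); apply: filterS => y yF.
rewrite -haar_meanB; try exact: bounded_borelM.
apply: le_trans (_ : J (fun k => `|phi k| * (e / (C + 1))) <= e); last first.
  under eq_fun do rewrite mulrC.
  rewrite haar_meanZ; last exact: bounded_borel_norm.
  by rewrite mulrC ler_mul_div_add1 // ltW.
apply: haar_mean_le_norm.
- by apply: bounded_borelB; exact: bounded_borelM.
- apply: bounded_borelM; first exact: bounded_borel_norm.
  exact: bounded_borel_cst.
move=> k Kk; rewrite -mulrBr normrM ler_wpM2l //.
exact: yF.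
Qed.

(** * Exchanging a functional bounded in the sup norm over [S] with a Haar integral *)

Section Interchange.
Variables (Y : Type) (S : set Y) (D : (Y -> R) -> Prop) (L : (Y -> R) -> R) (C : R).
Variable F : Y -> G -> R.
Hypothesis D_lin : forall a u v, D u -> D v -> D (fun y => a * u y + v y).
Hypothesis L_lin : forall a u v, D u -> D v ->
  L (fun y => a * u y + v y) = a * L u + L v.
Hypothesis L_bound : forall u B, D u -> (forall y, S y -> `|u y| <= B) ->
  `|L u| <= C * B.
Hypothesis D_F : forall k, D (F ^~ k).
Hypothesis D_J : forall phi, bm phi -> D (fun y => J (fun k => phi k * F y k)).
Hypothesis F_continuous : forall y, continuous (F y).
Hypothesis F_equi : forall k0 (e : R), 0 < e ->
  \forall k \near k0, forall y, S y -> `|F y k - F y k0| <= e.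

Let DB u v : D u -> D v -> D (fun y => u y - v y).
Proof.
move=> Du Dv; rewrite (_ : (fun y => _) = (fun y => -1 * v y + u y)).
  exact: D_lin.
by apply/funext => y; rewrite mulN1r addrC.
Qed.

Let LB u v : D u -> D v -> L (fun y => u y - v y) = L u - L v.
Proof.
move=> Du Dv; rewrite (_ : (fun y => _) = (fun y => -1 * v y + u y)).
  by rewrite L_lin // mulN1r addrC.
by apply/funext => y; rewrite mulN1r addrC.
Qed.

Let C_ge0 : 0 <= C.
Proof.
have D0 : D (fun=> 0).
  rewrite (_ : (fun=> 0) = (fun y => F y 1%g - F y 1%g)); first exact: DB.
  by apply/funext => y; rewrite subrr.
have := L_bound D0 (B := 1); rewrite mulr1 => h.
by apply: le_trans (h _) => // y _; rewrite normr0.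
Qed.

Let LF_near k0 (e : R) : 0 < e ->
  \forall k \near k0, `|L (F ^~ k) - L (F ^~ k0)| <= C * e.
Proof.
move=> e0; apply: filterS (F_equi k0 e0) => k kF.
by rewrite -LB //; apply: L_bound; [exact: DB|].
Qed.

Lemma bounded_functional_continuous : continuous (fun k => L (F ^~ k)).
Proof.
apply/continuous_distP => k0 e e0.
have C1 : 0 < C + 1 by rewrite ltr_wpDl.
have := LF_near k0 (e := e / (C + 1)) ltac:(by rewrite divr_gt0).
apply: filterS => k /le_trans; apply.
by rewrite ler_mul_div_add1 // ltW.
Qed.

Let bF y : bm (F y). Proof. exact: continuous_bounded_borel. Qed.
Let bLF : bm (fun k => L (F ^~ k)).
Proof. exact/continuous_bounded_borel/bounded_functional_continuous. Qed.

Let err phi := L (fun y => J (fun k => phi k * F y k)) -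
               J (fun k => phi k * L (F ^~ k)).

Let errD phi psi : bm phi -> bm psi ->
  err (fun k => phi k + psi k) = err phi + err psi.
Proof.
move=> bp bq; rewrite /err.
have -> : (fun y => J (fun k => (phi k + psi k) * F y k)) =
    (fun y => 1 * J (fun k => phi k * F y k) + J (fun k => psi k * F y k)).
  apply/funext => y; rewrite mul1r -haar_meanD; try exact: bounded_borelM.
  by apply: eq_haar_mean => k _; rewrite mulrDl.
rewrite L_lin; try exact: D_J.
have -> : J (fun k => (phi k + psi k) * L (F^~ k)) =
    J (fun k => phi k * L (F^~ k)) + J (fun k => psi k * L (F^~ k)).
  rewrite -haar_meanD; try exact: bounded_borelM.
  by apply: eq_haar_mean => k _; rewrite mulrDl.
by ring.
Qed.

Let err_local phi k0 (e : R) (U : set G) : 0 < e -> bm phi ->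
  (forall k, U k -> forall y, S y -> `|F y k - F y k0| <= e) ->
  (forall k, ~ U k -> phi k = 0) ->
  `|err phi| <= 2 * C * e * J (fun k => `|phi k|).
Proof.
move=> e0 bp UF phi0.
have bnp := bounded_borel_norm bp.
have LU k : U k -> `|L (F ^~ k) - L (F ^~ k0)| <= C * e.
  by move=> Uk; rewrite -LB //; apply: L_bound; [exact: DB|exact: UF].
pose g y := J (fun k => phi k * F y k) - J phi * F y k0.
have gE y : g y = J (fun k => phi k * (F y k - F y k0)).
  rewrite /g mulrC -haar_meanZ // -haar_meanB; try exact: bounded_borelM.
    by apply: eq_haar_mean => k _; ring.
  exact: bounded_borelZ.
have Dg : D g.
  apply: DB; first exact: D_J.
  (* Closure of [D] is given in the form [a * u + v]; this writes a scalar multiple in that form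
     using [F] alone. *)
  rewrite (_ : (fun y => _) = (fun y => (J phi - 1) * F y k0 + F y k0)).
    exact: D_lin.
  by apply/funext => y; ring.
have Lg : L g = L (fun y => J (fun k => phi k * F y k)) - J phi * L (F ^~ k0).
  rewrite /g LB; last 2 first.
  - exact: D_J.
  - rewrite (_ : (fun y => _) = (fun y => (J phi - 1) * F y k0 + F y k0)).
      exact: D_lin.
    by apply/funext => y; ring.
  congr (_ - _); rewrite (_ : (fun y => _) = (fun y => (J phi - 1) * F y k0 + F y k0)).
    by rewrite L_lin //; ring.
  by apply/funext => y; ring.
have Lg_le : `|L g| <= C * (e * J (fun k => `|phi k|)).
  apply: L_bound => // y Sy; rewrite gE -haar_meanZ //.
  apply: haar_mean_le_norm.
  - apply: bounded_borelM => //; apply: bounded_borelB => //.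
    exact: bounded_borel_cst.
  - exact: bounded_borelZ.
  move=> k Kk; rewrite normrM mulrC.
  have [Uk|/phi0 ->] := pselect (U k); last by rewrite normr0 !mulr0.
  by rewrite ler_wpM2r // UF.
have h_le : `|J (fun k => phi k * (L (F ^~ k) - L (F ^~ k0)))| <=
    C * e * J (fun k => `|phi k|).
  rewrite -haar_meanZ //; apply: haar_mean_le_norm.
  - apply: bounded_borelM => //; apply: bounded_borelB => //.
    exact: bounded_borel_cst.
  - exact: bounded_borelZ.
  move=> k Kk; rewrite normrM mulrC.
  have [Uk|/phi0 ->] := pselect (U k); last by rewrite normr0 !mulr0.
  by rewrite ler_wpM2r // LU.
have -> : err phi = L g - J (fun k => phi k * (L (F ^~ k) - L (F ^~ k0))).
  rewrite Lg /err.
  have -> : J (fun k => phi k * (L (F ^~ k) - L (F ^~ k0))) =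
      J (fun k => phi k * L (F ^~ k)) - J phi * L (F ^~ k0).
    rewrite [J phi * _]mulrC -haar_meanZ // -haar_meanB; try exact: bounded_borelM.
      by apply: eq_haar_mean => k _; ring.
    exact: bounded_borelZ.
  by ring.
apply: le_trans (ler_normB _ _) _; apply: le_trans (lerD Lg_le h_le) _.
by rewrite le_eqVlt; apply/orP; left; apply/eqP; ring.
Qed.

(* The error [err phi] is additive in [phi], and is [O (e)] times the L^1 norm of
   [phi] when [F] varies by at most [e] over the support of [phi]. *)
Lemma haar_mean_interchange phi : bm phi ->
  L (fun y => J (fun k => phi k * F y k)) = J (fun k => phi k * L (F ^~ k)).
Proof.
move=> bp; apply/eqP; rewrite -subr_eq0 -/(err phi) -normr_le0.
suff h (e : R) : 0 < e -> `|err phi| <= 2 * C * e * J (fun k => `|phi k|).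
  apply/ler_addgt0Pr => e e0; rewrite add0r.
  pose N := 2 * C * J (fun k => `|phi k|).
  have N0 : 0 <= N by rewrite !mulr_ge0 // haar_mean_ge0.
  have N1 : 0 < N + 1 by rewrite ltr_wpDl.
  apply: le_trans (h (e / (N + 1)) _) _; first by rewrite divr_gt0.
  by rewrite mulrAC -/N ler_mul_div_add1 // ltW.
move=> e0.
pose U k0 : set G := ([set k | forall y, S y -> `|F y k - F y k0| <= e])°.
have nU k0 : nbhs k0 (U k0) by apply/nbhs_interior/F_equi.
have oU k0 : open (U k0) by exact: open_interior.
have UF k0 k : U k0 k -> forall y, S y -> `|F y k - F y k0| <= e.
  by move/interior_subset.
have [s [_ sU]] := compact_nbhs_cover nU.
have {}sU y : K y -> exists2 x, x \in s & U x y by exact: sU.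
suff : forall psi, bm psi -> (forall k, K k -> (forall x, x \in s -> ~ U x k) -> psi k = 0) ->
   `|err psi| <= 2 * C * e * J (fun k => `|psi k|).
  by apply => // k Kk h; have [x xs] := sU k Kk; move/h: xs.
(* Induction on the centres of a cover of the support: split off the part of [psi] in [U x]. The two
   parts have disjoint supports, so their L^1 norms add up exactly and the number of pieces does not
   enter the bound. *)
elim: {sU} s => [|x s IH] psi bpsi psi0.
  have psiK k : K k -> psi k = 0 by move=> Kk; exact: psi0.
  suff -> : err psi = 0.
    by rewrite normr0 mulr_ge0 ?haar_mean_ge0 // !mulr_ge0 // ltW.
  have J0 v : J (fun k => psi k * v k) = 0.
    by rewrite -[RHS](haar_mean_cst 0); apply: eq_haar_mean => k Kk;
      rewrite psiK ?mul0r.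
  rewrite /err J0 subr0 (_ : (fun y => _) = (fun y => F y 1%g - F y 1%g)).
    by rewrite LB // subrr.
  by apply/funext => y; rewrite J0 subrr.
pose p1 k := \1_(U x) k * psi k.
pose p2 k := psi k - p1 k.
have b1 : bm p1 by apply: bounded_borelM => //; exact: bounded_borel_indic.
have b2 : bm p2 by exact: bounded_borelB.
have p12 : psi = (fun k => p1 k + p2 k) by apply/funext => k; rewrite /p2 addrC subrK.
have U1 k : U x k -> p1 k = psi k /\ p2 k = 0.
  by move=> Uk; rewrite /p2 /p1 indicE mem_set // mul1r subrr.
have U0 k : ~ U x k -> p1 k = 0 /\ p2 k = psi k.
  by move=> Uk; rewrite /p2 /p1 indicE memNset // mul0r subr0.
have -> : J (fun k => `|psi k|) = J (fun k => `|p1 k|) + J (fun k => `|p2 k|).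
  rewrite -haar_meanD; try exact: bounded_borel_norm.
  apply: eq_haar_mean => k _; have [/U1[-> ->]|/U0[-> ->]] := pselect (U x k).
    by rewrite normr0 addr0.
  by rewrite normr0 add0r.
rewrite p12 errD // mulrDr; apply: le_trans (ler_normD _ _) _; apply: lerD.
  by apply: (err_local (k0 := x) (U := U x)) => //; [exact: UF|move=> k /U0[]].
apply: IH => // k Kk ks.
have [/U1[_ ->] //|Uk] := pselect (U x k).
have [_ ->] := U0 k Uk; apply: psi0 => // z; rewrite inE => /orP[/eqP -> //|].
exact: ks.
Qed.

End Interchange.

(** An instance of the exchange, with [psi] integrated as the functional [L], continuous functions
    as its domain, and sup norm over [K]. *)
Lemma haar_mean_fubini (phi psi : G -> R) (F : G -> G -> R) :
  bm phi -> bm psi -> continuous (fun z : G * G => F z.1 z.2) ->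
  J (fun y => psi y * J (fun k => phi k * F y k)) =
  J (fun k => phi k * J (fun y => psi y * F y k)).
Proof.
move=> bphi bpsi cF.
have cFl k : continuous (F ^~ k) by exact: (continuous_curryr (y := k) cF).
have cFr y : continuous (F y) by exact: (continuous_curryl (x := y) cF).
pose L (u : G -> R) := J (fun y => psi y * u y).
have bm_cont u : continuous u -> bm u := @continuous_bounded_borel u.
apply: (@haar_mean_interchange G K (fun u => continuous u) L (J (fun y => `|psi y|)) F) => //.
- by move=> a u v cu cv y; apply: cvgD; [apply: cvgM; [exact: cvg_cst|exact: cu]|exact: cv].
- move=> a u v /bm_cont bu /bm_cont bv; rewrite /L -haar_meanZ; last exact: bounded_borelM.
  rewrite -haar_meanD; last exact: bounded_borelM.
    by apply: eq_haar_mean => y _; ring.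
  by apply: bounded_borelZ; exact: bounded_borelM.
- move=> u B /bm_cont bu uB; rewrite /L mulrC -haar_meanZ; last exact: bounded_borel_norm.
  apply: haar_mean_le_norm; first exact: bounded_borelM.
    by apply: bounded_borelZ; exact: bounded_borel_norm.
  by move=> y Ky; rewrite normrM mulrC ler_wpM2r // uB.
- by move=> p bp; exact: haar_mean_continuous.
- by move=> k0 e e0; exact: compact_near_dist.
Qed.

(** The spanning functions are continuous so that products with them can be integrated term by term.
    Only translations by [K] occur, but the identity holds on all of [G], as it does for
    eigenfunctions of a convolution operator. *)
Definition left_finite (phi : G -> R) : Prop :=
  continuous phi /\ exists n (e : 'I_n -> G -> R),
    (forall i, continuous (e i)) /\
    forall a, K a -> exists r : 'I_n -> R,
      forall x, phi (a^-1 * x)%g = \sum_i r i * e i x.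

(** * Convolution operators and the Peter-Weyl argument *)

Section Convolution.
Variable c : G -> R.
Hypothesis c_continuous : continuous c.

Implicit Types (u v w : G -> R).
Local Notation dot u v := (J (fun x => u x * v x)).

Let F x y := c (x^-1 * y)%g.

Let F_continuous : continuous (fun z : G * G => F z.1 z.2).
Proof.
move=> z; apply: (@continuous_comp _ _ _ (fun z : G * G => (z.1^-1 * z.2)%g) c).
  apply: (@continuous_comp _ _ _ (fun z : G * G => (z.1^-1%g, z.2)) (fun z => (z.1 * z.2)%g)).
    apply: cvg_pair => //=; last exact: cvg_snd.
    apply: (@continuous_comp _ _ _ fst (fun x : G => x^-1%g)); first exact: cvg_fst.
    exact: invg_continuous.
  exact: mulg_continuous.
exact: c_continuous.
Qed.

Let Fl_continuous x : continuous (F x).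
Proof. exact: (continuous_curryl (x := x) F_continuous). Qed.

Let Fr_continuous y : continuous (F ^~ y).
Proof. exact: (continuous_curryr (y := y) F_continuous). Qed.

Let bc u (cu : continuous u) : bm u := continuous_bounded_borel cu.
Arguments bc : clear implicits.

Definition conv (u : G -> R) (x : G) : R := J (fun y => u y * F x y).
Definition conv_adj (u : G -> R) (y : G) : R := J (fun x => u x * F x y).
Local Notation A := conv.
Local Notation At := conv_adj.
Local Notation T u := (At (A u)).

Lemma conv_continuous u : continuous u -> continuous (A u).
Proof.
move=> cu; exact: (haar_mean_continuous (bc _ cu) F_continuous).
Qed.

Lemma conv_adj_continuous u : continuous u -> continuous (At u).
Proof.
move=> cu; apply: (@haar_mean_continuous _ u (fun y x => F x y) (bc _ cu)).
move=> z; apply: (@continuous_comp _ _ _ (fun z : G * G => (z.2, z.1)) (fun z => F z.1 z.2)).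
  by apply: cvg_pair => //=; [exact: cvg_snd|exact: cvg_fst].
exact: F_continuous.
Qed.

Let cA := conv_continuous.
Let cAt := conv_adj_continuous.
Let cT u : continuous u -> continuous (T u).
Proof. by move=> cu; apply/cAt/cA. Qed.

Let contZ (r : R) u : continuous u -> continuous (fun x => r * u x : R).
Proof. by move=> cu; apply: continuous_realM => //; exact: cst_continuous. Qed.
Let cont_sum n (u : 'I_n -> G -> R) : (forall i, continuous (u i)) ->
  continuous (fun x => \sum_i u i x).
Proof.
move=> cu; elim: n u cu => [|n IH] u cu.
  rewrite (_ : (fun x => _) = fun=> 0); first exact: cst_continuous.
  by apply/funext => x; rewrite big_ord0.
rewrite (_ : (fun x => _) =
    (fun x => \sum_(i < n) u (widen_ord (leqnSn n) i) x + u ord_max x)).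
  by apply: continuous_realD => //; apply: IH.
by apply/funext => x; rewrite big_ord_recr.
Qed.

Let dotC u v : dot u v = dot v u.
Proof. by apply: eq_haar_mean => x _; rewrite mulrC. Qed.

Let dotZ (r : R) u v : continuous u -> continuous v ->
  dot (fun x => r * u x) v = r * dot u v.
Proof.
move=> cu cv; rewrite -haar_meanZ; last exact/bc/continuous_realM.
by apply: eq_haar_mean => x _; rewrite mulrA.
Qed.

Let dotB u v w : continuous u -> continuous v -> continuous w ->
  dot (fun x => u x - v x) w = dot u w - dot v w.
Proof.
move=> cu cv cw; rewrite -haar_meanB; try exact/bc/continuous_realM.
by apply: eq_haar_mean => x _; rewrite mulrBl.
Qed.

Let dot_sum n (u : 'I_n -> G -> R) v : (forall i, continuous (u i)) -> continuous v ->
  dot (fun x => \sum_i u i x) v = \sum_i dot (u i) v.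
Proof.
move=> cu cv; rewrite -haar_mean_sum; last by move=> i; exact/bc/continuous_realM.
by apply: eq_haar_mean => x _; rewrite mulr_suml.
Qed.

Let dot_ge0 u : 0 <= dot u u.
Proof. by apply: haar_mean_ge0 => x _; rewrite -expr2 sqr_ge0. Qed.

Let dotCS u v : continuous u -> continuous v -> dot u v ^+ 2 <= dot u u * dot v v.
Proof.
move=> cu cv; have := haar_mean_CS (bc _ cu) (bc _ cv).
by congr (_ <= _ * _); apply: eq_haar_mean => x _; rewrite expr2.
Qed.

Let conv_adjE u v : continuous u -> continuous v -> dot (A u) v = dot u (At v).
Proof.
move=> cu cv; rewrite dotC.
exact: (haar_mean_fubini (bc _ cu) (bc _ cv) F_continuous).
Qed.

Let TdotE u v : continuous u -> continuous v -> dot (T u) v = dot (A u) (A v).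
Proof. by move=> cu cv; rewrite dotC -conv_adjE; [rewrite dotC|exact: cv|exact: cA]. Qed.

Let TdotC u v : continuous u -> continuous v -> dot (T u) v = dot u (T v).
Proof. by move=> cu cv; rewrite TdotE; [rewrite conv_adjE; [|exact: cu|exact: cA]|exact: cu|exact: cv]. Qed.

(** The kernel of [T]: [T u x] is the inner product of [u] with [ker x], so L^2 estimates on [u]
    become pointwise ones on [T u]. *)
Let ker x := At (F ^~ x).

Let cker x : continuous (ker x). Proof. exact: cAt. Qed.
Arguments cker : clear implicits.

Let TE u x : continuous u -> T u x = dot u (ker x).
Proof. by move=> cu; rewrite -conv_adjE. Qed.

Let TZ (r : R) u x : continuous u -> T (fun y => r * u y) x = r * T u x.
Proof. by move=> cu; rewrite !TE ?dotZ //; exact: contZ. Qed.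

Local Notation lt a u := (fun x => u (a^-1 * x)%g) (only parsing).

Let clt a u : continuous u -> continuous (lt a u).
Proof.
move=> cu x; apply: (@continuous_comp _ _ _ (fun x => (a^-1 * x)%g) u).
  exact: mulg_left_continuous.
exact: cu.
Qed.

(** [F (a * x) (a * y) = F x y]. Eigenspaces of [T] are therefore stable under left translation by
    [K], which is what makes their elements K-finite. *)
Let T_lt a u : K a -> continuous u -> T (lt a u) = lt a (T u).
Proof.
move=> Ka cu; apply/funext => x.
have A_lt z : A (lt a u) z = A u (a^-1 * z)%g.
  rewrite /conv -(haar_mean_mull Ka); last first.
    by apply/bc/continuous_realM; [exact: clt|exact: Fl_continuous].
  by apply: eq_haar_mean => y _; rewrite mulKg /F invgM invgK mulgA.
rewrite /conv_adj -(haar_mean_mull Ka); last first.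
  by apply/bc/continuous_realM; [apply: cA; exact: clt|exact: Fr_continuous].
by apply: eq_haar_mean => y _; rewrite A_lt mulKg /F invgM mulgA.
Qed.

Let dot_lt a u v : K a -> continuous u -> continuous v ->
  dot (lt a u) (lt a v) = dot u v.
Proof.
move=> Ka cu cv; rewrite -(haar_mean_mull Ka); last first.
  by apply/bc/continuous_realM; exact: clt.
by apply: eq_haar_mean => y _; rewrite mulKg.
Qed.

Let ker_lt a : K a -> ker a = lt a (ker 1%g).
Proof.
move=> Ka; apply/funext => y; rewrite /ker /conv_adj -(haar_mean_mull Ka); last first.
  by apply/bc/continuous_realM; exact: Fr_continuous.
by apply: eq_haar_mean => z _; rewrite /F invgM -!mulgA mulVg.
Qed.

(** * Power iteration of [T] on its kernel function at the identity *)

Let u_ n := iter n (fun u => T u) (ker 1%g).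

Let cu_ n : continuous (u_ n).
Proof. by elim: n => [|n IH] /=; [exact: cker|exact: cT]. Qed.
Arguments cu_ : clear implicits.

Let TuE n : T (u_ n) = u_ n.+1. Proof. by []. Qed.

(** The moments of the spectral measure of [T] at [ker 1]. By [dotu] every inner product of iterates
    is one of them. *)
Let b n := dot (u_ n) (ker 1%g).

Let dotu n m : dot (u_ n) (u_ m) = b (n + m)%N.
Proof.
elim: m n => [|m IH] n; first by rewrite addn0.
by rewrite -TdotC; [rewrite TuE IH addSnnS|exact: cu_|exact: cu_].
Qed.

Let iterT_lt a n : K a -> iter n (fun u => T u) (ker a) = lt a (u_ n).
Proof.
move=> Ka; elim: n => [|n IH] /=; first exact: ker_lt.
by rewrite IH T_lt.
Qed.

Let iterT_cont n v : continuous v -> continuous (iter n (fun u => T u) v).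
Proof. by move=> cv; elim: n => [//|n IH] /=; exact: cT. Qed.

Let iterT_dot n u v : continuous u -> continuous v ->
  dot (iter n (fun u => T u) u) v = dot u (iter n (fun u => T u) v).
Proof.
move=> cu cv; elim: n v cv => [//|n IH] v cv.
rewrite iterS TdotC; [by rewrite (IH _ (cT cv)) -iterSr|exact: iterT_cont|exact: cv].
Qed.

(** The value at [x] is the pairing of [T^n u_m] with [ker x]. Moving [T^n] across gives the pairing
    of [u_m] with the translate by [x] of [u_n]; then Cauchy-Schwarz and invariance of the norm. *)
Let u_sup n m x : K x -> u_ (n + m).+1 x ^+ 2 <= b n.*2 * b m.*2.
Proof.
move=> Kx.
have -> : u_ (n + m).+1 x = dot (u_ m) (lt x (u_ n)).
  rewrite -TuE TE; last exact: cu_.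
  have -> : u_ (n + m) = iter n (fun u => T u) (u_ m) by exact: iterD.
  rewrite iterT_dot; [|exact: cu_|exact: cker].
  by rewrite iterT_lt.
apply: le_trans (dotCS _ _) _; [exact: cu_|by apply: clt; exact: cu_|].
by rewrite (dot_lt Kx (cu_ n) (cu_ n)) !dotu !addnn mulrC.
Qed.

(** The left side is the squared norm of [u_ (n + m).+1]; integrate [u_sup] over [K], which has mass
    1. *)
Let b_submul n m : b (n + m).+1.*2 <= b n.*2 * b m.*2.
Proof.
rewrite -addnn -dotu -[leRHS]haar_mean_cst; apply: le_haar_mean.
- exact/bc/continuous_realM.
- exact: bounded_borel_cst.
by move=> x Kx; rewrite -expr2 u_sup.
Qed.

(** Cauchy-Schwarz for [dot] when [n] is even, and for the form [dot (A u) (A v) = dot (T u) v] when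
    [n] is odd. *)
Let b_convex n : b n.+1 ^+ 2 <= b n * b n.+2.
Proof.
have [j [->|->]] : exists j, n = j.*2 \/ n = j.*2.+1.
  exists n./2; rewrite -[n in n = _]odd_double_half -[n in n = _.+1]odd_double_half.
  by case: (odd n); [right|left].
  have -> : b j.*2.+1 = dot (u_ j) (u_ j.+1) by rewrite dotu addnS addnn.
  rewrite -doubleS -2!addnn -!dotu; exact: dotCS.
have odd i : b i.*2.+1 = dot (A (u_ i)) (A (u_ i)).
  by rewrite -(TdotE (cu_ i) (cu_ i)) TuE dotu addSn addnn.
have -> : b j.*2.+2 = dot (A (u_ j)) (A (u_ j.+1)).
  by rewrite -(TdotE (cu_ j) (cu_ j.+1)) TuE dotu addnS addSn addnn.
by rewrite -doubleS !odd; apply: dotCS; exact: cA.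
Qed.

Hypothesis c1 : c 1%g != 0.

Let b0_gt0 : 0 < b 0.
Proof.
apply: haar_mean_gt0; first exact: continuous_realM.
  by move=> x _; rewrite -expr2 sqr_ge0.
have h : 0 < ker 1%g 1%g.
  apply: haar_mean_gt0; first by apply: continuous_realM; exact: Fr_continuous.
    by move=> x _; rewrite -expr2 sqr_ge0.
  by rewrite -expr2 /F invg1 mulg1 exprn_even_gt0.
by rewrite mulr_gt0.
Qed.

(** [b 1] is the squared norm of [A (ker 1)], and pairing [A (ker 1)] with [F ^~ 1] gives
    [b 0 > 0]. *)
Let b1_gt0 : 0 < b 1.
Proof.
have E : b 1 = dot (A (ker 1%g)) (A (ker 1%g)) by rewrite -TdotE.
rewrite lt_def E dot_ge0 andbT; apply/eqP => E0.
have cF1 : continuous (F ^~ 1%g) by exact: Fr_continuous.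
have := @dotCS (A (ker 1%g)) (F ^~ 1%g) _ cF1; move/(_ (cA (cker 1%g))).
rewrite E0 mul0r.
have -> : dot (A (ker 1%g)) (F^~ 1%g) = b 0
  by rewrite -[LHS]/(T (ker 1%g) 1%g) (TE 1%g (cker 1%g)).
by apply/negP; rewrite -ltNge exprn_gt0.
Qed.

Let b_gt0 n : 0 < b n.
Proof.
suff : 0 < b n /\ 0 < b n.+1 by case.
elim: n => [|n [bn bn1]]; first by split; [exact: b0_gt0|exact: b1_gt0].
split; first exact: bn1.
rewrite -(pmulr_rgt0 _ bn); apply: lt_le_trans (b_convex n).
exact: exprn_gt0.
Qed.

(** The squared distance of [s n] and [s m] is [be n.*2 + be m.*2 - 2 * be (n + m)], and [be]
    decreases to [beta], so [s] is Cauchy in L^2. One further application of [T] turns this into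
    pointwise convergence, uniform on [K]. *)
Lemma conv_eigenfunction : exists lam w,
  [/\ 0 < lam, continuous w, (forall x, T w x = lam * w x) & 0 < w 1%g].
Proof.
have [lam [beta [lam0 beta0 b_lb b_ub b_cvg]]] :=
  log_convex_limit b_gt0 b_convex b_submul.
pose be n := b n / lam ^+ n.
have lamX n : 0 < lam ^+ n by rewrite exprn_gt0.
have be_lb n : beta <= be n by rewrite ler_pdivlMr.
have be_homo n m : (n <= m)%N -> be m <= be n.
  have /nonincreasing_seqP : forall k, be k.+1 <= be k.
    move=> k; rewrite /be ler_pdivrMr // exprS mulrA mulrAC divfK ?gt_eqF //.
    by rewrite mulrC; exact: b_ub.
  exact.
pose s n x := (lam ^- n) * u_ n x.
have cs : forall n, continuous (s n) by move=> n; apply: contZ; exact: cu_.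
have dots n m : dot (s n) (s m) = be (n + m)%N.
  rewrite /s dotZ; [|exact: cu_|exact: cs].
  rewrite dotC dotZ; [|exact: cu_|exact: cu_].
  rewrite dotC dotu /be exprD invfM; ring.
have Ts n x : T (s n) x = lam * s n.+1 x.
  rewrite /s TZ; last exact: cu_.
  rewrite TuE exprS invfM; field; rewrite !gt_eqF //.
have sT n x : s n.+1 x = lam^-1 * T (s n) x by rewrite Ts mulKf // gt_eqF.
have sE n x : s n.+1 x = lam^-1 * dot (s n) (ker x).
  by rewrite -(TE _ (cs n)) Ts mulKf // gt_eqF.
pose ep N := 2 * (be N.*2 - beta).
have ep0 N : 0 <= ep N by rewrite mulr_ge0 // subr_ge0.
have ep_cvg : ep @ \oo --> 0.
  have : (fun N => 2 * (be N.*2 - beta)) @ \oo --> 2 * (beta - beta).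
    apply: cvgM; first exact: cvg_cst.
    apply: cvgB; last exact: cvg_cst.
    apply: (cvg_comp (fun N => N.*2) be) b_cvg.
    move=> P [N _ hN]; exists N => // k /= Nk; apply: hN => /=.
    by rewrite -addnn; apply: leq_trans Nk (leq_addr _ _).
  by rewrite subrr mulr0.
have s_dist N n m : (N <= n)%N -> (N <= m)%N ->
    dot (fun x => s n x - s m x) (fun x => s n x - s m x) <= ep N.
  move=> Nn Nm.
  have csB : continuous (fun x => s n x - s m x) by exact: continuous_realB.
  have e1 u : continuous u -> dot u (fun x => s n x - s m x) = dot u (s n) - dot u (s m).
    by move=> cu; rewrite dotC (dotB (cs n) (cs m) cu) [dot u (s n)]dotC [dot u (s m)]dotC.
  rewrite (dotB (cs n) (cs m) csB) (e1 _ (cs n)) (e1 _ (cs m)) !dots !addnn.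
  have := be_lb (m + n)%N; have := be_lb (n + m)%N.
  have : be n.*2 <= be N.*2 by apply: be_homo; rewrite leq_double.
  have : be m.*2 <= be N.*2 by apply: be_homo; rewrite leq_double.
  by rewrite /ep; lra.
pose kk x := dot (ker x) (ker x).
have kk0 x : 0 <= kk x by exact: dot_ge0.
have step u x : continuous u -> (lam^-1 * dot u (ker x)) ^+ 2 <=
    lam^-1 ^+ 2 * kk x * dot u u.
  move=> cu; rewrite exprMn -mulrA ler_pM2l ?exprn_gt0 ?invr_gt0 // mulrC.
  by apply: dotCS.
have sdist x N n m : (N <= n)%N -> (N <= m)%N ->
    (s n.+1 x - s m.+1 x) ^+ 2 <= lam^-1 ^+ 2 * kk x * ep N.
  move=> Nn Nm; rewrite !sE -mulrBr -dotB //.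
  have csB : continuous (fun x => s n x - s m x) by exact: continuous_realB.
  apply: le_trans (step _ x csB) _.
  apply: ler_wpM2l; last exact: s_dist.
  by apply: mulr_ge0; [exact: sqr_ge0|exact: kk0].
have E_cvg x : (fun N => lam^-1 ^+ 2 * kk x * ep N) @ \oo --> 0.
  rewrite -[X in _ --> X](mulr0 (lam^-1 ^+ 2 * kk x)).
  by apply: cvgM => //; exact: cvg_cst.
have ex_w x : exists l, forall N n, (N <= n)%N ->
    (s n.+1 x - l) ^+ 2 <= lam^-1 ^+ 2 * kk x * ep N.
  exact: (cauchy_sqr_dist (x := fun n => s n.+1 x) (sdist x) (E_cvg x)).
pose w x := projT1 (cid (ex_w x)).
have wP x N n : (N <= n)%N -> (s n.+1 x - w x) ^+ 2 <= lam^-1 ^+ 2 * kk x * ep N.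
  exact: (projT2 (cid (ex_w x))).
have s_cvg x : (fun n => s n.+1 x) @ \oo --> w x.
  by apply: (cvg_sqr_dist _ (E_cvg x)) => n; exact: wP.
have cw : continuous w.
  apply/continuous_distP => y e e0.
  (* Bounds [lam^-1] times the L^1 norm of [A (s n)]: the square of that norm is at most
     [dot (T (s n)) (s n) = lam * be n.*2.+1]. Hence the functions [s n.+1] are equicontinuous. *)
  pose M := lam^-1 * (1 + lam * be 0).
  have be00 : 0 < be 0 by apply: lt_le_trans (be_lb 0).
  have M0 : 0 <= M by rewrite mulr_ge0 ?invr_ge0 ?ltW // addr_gt0 // mulr_gt0.
  have eM : 0 < e / (M + 1) by rewrite divr_gt0 // ltr_wpDl.
  have := compact_near_dist K_compact F_continuous y eM.
  apply: filterS => x xy.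
  have AsB n : J (fun z => `|A (s n) z|) <= 1 + lam * be 0.
    have cAs : continuous (A (s n)) by exact: cA.
    have bAs : bm (fun z => `|A (s n) z|) by apply: bounded_borel_norm; exact: bc.
    have h : J (fun z => `|A (s n) z|) ^+ 2 <= lam * be 0.
      have := haar_mean_CS bAs (bounded_borel_cst 1).
      rewrite (eq_haar_mean (v := fun z => `|A (s n) z|)); last by move=> z _; rewrite mulr1.
      rewrite (eq_haar_mean (u := fun x => 1 ^+ 2) (v := fun z => 1)); last by move=> z _; rewrite expr1n.
      rewrite haar_mean_cst mulr1 => /le_trans; apply.
      rewrite (eq_haar_mean (v := fun z => A (s n) z * A (s n) z)); last first.
        by move=> z _; rewrite real_normK ?num_real // expr2.
      rewrite -TdotE //.
      have -> : dot (T (s n)) (s n) = lam * dot (s n.+1) (s n).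
        by rewrite -dotZ //; apply: eq_haar_mean => z _; rewrite Ts.
      by rewrite dots ler_pM2l // be_homo.
    have := sqr_ge0 (J (fun z => `|A (s n) z|) - 1).
    have := sqr_ge0 (J (fun z => `|A (s n) z|)); nra.
  have snB n : `|s n.+1 x - s n.+1 y| <= e.
    have -> : s n.+1 x - s n.+1 y =
        lam^-1 * J (fun z => A (s n) z * (F z x - F z y)).
      rewrite !sT -mulrBr; congr (_ * _); rewrite /conv_adj -haar_meanB; first last.
      - by apply/bc/continuous_realM; [exact: cA|exact: Fr_continuous].
      - by apply/bc/continuous_realM; [exact: cA|exact: Fr_continuous].
      by apply: eq_haar_mean => z _; rewrite mulrBr.
    rewrite normrM gtr0_norm ?invr_gt0 //.
    apply: le_trans (_ : lam^-1 * J (fun z => (e / (M + 1)) * `|A (s n) z|) <= _).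
      rewrite ler_pM2l ?invr_gt0 //; apply: haar_mean_le_norm.
      - apply/bc/continuous_realM; first exact: cA.
        by apply: continuous_realB; exact: Fr_continuous.
      - by apply/bounded_borelZ/bounded_borel_norm/bc; exact: cA.
      by move=> z Kz; rewrite normrM mulrC ler_wpM2r // xy.
    rewrite haar_meanZ; last by apply/bounded_borel_norm/bc; exact: cA.
    rewrite mulrCA mulrC; apply: le_trans (ler_mul_div_add1 M0 (ltW e0)).
    by rewrite ler_wpM2r ?(ltW eM) // ler_pM2l ?invr_gt0 // AsB.
  have hc : (fun n => `|s n.+1 x - s n.+1 y|) @ \oo --> `|w x - w y|.
    by apply: cvg_norm; apply: cvgB.
  have <- := cvg_lim _ hc; last exact: norm_hausdorff.
  apply: limr_le; first by apply/cvg_ex; eexists; exact: hc.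
  by exists 0%N => // n _; exact: snB.
have kkK x : K x -> kk x = b 0.
  by move=> Kx; rewrite /kk (ker_lt Kx) (dot_lt Kx (cker 1%g) (cker 1%g)).
have Tw x : T w x = lam * w x.
  (* On [K] the norm of [ker y] does not depend on [y], so the pointwise bound [wP] integrates to
     L^2 convergence of [s n.+1] to [w]. *)
  have h1 : (fun n => lam * s n.+2 x) @ \oo --> T w x.
    apply: (@cvg_sqr_dist _ _ (fun n => kk x * (lam^-1 ^+ 2 * b 0 * ep n))).
      move=> n; rewrite -Ts !TE //.
      have cd : continuous (fun y => s n.+1 y - w y) by exact: continuous_realB.
      rewrite -dotB //; apply: le_trans (dotCS cd _) _ => //.
      rewrite mulrC; apply: ler_wpM2l; first exact: kk0.
      rewrite -[leRHS]haar_mean_cst; apply: le_haar_mean.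
      - exact/bc/continuous_realM.
      - exact: bounded_borel_cst.
      by move=> y Ky; rewrite -expr2 -(kkK y Ky); exact: wP.
    rewrite -[X in _ --> X](mulr0 (kk x)); apply: cvgM; first exact: cvg_cst.
    rewrite -[X in _ --> X](mulr0 (lam^-1 ^+ 2 * b 0)).
    by apply: cvgM => //; exact: cvg_cst.
  have h2 : (fun n => lam * s n.+2 x) @ \oo --> lam * w x.
    apply: cvgM; first exact: cvg_cst.
    apply: (cvg_comp (fun n => n.+1) (fun n => s n.+1 x) _ (s_cvg x)).
    by move=> P [N _ hN]; exists N => // k /= Nk; apply: hN => /=; exact: leqW.
  exact: (cvg_unique _ h1 h2).
exists lam, w; split => //.
(* Here [beta > 0] prevents the limit function from vanishing. *)
have h : (fun n => s n.+1 1%g) @ \oo --> lam^-1 * beta.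
  rewrite (_ : (fun n => _) = (fun n => lam^-1 * be n)).
    by apply: cvgM => //; exact: cvg_cst.
  apply/funext => n; rewrite sE; congr (_ * _).
  by rewrite /s dotZ; [rewrite mulrC|exact: cu_|exact: cker].
have -> : w 1%g = lam^-1 * beta by exact: (cvg_unique _ (s_cvg 1%g) h).
by rewrite mulr_gt0 // invr_gt0.
Qed.

(* Bessel's inequality for the kernel [ker x], integrated over [x]. *)
Let eigen_family_bound lam n (e : 'I_n -> G -> R) :
  (forall i, continuous (e i)) ->
  (forall i x, T (e i) x = lam * e i x) ->
  (forall i j, dot (e i) (e j) = (i == j)%:R) -> n%:R * lam ^+ 2 <= b 0.
Proof.
move=> ce Te orth.
have bound x : K x -> \sum_i (lam * e i x) ^+ 2 <= b 0.
  move=> Kx; pose a i := lam * e i x.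
  have aE i : a i = dot (e i) (ker x) by rewrite /a -Te TE.
  pose p y := \sum_i a i * e i y.
  have cae i : continuous (fun y => a i * e i y) by exact: contZ.
  have cp : continuous p by exact: cont_sum.
  have pE v : continuous v -> dot p v = \sum_i a i * dot (e i) v.
    move=> cv; rewrite dot_sum //; apply: eq_bigr => i _.
    by rewrite dotZ.
  have pk : dot p (ker x) = \sum_i a i ^+ 2.
    by rewrite pE //; apply: eq_bigr => i _; rewrite -aE expr2.
  have ep i : dot (e i) p = a i.
    rewrite dotC pE // (bigD1 i) //= orth eqxx mulr1 big1 ?addr0 // => j ji.
    by rewrite orth (negbTE ji) mulr0.
  have pp : dot p p = \sum_i a i ^+ 2.
    by rewrite pE //; apply: eq_bigr => i _; rewrite ep expr2.
  have ckp : continuous (fun y => ker x y - p y) by exact: continuous_realB.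
  have := dot_ge0 (fun y => ker x y - p y).
  have e1 v : continuous v ->
      dot v (fun y => ker x y - p y) = dot v (ker x) - dot v p.
    move=> cv; rewrite dotC (dotB (cker x) cp cv).
    by rewrite [dot v (ker x)]dotC [dot v p]dotC.
  rewrite (dotB (cker x) cp ckp) (e1 _ (cker x)) (e1 _ cp).
  rewrite pk pp [dot (ker x) p]dotC pk (ker_lt Kx) (dot_lt Kx (cker 1%g) (cker 1%g)).
  by rewrite -/(b 0); lra.
rewrite -[leRHS]haar_mean_cst.
have -> : n%:R * lam ^+ 2 = J (fun x => \sum_i (lam * e i x) ^+ 2).
  rewrite haar_mean_sum; last by move=> i; apply/bc/continuous_realM; exact: contZ.
  rewrite -[n in n%:R](card_ord n) -sum1_card natr_sum mulr_suml.
  apply: eq_bigr => i _; rewrite mul1r.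
  rewrite (eq_haar_mean (v := fun x => lam ^+ 2 * (e i x * e i x))); last first.
    by move=> x _; ring.
  by rewrite haar_meanZ ?orth ?eqxx ?mulr1 //; exact/bc/continuous_realM.
apply: le_haar_mean; last exact: bound.
- apply: bounded_borel_sum => i; apply: bc; apply: continuous_realM; exact: contZ.
- exact: bounded_borel_cst.
Qed.

(** [eigen_family_bound] limits the size of orthonormal families in the eigenspace. A family that
    cannot be enlarged spans, since a nonzero residue could be normalised and added. *)
Let eigen_basis lam : 0 < lam -> exists n (e : 'I_n -> G -> R),
  (forall i, continuous (e i)) /\
  forall v, continuous v -> (forall x, T v x = lam * v x) ->
    exists a : 'I_n -> R, forall x, v x = \sum_i a i * e i x.
Proof.
move=> lam0.
pose P n := exists e : 'I_n -> G -> R, [/\ forall i, continuous (e i),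
  forall i x, T (e i) x = lam * e i x & forall i j, dot (e i) (e j) = (i == j)%:R].
have P0 : P 0%N by exists (fun _ _ => 0); split=> -[].
have [n [Pn PSn]] : exists n, P n /\ ~ P n.+1.
  apply: contrapT => h.
  have PA n : P n.
    elim: n => [//|n Pn]; apply: contrapT => PSn; apply: h.
    by exists n.
  pose N := (Num.truncn (b 0 / lam ^+ 2)).+1.
  have [e [ce Te orth]] := PA N.
  have := eigen_family_bound ce Te orth.
  rewrite -ler_pdivlMr ?exprn_gt0 //; apply/negP; rewrite -ltNge.
  exact: truncnS_gt.
have [e [ce Te orth]] := Pn.
exists n, e; split=> // v cv Tv.
pose a i := dot (e i) v.
exists a => x.
pose p y := \sum_i a i * e i y.
have cae i : continuous (fun y => a i * e i y) by exact: contZ.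
have cp : continuous p by exact: cont_sum.
pose r y := v y - p y.
have cr : continuous r by exact: continuous_realB.
have Tp y : T p y = lam * p y.
  rewrite TE // dot_sum // /p mulr_sumr; apply: eq_bigr => i _.
  by rewrite dotZ // -TE // Te mulrCA.
have Tr y : T r y = lam * r y.
  by rewrite TE // dotB // -!TE // Tv Tp -mulrBr.
have re i : dot (e i) r = 0.
  rewrite dotC dotB // [dot v _]dotC -/(a i) dot_sum //.
  under eq_bigr do rewrite dotZ // orth.
  rewrite (bigD1 i) //= eqxx mulr1 big1 ?addr0 ?subrr // => j ji.
  by rewrite (negbTE ji) mulr0.
have r0 : dot r r = 0.
  apply/eqP; rewrite eq_le dot_ge0 andbT leNgt; apply/negP => rr.
  apply: PSn.
  pose t := (Num.sqrt (dot r r))^-1.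
  pose v' y := t * r y.
  have cv' : continuous v' by exact: contZ.
  have v'v' : dot v' v' = 1.
    rewrite dotZ // dotC dotZ // mulrA -expr2 exprVn sqr_sqrtr ?ltW //.
    by rewrite mulVf // gt_eqF.
  have ev' i : dot (e i) v' = 0 by rewrite dotC dotZ // dotC re mulr0.
  pose e' (i : 'I_n.+1) := if unlift ord_max i is Some j then e j else v'.
  exists e'; split.
  - by move=> i; rewrite /e'; case: unliftP.
  - move=> i y; rewrite /e'; case: unliftP => [j _|_]; first exact: Te.
    by rewrite TZ // Tr mulrCA.
  - move=> i j; rewrite /e'; case: unliftP => [i' ->|->]; case: unliftP => [j' ->|->].
    + by rewrite orth (inj_eq (@lift_inj _ _)).
    + by rewrite ev' eq_sym (negbTE (neq_lift _ _)).
    + by rewrite dotC ev' (negbTE (neq_lift _ _)).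
    + by rewrite v'v' eqxx.
(* A zero L^2 norm over [K] gives vanishing at every point of [G], because [lam * r x] is the
   pairing of [r] with [ker x]. *)
have : (lam * r x) ^+ 2 <= 0.
  by rewrite -Tr TE //; apply: le_trans (dotCS cr (cker x)) _; rewrite r0 mul0r.
rewrite le_eqVlt ltNge sqr_ge0 orbF sqrf_eq0 mulf_eq0 gt_eqF //= subr_eq0.
by move/eqP.
Qed.

Lemma conv_left_finite_neq0 :
  exists phi, left_finite phi /\ J (fun x => phi x * c x) != 0.
Proof.
apply: contrapT => h.
have [lam [w [lam0 cw Tw w1]]] := conv_eigenfunction.
have [n [e [ce span]]] := eigen_basis lam0.
have fin a : K a -> left_finite (lt a w).
  move=> Ka; split; first exact: clt.
  exists n, e; split=> // a' Ka'.
  have Kaa : K (a' * a)%g by case: K_subgroup => _ KM _; exact: KM.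
  have [r rE] := span (lt (a' * a)%g w) (@clt _ _ cw) ltac:(by move=> x; rewrite T_lt // Tw).
  by exists r => x; rewrite -rE invgM mulgA.
(* After the substitution [y := x * y], [A w x] is the pairing of [c] with a left translate of
   [w]. *)
have Aw0 x : K x -> A w x = 0.
  move=> Kx; apply/eqP; apply: contrapT => /negP Aw; apply: h.
  have Kx' : K (x^-1)%g by case: K_subgroup => _ _; exact.
  exists (lt (x^-1)%g w); split; first exact: fin.
  apply: contraNneq Aw => <-.
  rewrite /conv -(haar_mean_mull Kx); last by apply/bc/continuous_realM; [|exact: Fl_continuous].
  by apply/eqP/eq_haar_mean => y _; rewrite invgK /F mulKg.
have := mulr_gt0 lam0 w1; rewrite -Tw /conv_adj.
rewrite (eq_haar_mean (v := fun=> 0)) ?haar_mean_cst ?ltxx // => x Kx.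
by rewrite Aw0 // mul0r.
Qed.

End Convolution.

Lemma peter_weyl (c : G -> R) : continuous c ->
  (forall phi, left_finite phi -> haar_mean (fun x => phi x * c x) = 0) ->
  c 1%g = 0.
Proof.
move=> cc h; apply: contrapT => /eqP c1.
have [phi [fphi]] := conv_left_finite_neq0 cc c1.
by rewrite h ?eqxx.
Qed.

End Haar.

(** * Matrix-valued functions on the coset space *)

Section ComplexContinuity.
Variables (R : realType).
Local Notation C := R[i].
Local Notation Re := complex.Re.
Local Notation Im := complex.Im.

Lemma Re_addc (x y : C) : Re (x + y) = Re x + Re y. Proof. by case: x; case: y. Qed.

Lemma Im_addc (x y : C) : Im (x + y) = Im x + Im y. Proof. by case: x; case: y. Qed.

Lemma Re_mulc (x y : C) : Re (x * y) = Re x * Re y - Im x * Im y.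
Proof. by case: x; case: y. Qed.

Lemma Im_mulc (x y : C) : Im (x * y) = Re x * Im y + Im x * Re y.
Proof. by case: x; case: y. Qed.

Lemma Re_conjc (x : C) : Re (x^*)%R = Re x. Proof. by case: x. Qed.

Lemma Im_conjc (x : C) : Im (x^*)%R = - Im x. Proof. by case: x. Qed.

Lemma eq_ReIm (x y : C) : Re x = Re y -> Im x = Im y -> x = y.
Proof. by case: x; case: y => a b c d /= -> ->. Qed.

Lemma Re_sum (I : Type) (s : seq I) (F : I -> C) :
  Re (\sum_(i <- s) F i) = \sum_(i <- s) Re (F i).
Proof. by elim: s => [|i s IH]; rewrite ?big_nil // !big_cons Re_addc IH. Qed.

Lemma Im_sum (I : Type) (s : seq I) (F : I -> C) :
  Im (\sum_(i <- s) F i) = \sum_(i <- s) Im (F i).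
Proof. by elim: s => [|i s IH]; rewrite ?big_nil // !big_cons Im_addc IH. Qed.

Lemma Re_norm (x : C) : Re `|x| = Num.sqrt (Re x ^+ 2 + Im x ^+ 2).
Proof. by rewrite normc_def. Qed.

Lemma Re_norm_ge0 (x : C) : 0 <= Re `|x|.
Proof. by rewrite Re_norm sqrtr_ge0. Qed.

Lemma Re_norm_sqr (x : C) : (Re `|x|) ^+ 2 = Re x ^+ 2 + Im x ^+ 2.
Proof. by rewrite Re_norm sqr_sqrtr // addr_ge0 // sqr_ge0. Qed.

Lemma le_Re_norm (x : C) : `|Re x| <= Re `|x|.
Proof.
rewrite -(ler_pXn2r (n := 2)) ?nnegrE ?Re_norm_ge0 //.
by rewrite Re_norm_sqr real_normK ?num_real // lerDl sqr_ge0.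
Qed.

Lemma le_Im_norm (x : C) : `|Im x| <= Re `|x|.
Proof.
rewrite -(ler_pXn2r (n := 2)) ?nnegrE ?Re_norm_ge0 //.
by rewrite Re_norm_sqr real_normK ?num_real // lerDr sqr_ge0.
Qed.

Lemma Re_norm_le (x : C) : Re `|x| <= `|Re x| + `|Im x|.
Proof.
rewrite -(ler_pXn2r (n := 2)) ?nnegrE ?Re_norm_ge0 ?addr_ge0 //.
rewrite Re_norm_sqr sqrrD !real_normK ?num_real // lerD2r lerDl.
by rewrite mulrn_wge0 // mulr_ge0.
Qed.

Lemma Re_normM (x y : C) : Re `|x * y| = Re `|x| * Re `|y|.
Proof. by rewrite normrM Re_mulc !normc_def /= mulr0 subr0. Qed.

Lemma normE (x : C) : `|x| = (Re `|x|)%:C. Proof. by rewrite normc_def. Qed.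

Variable Y : topologicalType.
Implicit Types (u v : Y -> C).

Definition ccont (u : Y -> C) : Prop :=
  continuous (fun y => Re (u y)) /\ continuous (fun y => Im (u y)).

Lemma ccontP u : continuous u <-> ccont u.
Proof.
split=> [cu|[cr ci]].
  have nbhsB (y : Y) (e : R) : 0 < e -> \forall z \near y, Re `|u y - u z| < e.
    move=> e0; have eC : (0 : C) < e%:C by rewrite ltcR.
    have h : \forall z \near y, ball (u y) e%:C (u z).
      by have /cvg_ballP := cu y; apply.
    by apply: filterS h => z; rewrite /ball /= normE ltcR.
  split; apply/continuous_distP => y e e0; apply: filterS (nbhsB y e e0) => z /ltW h.
    by rewrite distrC; apply: le_trans h; have := le_Re_norm (u y - u z); rewrite !Re_addc; case: (u z).
  by rewrite distrC; apply: le_trans h; have := le_Im_norm (u y - u z); rewrite !Im_addc; case: (u z).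
move=> y; apply/cvg_ballP => e e0.
(* Radii of balls in [R[i]] are complex numbers; a positive one is real. *)
have [eI eR] : Im e = 0 /\ 0 < Re e.
  by move: e0; rewrite ltcE /= => /andP[/eqP].
have e3 : 0 < Re e / 3 by rewrite divr_gt0.
have h1 := (continuous_distP _).1 cr y _ e3.
have h2 := (continuous_distP _).1 ci y _ e3.
near=> z.
rewrite /ball /= normE; have -> : e = (Re e)%:C by apply: eq_ReIm.
rewrite ltcR; apply: le_lt_trans (Re_norm_le _) _.
have : `|Re (u z) - Re (u y)| <= Re e / 3 by near: z.
have : `|Im (u z) - Im (u y)| <= Re e / 3 by near: z.
have -> : Re (u y - u z) = - (Re (u z) - Re (u y)) by rewrite opprB; case: (u y); case: (u z).
have -> : Im (u y - u z) = - (Im (u z) - Im (u y)) by rewrite opprB; case: (u y); case: (u z).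
by rewrite !normrN; lra.
Unshelve. all: by end_near. Qed.

Lemma ccont_cst (a : C) : ccont (fun=> a).
Proof. by split; exact: cst_continuous. Qed.

Lemma ccontD u v : ccont u -> ccont v -> ccont (fun y => u y + v y).
Proof.
move=> [ur ui] [vr vi]; split.
  by under eq_fun do rewrite Re_addc; move=> y; apply: cvgD; [exact: ur|exact: vr].
by under eq_fun do rewrite Im_addc; move=> y; apply: cvgD; [exact: ui|exact: vi].
Qed.

Lemma ccontM u v : ccont u -> ccont v -> ccont (fun y => u y * v y).
Proof.
move=> [ur ui] [vr vi]; split.
  under eq_fun do rewrite Re_mulc; move=> y; apply: cvgB; apply: cvgM;
    [exact: ur|exact: vr|exact: ui|exact: vi].
under eq_fun do rewrite Im_mulc; move=> y; apply: cvgD; apply: cvgM;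
  [exact: ur|exact: vi|exact: ui|exact: vr].
Qed.

Lemma ccont_conj u : ccont u -> ccont (fun y => (u y)^*%R).
Proof.
move=> [ur ui]; split; first by under eq_fun do rewrite Re_conjc.
by under eq_fun do rewrite Im_conjc; move=> y; apply: cvgN; exact: ui.
Qed.

Lemma ccont_sum (I : Type) (s : seq I) (u : I -> Y -> C) :
  (forall i, ccont (u i)) -> ccont (fun y => \sum_(i <- s) u i y).
Proof.
move=> cu; elim: s => [|i s IH].
  by under eq_fun do rewrite big_nil; exact: ccont_cst.
by under eq_fun do rewrite big_cons; exact: ccontD.
Qed.

Lemma continuous_mxP m n (f : Y -> 'M[C]_(m, n)) :
  continuous f <-> forall i j, ccont (fun y => f y i j).
Proof.
split=> [cf i j|cf].
  apply/ccontP => y P nP.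
  apply: (cf y [set M | P (M i j)]).
  exists (fun i' j' => if (i' == i) && (j' == j) then P else setT).
    move=> i' j'; case: ifP => [/andP[/eqP -> /eqP ->] //|_]; exact: filterT.
  by move=> M /= /(_ i j); rewrite !eqxx.
move=> y P [Q nQ QP].
have h ij : nbhs y [set z | Q ij.1 ij.2 (f z ij.1 ij.2)].
  by have /ccontP cij := cf ij.1 ij.2; exact: (cij y (Q ij.1 ij.2) (nQ _ _)).
have : \forall z \near y, forall ij : 'I_m * 'I_n, Q ij.1 ij.2 (f z ij.1 ij.2).
  exact: filter_forall.
apply: filterS => z hz; apply: QP => i j; exact: (hz (i, j)).
Qed.

Lemma continuous_mulmx m n k (f : Y -> 'M[C]_(m, n)) (h : Y -> 'M[C]_(n, k)) :
  continuous f -> continuous h -> continuous (fun y => f y *m h y).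
Proof.
move=> /continuous_mxP cf /continuous_mxP ch; apply/continuous_mxP => i j.
by under eq_fun do rewrite mxE; apply: ccont_sum => l; apply: ccontM.
Qed.

Lemma continuous_mxD m n (f h : Y -> 'M[C]_(m, n)) :
  continuous f -> continuous h -> continuous (fun y => f y + h y).
Proof.
move=> /continuous_mxP cf /continuous_mxP ch; apply/continuous_mxP => i j.
by under eq_fun do rewrite mxE; exact: ccontD.
Qed.

Lemma continuous_mxZ m n (a : C) (f : Y -> 'M[C]_(m, n)) :
  continuous f -> continuous (fun y => a *: f y).
Proof.
move=> /continuous_mxP cf; apply/continuous_mxP => i j.
by under eq_fun do rewrite mxE; apply: ccontM => //; exact: ccont_cst.
Qed.

End ComplexContinuity.

Section CoordinateNorm.
Variable R : realType.
Local Notation C := R[i].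
Local Notation Re := complex.Re.

Lemma Re_cdot m n (A : 'M[C]_(m, n)) :
  Re (cdot A A) = \sum_i \sum_j (Re `|A i j|) ^+ 2.
Proof.
rewrite /cdot Re_sum; apply: eq_bigr => i _; rewrite Re_sum; apply: eq_bigr => j _.
by rewrite Re_mulc Re_conjc Im_conjc Re_norm_sqr; ring.
Qed.

Lemma Re_cdot_ge0 m n (A : 'M[C]_(m, n)) : 0 <= Re (cdot A A).
Proof. by rewrite Re_cdot; do 2 apply: sumr_ge0 => ? _; exact: sqr_ge0. Qed.

Lemma cnorm_sqr m n (A : 'M[C]_(m, n)) : cnorm A ^+ 2 = Re (cdot A A).
Proof. by rewrite /cnorm sqr_sqrtr // Re_cdot_ge0. Qed.

Lemma cnorm_ge0 m n (A : 'M[C]_(m, n)) : 0 <= cnorm A.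
Proof. exact: sqrtr_ge0. Qed.

Lemma le_cnorm_sqr m n (A : 'M[C]_(m, n)) i j : Re `|A i j| ^+ 2 <= cnorm A ^+ 2.
Proof.
rewrite cnorm_sqr Re_cdot (bigD1 i) //= (bigD1 j) //= -addrA lerDl.
apply: addr_ge0; first by apply: sumr_ge0 => ? _; exact: sqr_ge0.
by do 2 apply: sumr_ge0 => ? _; exact: sqr_ge0.
Qed.

Lemma le_cnorm m n (A : 'M[C]_(m, n)) i j : Re `|A i j| <= cnorm A.
Proof.
by rewrite -(ler_pXn2r (n := 2)) ?nnegrE ?Re_norm_ge0 ?cnorm_ge0 // le_cnorm_sqr.
Qed.

Lemma sum_sqr_le (I : Type) (s : seq I) (F : I -> R) : (forall i, 0 <= F i) ->
  \sum_(i <- s) F i ^+ 2 <= (\sum_(i <- s) F i) ^+ 2.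
Proof.
move=> F0; elim: s => [|i s IH]; first by rewrite !big_nil expr0n.
rewrite !big_cons sqrrD; apply: le_trans (lerD (lexx _) IH) _.
rewrite lerD2r lerDl mulrn_wge0 // mulr_ge0 // sumr_ge0 // => j _.
Qed.

Lemma cnorm_le_sum m n (A : 'M[C]_(m, n)) :
  cnorm A <= \sum_i \sum_j Re `|A i j|.
Proof.
have S0 i : 0 <= \sum_j Re `|A i j| by apply: sumr_ge0 => j _; exact: Re_norm_ge0.
rewrite -(ler_pXn2r (n := 2)) ?nnegrE ?cnorm_ge0 ?sumr_ge0 //.
rewrite cnorm_sqr Re_cdot; apply: le_trans (sum_sqr_le _ S0).
by apply: ler_sum => i _; apply: sum_sqr_le => j; exact: Re_norm_ge0.
Qed.

Lemma Re_norm_sum (I : Type) (s : seq I) (F : I -> C) :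
  Re `|\sum_(i <- s) F i| <= \sum_(i <- s) Re `|F i|.
Proof.
elim: s => [|i s IH]; first by rewrite !big_nil normr0.
rewrite !big_cons; apply: le_trans (_ : Re `|F i| + Re `|\sum_(j <- s) F j| <= _).
  by have := ler_normD (F i) (\sum_(j <- s) F j); rewrite lecE Re_addc => /andP[].
by rewrite lerD2l.
Qed.

(** A crude constant: some bound of the operator norm by the entries is all that the density
    argument asks for. *)
Lemma cnorm_mulmx_le m n (A : 'M[C]_(m, n)) (v : 'cV[C]_n) (B : R) :
  (forall i j, Re `|A i j| <= B) -> cnorm (A *m v) <= m%:R * n%:R * B * cnorm v.
Proof.
move=> AB; apply: le_trans (cnorm_le_sum _) _.
apply: le_trans (_ : \sum_(i < m) \sum_(j < n) B * cnorm v <= _); last first.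
  by rewrite !sumr_const !card_ord -mulrnA -[leLHS]mulr_natl natrM [n%:R * _]mulrC mulrA.
apply: ler_sum => i _; rewrite big_ord1 mxE; apply: le_trans (Re_norm_sum _ _) _.
apply: ler_sum => j _; rewrite Re_normM; apply: ler_pM => //; rewrite ?Re_norm_ge0 //.
exact: le_cnorm.
Qed.

End CoordinateNorm.

(** * Right translations of the coset space *)

Section CosetSpace.
Variables (R : realType) (G : lieGroup R) (Gam : set G).
Hypothesis Gam_subgroup : subgroup Gam.
Local Notation X := (coset_space Gam).
Local Notation pi := (\pi_(coset_space Gam)%qT : G -> X).

Lemma pi_cosetP (x y : G) : pi x = pi y <-> exists2 c, Gam c & y = (c * x)%g.
Proof.
case: Gam_subgroup => G1 GM GV; have piP x' y' : pi x' = pi y' <-> left_coset Gam x' = left_coset Gam y'.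
  change (\pi_({eq_quot (@coset_rel G Gam)})%qT x' =
      \pi_({eq_quot (@coset_rel G Gam)})%qT y' <->
    left_coset Gam x' = left_coset Gam y').
  by split=> [/eqquotP/asboolP|e]; last exact/eqquotP/asboolP.
split=> [/piP e|[c Gc ->]].
  have : left_coset Gam y y by exists 1%g => //; rewrite mul1g.
  by rewrite -e => -[c Gc <-]; exists c.
apply/piP/seteqP; split=> z [d Gd <-].
  by exists (d * c^-1)%g; [apply: GM => //; exact: GV|rewrite -mulgA mulKg].
by exists (d * c)%g; [exact: GM|rewrite mulgA].
Qed.

Lemma rtrans_pi (g x : G) : rtrans g (pi x) = pi (x * g)%g.
Proof.
rewrite /rtrans; apply/pi_cosetP.
have /pi_cosetP[c Gc e] : pi (repr (pi x)) = pi x by rewrite reprK.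
by exists c => //; rewrite {1}e mulgA.
Qed.

Lemma rtransM (g h : G) (x : X) : rtrans h (rtrans g x) = rtrans (g * h)%g x.
Proof. by have -> : x = pi (repr x) by [rewrite reprK]; rewrite !rtrans_pi mulgA. Qed.

Lemma rtrans1 (x : X) : rtrans 1%g x = x.
Proof. by have -> : x = pi (repr x) by [rewrite reprK]; rewrite rtrans_pi mulg1. Qed.

Lemma pi_open (U : set G) : open U -> open (pi @` U).
Proof.
move=> oU; change (open (pi @^-1` (pi @` U))).
have -> : pi @^-1` (pi @` U) = \bigcup_(c in Gam) (fun x => (c * x)%g) @^-1` U.
  apply/seteqP; split=> [x [y Uy /esym/pi_cosetP[c Gc yE]]|x [c Gc Ux]].
    by exists c => //=; rewrite -yE.
  by exists (c * x)%g => //; apply/esym/pi_cosetP; exists c.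
apply: bigcup_open => c _.
by have /continuousP := @mulg_left_continuous _ G c; apply.
Qed.

(** Joint continuity does not follow from the quotient topology formally, a product of quotient maps
    need not be one; openness of the projection gives the neighbourhoods. *)
Lemma rtrans_continuous2 : continuous (fun z : X * G => rtrans z.2 z.1).
Proof.
move=> [x g] W nW.
pose x0 := repr x.
have e : rtrans g x = pi (x0 * g)%g by rewrite -rtrans_pi reprK.
have : nbhs (x0, g) ((fun z : G * G => pi (z.1 * z.2)%g) @^-1` W).
  have cm : continuous (fun z : G * G => pi (z.1 * z.2)%g).
    move=> z; apply: continuous_comp; first exact: mulg_continuous.
    exact: pi_continuous.
  by apply: (cm (x0, g)); rewrite /= -e.
move=> [[A B] /= [nA nB] AB].
exists (pi @` A°, B) => /=.
  split=> //; apply: open_nbhs_nbhs; split; first exact/pi_open/open_interior.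
  by exists x0; [exact: nbhs_singleton (nbhs_interior nA)|rewrite reprK].
move=> [y h] /= [[a Aa <-] Bh]; rewrite rtrans_pi.
by apply: (AB (a, h)); split=> //=; exact: interior_subset.
Qed.

Lemma rtrans_continuous g : continuous (rtrans g : X -> X).
Proof.
apply/quotient_continuous => x.
rewrite (_ : _ \o _ = (fun x => pi (x * g)%g)); last first.
  by apply/funext => z; exact: rtrans_pi.
apply: continuous_comp; last exact: pi_continuous.
exact: (continuous_curryr (y := g) mulg_continuous).
Qed.

End CosetSpace.

Section Density.
Variables (R : realType) (G : lieGroup R) (K Gam : set G).
Variable mK : {measure set (borel G) -> \bar R}.
Hypothesis K_subgroup : subgroup K.
Hypothesis K_compact : compact K.
Hypothesis K_haar : haar_measure K mK.
Hypothesis Gam_subgroup : subgroup Gam.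
Hypothesis Gam_cocompact : cocompact Gam.
Variable p : nat.
Local Notation C := R[i].
Local Notation X := (coset_space Gam).
Local Notation J := (haar_mean K mK).
Local Notation Re := complex.Re.
Local Notation Im := complex.Im.

(* The real and imaginary parts of the entries of a matrix-valued function form
   a single real function on the product of X and this finite set. *)
Let index := ('I_p * 'I_p * bool)%type.

Let assemble (u : X * index -> R) (x : X) : 'M[C]_p :=
  \matrix_(i, j) (u (x, (i, j, true)) +i* u (x, (i, j, false))).

Let component (f : X -> 'M[C]_p) (y : X * index) : R :=
  let: (x, (i, j, b)) := y in if b then Re (f x i j) else Im (f x i j).

Lemma in_AP (f : X -> 'M[C]_p) : in_A f <-> forall k, continuous (fun x => component f (x, k)).
Proof.
rewrite /in_A continuous_mxP; split=> [cf [[i j] b]|cf i j].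
  by case: (cf i j) => ? ?; case: b.
by split; [exact: (cf (i, j, true))|exact: (cf (i, j, false))].
Qed.

Let translate_continuous2 (u : X -> R) : continuous u ->
  continuous (fun z : X * G => u (rtrans z.2 z.1)).
Proof.
move=> cu z; apply: (@continuous_comp _ _ _ (fun z : X * G => rtrans z.2 z.1) u).
  exact: rtrans_continuous2.
exact: cu.
Qed.

Let translate_continuous (u : X -> R) x : continuous u ->
  continuous (fun g => u (rtrans g x)).
Proof.
by move=> cu; exact: (continuous_curryl (translate_continuous2 cu)).
Qed.

Let D (u : X * index -> R) := forall k, continuous (fun x => u (x, k)).

Variable L : (X -> 'M[C]_p) -> R.
Variable c0 : R.
Hypothesis L_lin : forall (a : R) f h, in_A f -> in_A h ->
  L (fun x => a%:C *: f x + h x) = a * L f + L h.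
Hypothesis L_bound : forall f B, in_A f ->
  (forall x i j, Re `|f x i j| <= B) -> `|L f| <= c0 * B.
Hypothesis L_AK : forall f, in_AK K f -> L f = 0.

Lemma vanishing_on_AK f : in_A f -> L f = 0.
Proof.
move=> Af.
pose F (y : X * index) (k : G) := component f (rtrans k y.1, y.2).
have cf k : continuous (fun x => component f (x, k)) by exact: (in_AP f).1.
have AD u : D u -> in_A (assemble u).
  move=> Du; apply/in_AP => -[[i j] b]; rewrite /component.
  by case: b; under eq_fun do rewrite mxE /=; exact: Du.
have asF g : assemble (F ^~ g) = (fun x => f (rtrans g x)).
  apply/funext => x; apply/matrixP => i j; rewrite mxE /F /=.
  exact: eq_ReIm.
have DF g : D (F ^~ g).
  by move=> k x; apply: (continuous_comp _ (cf k _)); exact: rtrans_continuous.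
have D_lin a u v : D u -> D v -> D (fun y => a * u y + v y).
  move=> Du Dv k; apply: continuous_realD; last exact: Dv.
  by apply: continuous_realM; [exact: cst_continuous|exact: Du].
have as_lin a u v : assemble (fun y => a * u y + v y) =
    (fun x => a%:C *: assemble u x + assemble v x).
  apply/funext => x; apply/matrixP => i j; rewrite !mxE.
  by apply: eq_ReIm; rewrite ?Re_addc ?Im_addc ?Re_mulc ?Im_mulc /= mul0r ?subr0 ?addr0.
have DJ phi : bounded_borel K phi -> D (fun y => J (fun k => phi k * F y k)).
  move=> bphi k; apply: (haar_mean_continuous K_subgroup K_compact K_haar
    (F := fun x g => component f (rtrans g x, k)) bphi).
  exact: (@translate_continuous2 (fun x => component f (x, k)) (cf k)).
have cF y : continuous (F y) by exact: (@translate_continuous (fun x => component f (x, y.2)) y.1 (cf y.2)).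
have F_equi g (e : R) : 0 < e ->
    \forall k \near g, forall y, [set: X * index] y -> `|F y k - F y g| <= e.
  move=> e0.
  have h i : \forall k \near g, forall x, [set: X] x ->
      `|component f (rtrans k x, i) - component f (rtrans g x, i)| <= e.
    exact: (@compact_near_dist R X G setT (fun x k => component f (rtrans k x, i))
      Gam_cocompact (@translate_continuous2 (fun x => component f (x, i)) (cf i)) g e e0).
  have : \forall k \near g, forall i, forall x, [set: X] x ->
      `|component f (rtrans k x, i) - component f (rtrans g x, i)| <= e.
    exact: filter_forall.
  by apply: filterS => k hk -[x i] _; exact: hk.
pose L' u := L (assemble u).
have L'_lin a u v : D u -> D v -> L' (fun y => a * u y + v y) = a * L' u + L' v.
  by move=> Du Dv; rewrite /L' as_lin; apply: L_lin; exact: AD.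
(* The factor 2 passes from real and imaginary parts to moduli of entries. *)
have L'_bound u B : D u -> (forall y, [set: X * index] y -> `|u y| <= B) ->
    `|L' u| <= (c0 * 2) * B.
  move=> Du uB; rewrite -mulrA; apply: L_bound; first exact: AD.
  move=> x i j; apply: le_trans (Re_norm_le _) _; rewrite mxE /= mulr_natl mulr2n.
  by apply: lerD; exact: uB.
pose c g := L' (F ^~ g).
have cc : continuous c.
  exact: (bounded_functional_continuous D_lin L'_lin L'_bound DF F_equi).
have -> : L f = c 1%g.
  by rewrite /c /L' asF; congr L; apply/funext => x; rewrite rtrans1.
apply: (peter_weyl K_subgroup K_compact K_haar cc) => phi [cphi [n [e [ce span]]]].
have bc (u : G -> R) : continuous u -> bounded_borel K u.
  exact: continuous_bounded_borel.
rewrite -(haar_mean_interchange K_subgroup K_compact K_haar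
  D_lin L'_lin L'_bound DF DJ cF F_equi (bc _ cphi)).
rewrite /L'; apply: L_AK; split; first by apply/AD/DJ/bc.
exists n, (fun i => assemble (fun y => J (fun k => e i k * F y k))).
move=> _ [a Ka ->]; have [r rE] := span a Ka.
exists (fun i => (r i)%:C) => x _.
have FE k y : F (rtrans a x, y) k = F (x, y) (a * k)%g by rewrite /F /= rtransM.
(* Invariance of the Haar integral moves right translation by [a] on the coset space to left
   translation of [phi], whose translates span a finite-dimensional space. Hence the average of [f]
   against [phi] is K-finite. *)
have JE y : J (fun k => phi k * F (rtrans a x, y) k) =
    \sum_i r i * J (fun k => e i k * F (x, y) k).
  have cFe i : continuous (fun k => e i k * F (x, y) k).
    by move=> k; apply: cvgM; [exact: ce|exact: cF].
  transitivity (J (fun k => phi (a^-1 * k)%g * F (x, y) k)).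
    rewrite -(haar_mean_mull K_subgroup K_compact K_haar Ka
      (u := fun k => phi (a^-1 * k)%g * F (x, y) k)); last first.
      apply: bc; apply: continuous_realM; last exact: cF.
      move=> k; apply: (@continuous_comp _ _ _ (fun k => (a^-1 * k)%g) phi); last exact: cphi.
      exact: mulg_left_continuous.
    by apply: eq_haar_mean => k _; rewrite FE mulKg.
  rewrite (eq_haar_mean mK (v := fun k => \sum_i r i * (e i k * F (x, y) k))); last first.
    by move=> k _; rewrite rE mulr_suml; apply: eq_bigr => i _; rewrite mulrA.
  rewrite (haar_mean_sum K_subgroup K_compact K_haar); last first.
    by move=> i; apply: bc; apply: continuous_realM; [exact: cst_continuous|exact: cFe].
  by apply: eq_bigr => i _; rewrite (haar_meanZ K_compact K_haar) //; exact: bc.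
apply/matrixP => i j; rewrite mxE summxE !JE.
apply: eq_ReIm.
  rewrite Re_sum /=.
  by apply: eq_bigr => l _; rewrite !mxE Re_mulc /= mul0r subr0.
rewrite Im_sum /=.
by apply: eq_bigr => l _; rewrite !mxE Im_mulc /= mul0r addr0.
Qed.

End Density.

(** * The projection P_T and states *)

Section UnitaryAlgebra.
Variable R : realType.
Local Notation C := R[i].

Lemma adjmxK m n (A : 'M[C]_(m, n)) : adjmx (adjmx A) = A.
Proof. by apply/matrixP => i j; rewrite !mxE conjCK. Qed.

Lemma adjmxM m n k (A : 'M[C]_(m, n)) (B : 'M[C]_(n, k)) :
  adjmx (A *m B) = adjmx B *m adjmx A.
Proof. by rewrite /adjmx trmx_mul map_mxM. Qed.

Lemma adjmxD m n (A B : 'M[C]_(m, n)) : adjmx (A + B) = adjmx A + adjmx B.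
Proof. by rewrite /adjmx linearD map_mxD. Qed.

Lemma adjmxB m n (A B : 'M[C]_(m, n)) : adjmx (A - B) = adjmx A - adjmx B.
Proof. by rewrite /adjmx linearB map_mxB. Qed.

Lemma adjmxZ m n (a : C) (A : 'M[C]_(m, n)) : adjmx (a *: A) = a^*%R *: adjmx A.
Proof. by apply/matrixP => i j; rewrite !mxE rmorphM. Qed.

Lemma adjmx1 n : adjmx (1%:M : 'M[C]_n) = 1%:M.
Proof. by rewrite /adjmx trmx1 map_mx1. Qed.

Lemma cdotE m n (A B : 'M[C]_(m, n)) : cdot A B = \tr (adjmx A *m B).
Proof.
rewrite /mxtrace /cdot exchange_big; apply: eq_bigr => j _.
by rewrite mxE; apply: eq_bigr => i _; rewrite !mxE.
Qed.

Lemma cdot_mull m n k (U : 'M[C]_(k, m)) (A : 'M[C]_(m, n)) (B : 'M[C]_(k, n)) :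
  cdot (U *m A) B = cdot A (adjmx U *m B).
Proof. by rewrite !cdotE adjmxM mulmxA. Qed.

Lemma cdot_mulr m n k (U : 'M[C]_(n, k)) (A : 'M[C]_(m, n)) (B : 'M[C]_(m, k)) :
  cdot (A *m U) B = cdot A (B *m adjmx U).
Proof. by rewrite !cdotE adjmxM -mulmxA mxtrace_mulC mulmxA. Qed.

Lemma cnorm_unitary m n (U : 'M[C]_m) (A : 'M[C]_(m, n)) :
  adjmx U *m U = 1%:M -> cnorm (U *m A) = cnorm A.
Proof. by move=> U1; rewrite /cnorm cdot_mull mulmxA U1 mul1mx. Qed.

Section Representation.
Variables (G : lieGroup R) (S : set G) (d : nat) (r : G -> 'M[C]_d).
Hypothesis S_subgroup : subgroup S.
Hypothesis r_unitary : unitary_rep S r.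

Lemma unitary_repV x : S x -> r (x^-1)%g = adjmx (r x).
Proof.
case: S_subgroup => _ _ SV; case: r_unitary => r1 rM rU _ Sx.
by rewrite -[LHS]mulmx1 -(rU x Sx) mulmxA -rM // ?mulVg ?r1 ?mul1mx //; exact: SV.
Qed.

Lemma unitary_rep_adjmx x : S x -> adjmx (r x) *m r x = 1%:M.
Proof.
move=> Sx; case: S_subgroup => _ _ SV; case: r_unitary => r1 rM rU _.
by rewrite -unitary_repV // -rM ?mulVg //; exact: SV.
Qed.

Lemma unitary_rep_invmx x : S x -> invmx (r x) = adjmx (r x).
Proof.
move=> Sx; have [_ _ rU _] := r_unitary.
have /mulmx1_unit[ru _] := rU x Sx.
by rewrite -[LHS]mulmx1 -(rU x Sx) mulmxA mulVmx // mul1mx.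
Qed.

(** An eigenspace of [A] is invariant and nonzero, hence everything. The transposes match the
    row-space encoding in [irreducible_rep]. *)
Lemma schur (A : 'M[C]_d) : irreducible_rep S r ->
  (forall x, S x -> r x *m A = A *m r x) -> exists a : C, A = a%:M.
Proof.
move=> [d0 irr] Acomm.
have [a aA] := eigenvalue_closed A^T d0.
exists a; have stable x : S x -> stablemx (eigenspace A^T a) (r x)^T.
  move=> Sx; apply/eigenspaceP.
  rewrite -mulmxA -trmx_mul -Acomm // trmx_mul mulmxA.
  by have /eigenspaceP -> := submx_refl (eigenspace A^T a); rewrite -scalemxAl.
have [/eqP|full] := irr _ stable.
  by rewrite mxrank_eq0 => /eqP E0; move: aA; rewrite /eigenvalue E0 eqxx.
have : (1%:M <= eigenspace A^T a)%MS by rewrite sub1mx /row_full full.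
by move=> /eigenspaceP; rewrite mul1mx => /(congr1 trmx); rewrite trmxK linearZ /= trmx1 scalemx1.
Qed.

End Representation.

End UnitaryAlgebra.

Section Projection.
Variables (R : realType) (G : lieGroup R) (g : lieAlgebra G) (K : set G).
Variables (I : iwasawa g K) (p q : nat).
Variables (gamma : G -> 'M[R[i]]_p) (kappa : G -> 'M[R[i]]_q).
Hypothesis K_subgroup : subgroup K.
Hypothesis gamma_unitary : unitary_rep K gamma.
Hypothesis kappa_unitary : unitary_rep (iw_M I) kappa.
Hypothesis kappa_irreducible : irreducible_rep (iw_M I) kappa.
Variable T : 'M[R[i]]_(q, p).
Hypothesis T_invariant : M_invariant I kappa gamma T.
Hypothesis T_norm : cnorm T = 1.

Lemma iw_M_subgroup : subgroup (iw_M I).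
Proof.
case: K_subgroup => K1 KM KV; split.
- by split=> // a _; rewrite mul1g mulg1.
- move=> x y [Kx xa] [Ky ya]; split; first exact: KM.
  by move=> a Aa; rewrite -mulgA ya // mulgA xa // mulgA.
- move=> x [Kx xa]; split; first exact: KV.
  move=> a Aa; apply: (mulgI x); rewrite mulgA mulgV mul1g.
  by rewrite mulgA xa // -mulgA mulgV mulg1.
Qed.

Lemma iw_M_sub m : iw_M I m -> K m. Proof. by case. Qed.

(** [T *m adjmx T] commutes with [kappa], so it is a scalar; its trace is the squared norm of [T],
    that is 1, which fixes the scalar as the inverse of [q]. *)
Lemma scaled_gram_eq1 : q%:R *: (T *m adjmx T) = 1%:M.
Proof.
have [a aE] : exists a, T *m adjmx T = a%:M.
  apply: (schur kappa_irreducible) => m Mm.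
  have Km := iw_M_sub Mm.
  have kk := unitary_rep_adjmx iw_M_subgroup kappa_unitary Mm.
  have gg : (gamma m)^T *m adjmx (gamma m)^T = 1%:M.
    rewrite -[adjmx _]/(map_mx Num.conj (gamma m)^T^T) trmxK.
    have := unitary_rep_adjmx K_subgroup gamma_unitary Km.
    by move=> /(congr1 trmx); rewrite trmx_mul trmx1 /adjmx -map_trmx trmxK.
  have e : kappa m *m T *m (gamma m)^T = T := T_invariant Mm.
  rewrite -[in RHS]e !adjmxM mulmxA; rewrite -(mulmxA _ (gamma m)^T).
  rewrite [(gamma m)^T *m (_ *m _)]mulmxA gg mul1mx.
  by rewrite -!mulmxA kk mulmx1 !mulmxA.
rewrite aE scale_scalar_mx; congr (_%:M).
have tr1 : \tr (T *m adjmx T) = 1.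
  rewrite mxtrace_mulC -cdotE.
  apply: eq_ReIm; first by rewrite -cnorm_sqr T_norm expr1n.
  rewrite /= /cdot Im_sum big1 // => i _; rewrite Im_sum big1 // => j _.
  by rewrite Im_mulc Re_conjc Im_conjc; ring.
transitivity (\tr (a%:M : 'M[R[i]]_q)); last by rewrite -aE.
by rewrite mxtrace_scalar mulr_natl.
Qed.

(** In the matrix encoding of the tensor product, [1 (x) P_T] acts by right multiplication with the
    transpose. *)
Lemma P_T_absorb : T *m (P_T T)^T = T.
Proof.
rewrite /P_T /hom_of linearZ /= trmx_mul trmxK.
have -> : (adjmx T^T)^T = adjmx T by rewrite /adjmx trmxK map_trmx.
by rewrite -scalemxAr mulmxA scalemxAl scaled_gram_eq1 mul1mx.
Qed.

Lemma P_T_self_adjoint : adjmx (P_T T) = P_T T.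
Proof. by rewrite /P_T adjmxZ adjmxM adjmxK rmorph_nat. Qed.

Lemma P_T_idempotent : P_T T *m P_T T = P_T T.
Proof.
have h : P_T T *m T^T = T^T by rewrite -[RHS](congr1 trmx P_T_absorb) trmx_mul trmxK.
by rewrite {2}/P_T /hom_of -scalemxAr mulmxA h.
Qed.

Lemma P_T_commute m : iw_M I m -> gamma m *m P_T T = P_T T *m gamma m.
Proof.
move=> Mm; have Km := iw_M_sub Mm.
have [_ _ gU _] := gamma_unitary.
suff h : gamma m *m P_T T *m adjmx (gamma m) = P_T T.
  have := congr1 (mulmx^~ (gamma m)) h; rewrite /= -mulmxA.
  by rewrite (unitary_rep_adjmx K_subgroup gamma_unitary Km) mulmx1.
have e : T^T = gamma m *m T^T *m (kappa m)^T.
  by rewrite -[LHS](congr1 trmx (T_invariant Mm)) !trmx_mul trmxK mulmxA.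
have kk : (kappa m)^T *m adjmx (kappa m)^T = 1%:M.
  rewrite -[adjmx _]/(map_mx Num.conj (kappa m)^T^T) trmxK.
  have := unitary_rep_adjmx iw_M_subgroup kappa_unitary Mm.
  by move=> /(congr1 trmx); rewrite trmx_mul trmx1 /adjmx -map_trmx trmxK.
rewrite /P_T /hom_of [in RHS]e !adjmxM -scalemxAr -scalemxAl; congr (_ *: _).
by rewrite !mulmxA -(mulmxA _ (kappa m)^T) kk mulmx1.
Qed.

End Projection.

(** * Compressing a state by a projection of value 1 *)

Section States.
Variables (R : realType) (G : lieGroup R) (Gam : set G) (p : nat).
Local Notation X := (coset_space Gam).
Variable s : (X -> 'M[R[i]]_p) -> R[i].
Hypothesis s_state : state s.
Implicit Types f h : X -> 'M[R[i]]_p.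

Lemma in_A_cst (A : 'M[R[i]]_p) : in_A (fun _ : X => A).
Proof. exact: cst_continuous. Qed.
Arguments in_A_cst : clear implicits.

Lemma in_AM f h : in_A f -> in_A h -> in_A (fun x => f x *m h x).
Proof. exact: continuous_mulmx. Qed.

Lemma in_AD f h : in_A f -> in_A h -> in_A (fun x => f x + h x).
Proof. exact: continuous_mxD. Qed.

Lemma in_AZ (a : R[i]) f : in_A f -> in_A (fun x => a *: f x).
Proof. exact: continuous_mxZ. Qed.

Lemma in_A_adj f : in_A f -> in_A (fun x => adjmx (f x)).
Proof.
move=> /continuous_mxP cf; apply/continuous_mxP => i j.
by under eq_fun do rewrite !mxE; apply: ccont_conj.
Qed.

Lemma state0 : s (fun=> 0) = 0.
Proof.
case: s_state => lin _ _ _; have := lin 1 _ _ (in_A_cst 0) (in_A_cst 0).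
by rewrite /= scale1r addr0 mul1r => /(congr1 (fun z => z - s (fun=> 0))); rewrite subrr addrK.
Qed.

Lemma stateD f h : in_A f -> in_A h -> s (fun x => f x + h x) = s f + s h.
Proof.
move=> Af Ah; case: s_state => lin _ _ _; have := lin 1 _ _ Af Ah.
by rewrite mul1r => <-; congr s; apply/funext => x; rewrite scale1r.
Qed.

Lemma stateZ a f : in_A f -> s (fun x => a *: f x) = a * s f.
Proof.
move=> Af; case: s_state => lin _ _ _; have := lin a _ _ Af (in_A_cst 0).
by rewrite state0 addr0 => <-; congr s; apply/funext => x; rewrite addr0.
Qed.

Lemma stateB f h : in_A f -> in_A h -> s (fun x => f x - h x) = s f - s h.
Proof.
move=> Af Ah; have e : s (fun x => -1 *: h x) = - s h by rewrite (stateZ _ Ah) mulN1r.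
rewrite -e -(stateD Af (@in_AZ (-1) h Ah)).
by congr s; apply/funext => x; rewrite scaleN1r.
Qed.

(* Positivity of [s] on [(z f^* + Q)^* (z f^* + Q)] for [z = t] and [z = i t]
   with [t] real and small forces the terms linear in [z] to vanish. *)
Lemma state_null_projection (Q : 'M[R[i]]_p) f :
  adjmx Q = Q -> Q *m Q = Q -> s (fun=> Q) = 0 -> in_A f ->
  s (fun x => f x *m Q) = 0 /\ s (fun x => Q *m adjmx (f x)) = 0.
Proof.
move=> Qa QQ sQ Af; have [_ pos _ _] := s_state.
have Aa := in_A_adj Af; have AQ := in_A_cst Q.
set b := s (fun x => f x *m Q); set c := s (fun x => Q *m adjmx (f x)).
set a := s (fun x => f x *m adjmx (f x)).
have key (z : R[i]) : 0 <= z^*%R * z * a + z^*%R * b + z * c.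
  have := pos (fun x => z *: adjmx (f x) + Q) (in_AD (@in_AZ z _ Aa) AQ).
  congr (0 <= _).
  rewrite (_ : (fun x => _) = (fun x => (z^*%R * z) *: (f x *m adjmx (f x)) +
      z^*%R *: (f x *m Q) + z *: (Q *m adjmx (f x)) + Q)); last first.
    apply/funext => x; rewrite adjmxD adjmxZ adjmxK Qa mulmxDl !mulmxDr QQ.
    by rewrite -!scalemxAl -!scalemxAr scalerA !addrA.
  have A1 := @in_AZ (z^*%R * z) _ (in_AM Af Aa).
  have A2 := @in_AZ (z^*%R) _ (in_AM Af AQ).
  have A3 := @in_AZ z _ (in_AM AQ Aa).
  rewrite (stateD (in_AD (in_AD A1 A2) A3) AQ) (stateD (in_AD A1 A2) A3).
  rewrite (stateD A1 A2) sQ addr0.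
  by rewrite (stateZ _ (in_AM Af Aa)) (stateZ _ (in_AM Af AQ)) (stateZ _ (in_AM AQ Aa)).
(* At [t = - v / (|u| + 1)] the linear term outweighs the quadratic one unless [v = 0]. *)
have small (u v : R) : (forall t : R, 0 <= t ^+ 2 * u + t * v) -> v = 0.
  move=> h; apply/eqP; apply: contrapT => /negP v0.
  have u1 : 0 < `|u| + 1 by rewrite ltr_wpDl.
  have := h (- v / (`|u| + 1)).
  have -> : (- v / (`|u| + 1)) ^+ 2 * u + - v / (`|u| + 1) * v =
      (v / (`|u| + 1)) ^+ 2 * (u - (`|u| + 1)).
    by field; rewrite gt_eqF.
  have : 0 < (v / (`|u| + 1)) ^+ 2.
    by rewrite exprn_even_gt0 //= mulf_neq0 // invr_eq0 gt_eqF.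
  have := ler_norm u; nra.
have a_im : complex.Im a = 0.
  have := pos _ Aa; rewrite (_ : (fun x => _) = (fun x => f x *m adjmx (f x))).
    by rewrite -/a lecE /= => /andP[/eqP].
  by apply/funext => x; rewrite adjmxK.
have bc1 (t : R) := key t%:C.
have bc2 (t : R) := key (0 +i* t).
have r1 : complex.Re b + complex.Re c = 0.
  apply: (small (complex.Re a)) => t; have := bc1 t; rewrite lecE => /andP[_].
  by rewrite !Re_addc !Re_mulc ?Im_mulc ?Re_conjc ?Im_conjc /=; lra.
have i1 : complex.Im b + complex.Im c = 0.
  have := bc1 1; rewrite lecE => /andP[/eqP + _].
  by rewrite !Im_addc !Im_mulc ?Re_mulc ?Re_conjc ?Im_conjc /= a_im; lra.
have r2 : complex.Im b - complex.Im c = 0.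
  apply: (small (complex.Re a)) => t; have := bc2 t; rewrite lecE => /andP[_].
  by rewrite !Re_addc !Re_mulc ?Im_mulc ?Re_conjc ?Im_conjc /=; lra.
have i2 : - complex.Re b + complex.Re c = 0.
  have := bc2 1; rewrite lecE => /andP[/eqP + _].
  by rewrite !Im_addc !Im_mulc ?Re_mulc ?Re_conjc ?Im_conjc /= a_im; lra.
by split; apply: eq_ReIm; rewrite /=; lra.
Qed.

(** With [Q = 1 - P] one has [f - P f P = Q f + P f Q], and [s Q = 0] makes [s] vanish on both
    terms. *)
Lemma state_compress (P : 'M[R[i]]_p) f :
  adjmx P = P -> P *m P = P -> s (fun=> P) = 1 -> in_A f ->
  s (fun x => P *m f x *m P) = s f.
Proof.
move=> Pa PP sP Af; have [_ _ s1 _] := s_state.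
pose Q := 1%:M - P.
have Qa : adjmx Q = Q by rewrite /Q adjmxB adjmx1 Pa.
have QQ : Q *m Q = Q by rewrite /Q mulmxBl mul1mx mulmxBr mulmx1 PP subrr subr0.
have sQ : s (fun=> Q) = 0.
  rewrite (stateB (in_A_cst 1%:M) (in_A_cst P)) sP.
  by rewrite [s _]s1 subrr.
have AQ := in_A_cst Q.
have right h : in_A h -> s (fun x => h x *m Q) = 0.
  by move=> Ah; have [] := state_null_projection Qa QQ sQ Ah.
have left h : in_A h -> s (fun x => Q *m h x) = 0.
  move=> Ah; have [_] := state_null_projection Qa QQ sQ (in_A_adj Ah).
  by move=> <-; congr s; apply/funext => x; rewrite adjmxK.
have -> : (fun x => P *m f x *m P) =
    (fun x => f x - (Q *m f x + (P *m f x) *m Q)).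
  apply/funext => x; rewrite /Q mulmxBl mul1mx mulmxBr mulmx1.
  by rewrite addrA subrK subKr.
have AP := in_A_cst P.
have A1 := in_AM AQ Af; have A2 := in_AM AP Af; have A3 := in_AM A2 AQ.
by rewrite (stateB Af (in_AD A1 A3)) (stateD A1 A3) (left _ Af) (right _ A2) addr0 subr0.
Qed.

End States.

(** * Invariance of the functionals sigma *)

Section ComplexMeasurability.
Variables (R : realType) (d : measure_display) (Y : measurableType d).
Implicit Types u v : Y -> R[i].
Local Notation Re := complex.Re.
Local Notation Im := complex.Im.

Lemma cmeasurable_cst (D : set Y) (a : R[i]) : cmeasurable D (fun=> a).
Proof. by split; exact: measurable_cst. Qed.

Lemma cmeasurableD (D : set Y) u v : cmeasurable D u -> cmeasurable D v ->
  cmeasurable D (fun y => u y + v y).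
Proof.
move=> [ur ui] [vr vi]; split.
  by under eq_fun do rewrite Re_addc; exact: measurable_funD.
by under eq_fun do rewrite Im_addc; exact: measurable_funD.
Qed.

Lemma cmeasurableM (D : set Y) u v : cmeasurable D u -> cmeasurable D v ->
  cmeasurable D (fun y => u y * v y).
Proof.
move=> [ur ui] [vr vi]; split.
  under eq_fun do rewrite Re_mulc; apply: measurable_funB; exact: measurable_funM.
under eq_fun do rewrite Im_mulc; apply: measurable_funD; exact: measurable_funM.
Qed.

Lemma cmeasurable_conj (D : set Y) u : cmeasurable D u ->
  cmeasurable D (fun y => (u y)^*%R).
Proof.
move=> [ur ui]; split; first by under eq_fun do rewrite Re_conjc.
under eq_fun do rewrite Im_conjc; exact: measurableT_comp.
Qed.

Lemma cmeasurable_sum (D : set Y) (I : Type) (s : seq I) (u : I -> Y -> R[i]) :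
  (forall i, cmeasurable D (u i)) -> cmeasurable D (fun y => \sum_(i <- s) u i y).
Proof.
move=> mu; elim: s => [|i s IH].
  by under eq_fun do rewrite big_nil; exact: cmeasurable_cst.
by under eq_fun do rewrite big_cons; exact: cmeasurableD.
Qed.

Lemma cmeasurable_mulmx (D : set Y) m n k (A : Y -> 'M[R[i]]_(m, n))
    (B : Y -> 'M[R[i]]_(n, k)) :
  (forall i j, cmeasurable D (fun y => A y i j)) ->
  (forall i j, cmeasurable D (fun y => B y i j)) ->
  forall i j, cmeasurable D (fun y => (A y *m B y) i j).
Proof.
move=> mA mB i j; under eq_fun do rewrite mxE.
by apply: cmeasurable_sum => l; exact: cmeasurableM.
Qed.

Lemma cmeasurable_cdot (D : set Y) m n (A B : Y -> 'M[R[i]]_(m, n)) :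
  (forall i j, cmeasurable D (fun y => A y i j)) ->
  (forall i j, cmeasurable D (fun y => B y i j)) ->
  cmeasurable D (fun y => cdot (A y) (B y)).
Proof.
move=> mA mB; apply: cmeasurable_sum => i; apply: cmeasurable_sum => j.
by apply: cmeasurableM => //; exact: cmeasurable_conj.
Qed.

Lemma cmeasurable_Re_norm_sqr u : cmeasurable setT u ->
  measurable_fun setT (fun y => Re `|u y| ^+ 2).
Proof.
move=> [ur ui]; under eq_fun do rewrite Re_norm_sqr.
by apply: measurable_funD; under eq_fun do rewrite expr2; exact: measurable_funM.
Qed.

Lemma cintegral_sqr_eq0 (mu : {measure set Y -> \bar R}) u :
  cmeasurable setT u -> (\int[mu]_y (Re `|u y| ^+ 2)%:E = 0)%E ->
  {ae mu, forall y, u y = 0}.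
Proof.
move=> mu' e.
have mn : measurable_fun setT (fun y => (Re `|u y| ^+ 2)%:E).
  by apply/measurable_EFinP; exact: cmeasurable_Re_norm_sqr.
have := (ae_eq_integral_abs mu measurableT mn).1.
under eq_integral => x _ do rewrite gee0_abs ?lee_fin ?sqr_ge0 //.
move=> /(_ e); apply: filterS => y /(_ Logic.I) [] /eqP.
rewrite sqrf_eq0 => /eqP h; apply/eqP.
by rewrite -normr_eq0 (normE (u y)) (h : Re `|u y| = 0) eqxx.
Qed.

Lemma ae_eq_cintegral (mu : {measure set Y -> \bar R}) u v :
  cmeasurable setT u -> cmeasurable setT v ->
  {ae mu, forall y, u y = v y} -> cintegral mu setT u = cintegral mu setT v.
Proof.
move=> [ur ui] [vr vi] uv; rewrite /cintegral /Rintegral.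
congr (fine _ +i* fine _); apply: ae_eq_integral => //;
  try (exact/measurable_EFinP);
  by apply: filterS uv => y ->.
Qed.

Lemma cintegral_invariant (mu : {measure set Y -> \bar R}) (f : Y -> Y) u :
  measurable_fun setT f -> cmeasurable setT u ->
  (forall B, measurable B -> mu (f @^-1` B) = mu B) ->
  cintegral mu setT (u \o f) = cintegral mu setT u.
Proof.
move=> mf [ur ui] inv; rewrite /cintegral; congr (_ +i* _).
  exact: (Rintegral_invariant mf ur inv).
exact: (Rintegral_invariant mf ui inv).
Qed.

End ComplexMeasurability.

(** * The restriction of the principal series to [K] *)

Section ExpZero.
Variables (R : realType) (G : lieGroup R) (g : lieAlgebra G) (K : set G).
Variable I : iwasawa g K.
Hypothesis K_subgroup : subgroup K.

Lemma la_exp0 : la_exp (0 : g) = 1%g.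
Proof.
have := la_expD (0 : g) 0 0; rewrite !scaler0 => e.
by apply: (mulgI (la_exp (0 : g))); rewrite -e mulg1.
Qed.

Lemma iwasawa_K k : K k -> iw_k I k = k /\ iw_log I k = 0.
Proof.
move=> Kk.
have n1 : analytic_subgroup (iw_n I) (1%g : G) by move=> S [].
have [] := @iw_unique _ _ _ _ I k 1%g 0 Kk n1.
have -> : vsval (0 : subvs_of (iw_a I)) = 0 by exact: linear0.
by rewrite la_exp0 !mulg1.
Qed.

Lemma smooth0 : smooth (fun _ : G => 0 : R).
Proof.
move=> c _ k; elim: k => [|k IH] /=.
  by split=> // x _; exact: cst_continuous.
split=> [x _|v]; first exact: cst_continuous.
split=> [x _|]; first exact: derivable_cst.
rewrite (_ : (fun x => _) = ((fun=> 0) \o point_of c)) //.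
by apply/funext => x /=; rewrite derive_cst.
Qed.

(** The bracket is given through commutators of fields, so its vanishing is tested on smooth
    functions. This yields [rho 0 = 0] in [apow0]. *)
Lemma la_bracket0 (Z : g) : la_bracket (0 : g) Z = 0.
Proof.
have fieldD (Y : g) : left_invariant_field (la_field Y) by exact: la_field_invariant.
have field0 f x : smooth f -> la_field (0 : g) f x = 0.
  move=> sf; have := la_field_linear 1 (0 : g) 0 x sf; rewrite scaler0 addr0 mul1r.
  by move/eqP; rewrite -subr_eq0 opprD addrA subrr sub0r oppr_eq0 => /eqP.
have fieldc (Y : g) : la_field Y (fun=> 0) = (fun=> 0).
  have [_ lin _ _] := fieldD Y; have := lin 1 (fun=> 0) (fun=> 0) smooth0 smooth0.
  rewrite (_ : (fun x : G => 1 * 0 + 0) = (fun=> 0)); last first.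
    by apply/funext => x; rewrite mulr0 addr0.
  move=> e; apply/funext => x; have := congr1 (fun h => h x) e.
  by rewrite /= mul1r => /eqP; rewrite -subr_eq0 opprD addrA subrr sub0r oppr_eq0 => /eqP.
apply: (@la_field_inj _ _ g) => f sf; apply/funext => x.
rewrite la_bracketE // field0; last by have [sm _ _ _] := fieldD Z; exact: sm.
rewrite (_ : la_field (0 : g) f = (fun=> 0)); last by apply/funext => y; exact: field0.
by rewrite fieldc subrr.
Qed.

Lemma apow0 (lam : adual I) : apow lam 0 = 1.
Proof.
rewrite /apow; have -> : rho (0 : subvs_of (iw_a I)) = 0.
  rewrite /rho /trace_on big1 ?mulr0 // => i _.
  by rewrite linear0 la_bracket0 linear0.
by rewrite oppr0 expR0 linear0 cos0 sin0; apply: eq_ReIm; rewrite /=; ring.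
Qed.

(** The A-component of an element of [K] is trivial, so [lam] disappears; this lets one invariance
    statement serve all the embeddings [xi n]. *)
Lemma ps_act_K d (lam : adual I) (phi : G -> 'cV[R[i]]_d) m k : K m -> K k ->
  ps_act lam (m^-1)%g phi k = phi (m * k)%g.
Proof.
move=> Km Kk; rewrite /ps_act invgK.
have [-> ->] := @iwasawa_K (m * k)%g ltac:(by case: K_subgroup => _ KM _; exact: KM).
by rewrite apow0 scale1r.
Qed.

End ExpZero.

Section Embedding.
Variables (R : realType) (G : lieGroup R) (g : lieAlgebra G) (K Gam : set G).
Variable I : iwasawa g K.
Variable mK : {measure set (borel G) -> \bar R}.
Variable nu : {measure set (borel (coset_space Gam)) -> \bar R}.
Variables (p q : nat) (kappa : G -> 'M[R[i]]_q).
Hypothesis K_subgroup : subgroup K.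
Hypothesis K_compact : compact K.
Hypothesis K_haar : haar_measure K mK.
Hypothesis Gam_subgroup : subgroup Gam.
Hypothesis nu_invariant : invariant_measure nu.
Local Notation C := R[i].
Local Notation V := 'cV[R[i]]_q.
Local Notation X := (coset_space Gam).
Local Notation Re := complex.Re.
Local Notation Im := complex.Im.
Local Notation M := (iw_M I).

(** A convenient domain for [xi]: it contains the columns of [psi_T] and [delta_T], lies in [in_H],
    and is stable under combinations and translations by [K]. *)
Definition continuous_section (phi : G -> V) : Prop :=
  {within K, continuous phi} /\
  forall k m, K k -> M m -> phi (k * m)%g = invmx (kappa m) *m phi k.
Local Notation cs := continuous_section.

Let M_sub m : M m -> K m. Proof. exact: iw_M_sub. Qed.
Let KM x y : K x -> K y -> K (x * y)%g.
Proof. by case: K_subgroup => _ h _; exact: h. Qed.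
Let KV x : K x -> K (x^-1)%g.
Proof. by case: K_subgroup => _ _; exact. Qed.

Lemma eq_continuous_section phi psi : (forall k, K k -> phi k = psi k) ->
  cs psi -> cs phi.
Proof.
move=> e [cpsi eqv]; split; last first.
  by move=> k m Kk Mm; rewrite !e //; [exact: eqv|exact: KM (M_sub Mm)].
by apply: subspace_eq_continuous cpsi => x /set_mem Kx; exact/esym/e.
Qed.

Lemma continuous_section_lin a phi psi : cs phi -> cs psi ->
  cs (fun k => a *: phi k + psi k).
Proof.
move=> [cphi ephi] [cpsi epsi]; split.
  apply: (@continuous_mxD R (subspace K) _ _ (fun k => a *: phi k) psi _ cpsi).
  exact: (@continuous_mxZ R (subspace K) _ _ a phi cphi).
by move=> k m Kk Mm; rewrite ephi // epsi // mulmxDr -scalemxAr.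
Qed.

Lemma continuous_section0 : cs (fun=> 0).
Proof. by split=> [|k m _ _]; [exact: cst_continuous|rewrite mulmx0]. Qed.

Lemma continuous_section_sum n (a : 'I_n -> C) (phi : 'I_n -> G -> V) :
  (forall i, cs (phi i)) -> cs (fun k => \sum_i a i *: phi i k).
Proof.
elim: n a phi => [|n IH] a phi cphi.
  by under eq_fun do rewrite big_ord0; exact: continuous_section0.
by under eq_fun do rewrite big_ord_recl; apply: continuous_section_lin => //; exact: IH.
Qed.

Lemma continuous_section_translate a phi : K a -> cs phi ->
  cs (fun k => phi (a * k)%g).
Proof.
move=> Ka [cphi ephi]; split; last first.
  by move=> k m Kk Mm; rewrite mulgA (ephi _ _ (KM Ka Kk) Mm).
apply/subspace_continuousP => x Kx.
have Kax : K (a * x)%g by exact: KM.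
have /subspace_continuousP /(_ _ Kax) h := cphi.
apply: (cvg_comp (fun k => (a * k)%g) phi _ h).
move=> P nP.
have nP' : \forall y \near x, K (a * y)%g -> P (a * y)%g.
  exact: (@mulg_left_continuous R G a x _ nP).
change (\forall y \near x, K y -> P (a * y)%g).
by apply: filterS nP' => y h' Ky; apply: h'; exact: KM.
Qed.

Let K_borel' : measurable (K : set (borel G)) := K_borel K_compact.

Let mK_fin : (mK K < +oo)%E. Proof. by case: K_haar => -> _ _; rewrite ltry. Qed.

Lemma within_haar_integrable (u : G -> R) : {within K, continuous u} ->
  mK.-integrable (K : set (borel G)) (EFin \o (u : borel G -> R)).
Proof.
move=> cu; apply: measurable_bounded_integrable => //.
  exact: within_continuous_borel_measurable.
have [||c cK h] := @compact_EVT_max _ R (fun x => `|u x|) K _ K_compact.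
- by exists 1%g; case: K_subgroup.
- by move=> x; apply: (@cvg_norm _ R^o); exact: cu.
exists `|u c|; split; first exact: num_real.
by move=> B cB x Kx; apply: le_trans (ltW cB); apply: h; rewrite inE.
Qed.

Lemma within_cnorm_sqr (phi : G -> V) : {within K, continuous phi} ->
  {within K, continuous (fun k => cnorm (phi k) ^+ 2)}.
Proof.
move=> cphi; have [cr _] : ccont ((fun k => cdot (phi k) (phi k)) : subspace K -> C).
  apply: ccont_sum => i; apply: ccont_sum => j; apply: ccontM.
    by apply: ccont_conj; exact: (continuous_mxP _).1.
  exact: (continuous_mxP _).1.
by under eq_fun do rewrite cnorm_sqr.
Qed.

Lemma continuous_section_in_H phi : cs phi -> in_H I mK kappa phi.
Proof.
move=> [cphi ephi]; split=> // [i|].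
  have [cr ci] := (continuous_mxP _).1 cphi i 0.
  by split; apply: within_continuous_borel_measurable.
have /integrableP[_] := within_haar_integrable (within_cnorm_sqr cphi).
apply: le_lt_trans; apply: ge0_le_integral => //=.
- by move=> x _; rewrite lee_fin sqr_ge0.
- apply/measurable_EFinP; apply: within_continuous_borel_measurable => //.
  exact: within_cnorm_sqr.
- apply/measurable_EFinP; apply: measurableT_comp => //.
  apply: within_continuous_borel_measurable => //.
  exact: within_cnorm_sqr.
by move=> x _; rewrite lee_fin ler_norm.
Qed.

Variables (lam : adual I) (xi : (G -> V) -> X -> C).
Hypothesis xi_embedding : unitary_embedding mK kappa nu lam xi.

Definition null_section (phi : G -> V) : Prop :=
  (\int[mK]_(k in (K : set (borel G))) (cnorm (phi k) ^+ 2)%:E = 0)%E.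

Let in_H_cs phi : cs phi -> in_H I mK kappa phi := @continuous_section_in_H phi.

Lemma xi_null phi : cs phi -> null_section phi ->
  {ae nu, forall x : borel X, xi phi x = 0}.
Proof.
move=> cphi null; have [L2 _ iso _] := xi_embedding.
have [mxi _] := L2 phi (in_H_cs cphi).
have e : (\int[nu]_(x in [set: borel X]) (Re `|xi phi x| ^+ 2)%:E = 0)%E.
  by rewrite (iso phi (in_H_cs cphi)).
exact (@cintegral_sqr_eq0 R _ (borel X) nu (xi phi) mxi e).
Qed.

(** [xi] acts on representatives; the isometry property makes it descend, almost everywhere, to
    classes of sections. *)
Lemma xi_eq phi psi : cs phi -> cs psi -> null_section (fun k => phi k - psi k) ->
  {ae nu, forall x : borel X, xi phi x = xi psi x}.
Proof.
move=> cphi cpsi null; have [_ lin _ _] := xi_embedding.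
pose d k := (-1) *: psi k + phi k.
have dE : d = (fun k => phi k - psi k).
  by apply/funext => k; rewrite /d scaleN1r addrC.
have cd : cs d by exact: continuous_section_lin.
have h1 := lin 1 d psi (in_H_cs cd) (in_H_cs cpsi).
have h2 : {ae nu, forall x : borel X, xi d x = 0} by apply: xi_null => //; rewrite dE.
apply: filterS2 h1 h2 => x h1 h2.
have phiE : (fun k => 1 *: d k + psi k) = phi.
  by apply/funext => k; rewrite scale1r dE subrK.
by rewrite -{1}phiE h1 h2 mulr0 add0r.
Qed.

Lemma null_section0 phi : (forall k, K k -> phi k = 0) -> null_section phi.
Proof.
move=> phi0; rewrite /null_section; apply: integral0_eq => k Kk.
have -> : phi k = 0 by exact: phi0.
by rewrite cnorm_sqr /cdot big1 // => i _; rewrite big1 // => j _; rewrite !mxE mulr0.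
Qed.

Lemma xi_sum n (a : 'I_n -> C) (phi : 'I_n -> G -> V) : (forall i, cs (phi i)) ->
  {ae nu, forall x : borel X,
     xi (fun k => \sum_i a i *: phi i k) x = \sum_i a i * xi (phi i) x}.
Proof.
have [_ lin _ _] := xi_embedding.
elim: n a phi => [|n IH] a phi cphi.
  have -> : (fun k => \sum_(i < 0) a i *: phi i k) = (fun=> 0).
    by apply/funext => k; rewrite big_ord0.
  have := xi_null continuous_section0 (null_section0 (fun _ _ => erefl)).
  by apply: filterS => x ->; rewrite big_ord0.
pose r k := \sum_(i < n) a (lift ord0 i) *: phi (lift ord0 i) k.
have cr : cs r by exact: continuous_section_sum.
have h1 := lin (a ord0) _ _ (in_H_cs (cphi ord0)) (in_H_cs cr).
have h2 := IH (fun i => a (lift ord0 i)) (fun i => phi (lift ord0 i)) (fun i => cphi _).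
apply: filterS2 h1 h2 => x h1 h2.
have -> : (fun k => \sum_i a i *: phi i k) = (fun k => a ord0 *: phi ord0 k + r k).
  by apply/funext => k; rewrite big_ord_recl.
by rewrite h1 big_ord_recl /r h2.
Qed.

Lemma xi_translate a phi : K a -> cs phi ->
  {ae nu, forall x : borel X,
     xi (fun k => phi (a * k)%g) x = xi phi (rtrans a^-1%g x)}.
Proof.
move=> Ka cphi; have [_ _ _ eqv] := xi_embedding.
have psE k : K k -> ps_act lam a^-1%g phi k = phi (a * k)%g by exact: ps_act_K.
have cps : cs (ps_act lam a^-1%g phi).
  exact: eq_continuous_section psE (continuous_section_translate Ka cphi).
have h1 := eqv a^-1%g phi (in_H_cs cphi).
have null k : K k -> phi (a * k)%g - ps_act lam a^-1%g phi k = 0.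
  by move=> Kk; rewrite psE // subrr.
have h2 := xi_eq (continuous_section_translate Ka cphi) cps (null_section0 null).
by apply: filterS2 h1 h2 => x h1 ->.
Qed.

(** [Phi] is fixed in L^2 by the action of [a^-1] on sections combined with [B] on [V_gamma]. As [B]
    need not be invertible or tied to [a], both [gamma m] inverse and [P_T] are allowed. *)
Definition translate_fixed (a : G) (B : 'M[C]_p) (Phi : G -> 'M[C]_(q, p)) : Prop :=
  forall j, null_section (fun k => col j (Phi (a * k)%g *m B^T) - col j (Phi k)).

Lemma ext_xi_fixed a B Phi : K a -> columns_in cs Phi -> translate_fixed a B Phi ->
  {ae nu, forall x : borel X,
     B *m ext_xi xi Phi (rtrans a^-1%g x) = ext_xi xi Phi x}.
Proof.
move=> Ka cPhi fixed.
have colE i : (fun k => col i (Phi (a * k)%g *m B^T)) =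
    (fun k => \sum_j B i j *: col j (Phi (a * k)%g)).
  apply/funext => k; apply/matrixP => r c; rewrite !mxE summxE.
  by apply: eq_bigr => j _; rewrite !mxE mulrC.
have ct j : cs (fun k => col j (Phi (a * k)%g)).
  exact: (continuous_section_translate Ka (cPhi j)).
have cB i : cs (fun k => col i (Phi (a * k)%g *m B^T)).
  by rewrite colE; exact: continuous_section_sum.
have h1 : {ae nu, forall x : borel X, forall i : 'I_p,
    xi (fun k => col i (Phi (a * k)%g *m B^T)) x = xi (fun k => col i (Phi k)) x}.
  by apply: filter_forall => i; exact: (xi_eq (cB i) (cPhi i) (fixed i)).
have h2 : {ae nu, forall x : borel X, forall i : 'I_p,
    xi (fun k => col i (Phi (a * k)%g *m B^T)) x =
    \sum_j B i j * xi (fun k => col j (Phi (a * k)%g)) x}.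
  apply: filter_forall => i; rewrite colE.
  exact: (xi_sum (B i) (phi := fun j k => col j (Phi (a * k)%g)) ct).
have h3 : {ae nu, forall x : borel X, forall j : 'I_p,
    xi (fun k => col j (Phi (a * k)%g)) x =
    xi (fun k => col j (Phi k)) (rtrans a^-1%g x)}.
  by apply: filter_forall => j; exact: (xi_translate Ka (cPhi j)).
apply: filterS3 h1 h2 h3 => x h1 h2 h3.
apply/matrixP => i c; rewrite !mxE -h1 h2.
by apply: eq_bigr => j _; rewrite mxE h3.
Qed.

Lemma ext_xi_measurable (Phi : G -> 'M[C]_(q, p)) : columns_in cs Phi ->
  forall i j, cmeasurable [set: borel X] (fun x => ext_xi xi Phi x i j).
Proof.
move=> cPhi i j; have [L2 _ _ _] := xi_embedding.
under eq_fun do rewrite mxE.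
by have [] := L2 _ (in_H_cs (cPhi i)).
Qed.

Lemma in_A_measurable (f : X -> 'M[C]_p) : in_A f ->
  forall i j, cmeasurable [set: borel X] (fun x => f x i j).
Proof.
move=> /continuous_mxP cf i j; have [cr ci] := cf i j.
by split; exact: continuous_borel_measurable.
Qed.

(** Almost everywhere the two vectors may be replaced by their [B]-images at the point translated by
    [a^-1]; invariance of [nu] then moves the translation onto [f]. Separate [B1] and [B2] permit a
    change on one side only. *)
Lemma sigma_xi_fixed a B1 B2 Phi Psi (f : X -> 'M[C]_p) : K a ->
  columns_in cs Phi -> columns_in cs Psi ->
  translate_fixed a B1 Phi -> translate_fixed a B2 Psi -> in_A f ->
  sigma_xi nu xi Phi Psi (fun x => adjmx B1 *m f (rtrans a x) *m B2) =
  sigma_xi nu xi Phi Psi f.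
Proof.
move=> Ka cPhi cPsi fPhi fPsi Af.
have mr b : measurable_fun setT (rtrans b : borel X -> borel X).
  by apply: continuous_borel; exact: rtrans_continuous.
have mc b (u : X -> C) : cmeasurable [set: borel X] u ->
    cmeasurable [set: borel X] (fun x => u (rtrans b x)).
  by move=> [ur ui]; split; [exact: (measurableT_comp ur (mr b))|exact: (measurableT_comp ui (mr b))].
have mPhi := ext_xi_measurable cPhi; have mPsi := ext_xi_measurable cPsi.
have mf := in_A_measurable Af.
have mcst (B : 'M[C]_p) i j : cmeasurable [set: borel X] (fun=> B i j).
  exact: cmeasurable_cst.
pose u (x : borel X) := cdot (B1 *m ext_xi xi Phi (rtrans a^-1%g x))
  (f x *m (B2 *m ext_xi xi Psi (rtrans a^-1%g x))).
have mtr (Th : G -> 'M[C]_(q, p)) : columns_in cs Th -> forall i j,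
    cmeasurable [set: borel X] (fun x => ext_xi xi Th (rtrans a^-1%g x) i j).
  by move=> cTh i j; apply: (mc _ (fun x => ext_xi xi Th x i j)); exact: ext_xi_measurable.
have mu : cmeasurable setT u.
  apply: cmeasurable_cdot.
    by apply: cmeasurable_mulmx => //; exact: mtr.
  apply: cmeasurable_mulmx => //; apply: cmeasurable_mulmx => //; exact: mtr.
transitivity (cintegral nu setT u).
  rewrite -(cintegral_invariant (mr a) mu); last by case: nu_invariant => _ _; exact.
  rewrite /sigma_xi; congr cintegral; apply/funext => x /=.
  rewrite /u rtransM // mulgV rtrans1 // cdot_mull.
  by rewrite !mulmxA.
have mv : cmeasurable [set: borel X]
    (fun x => cdot (ext_xi xi Phi x) (f x *m ext_xi xi Psi x)).
  by apply: cmeasurable_cdot => //; exact: cmeasurable_mulmx.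
apply: (@ae_eq_cintegral R _ (borel X) nu u _ mu mv).
have h1 := ext_xi_fixed Ka cPhi fPhi; have h2 := ext_xi_fixed Ka cPsi fPsi.
by apply: filterS2 h1 h2 => x h1 h2; rewrite /u h1 h2.
Qed.

End Embedding.

(** * Isotypic components of delta_T *)

Section Delta.
Variables (R : realType) (G : lieGroup R) (g : lieAlgebra G) (K : set G).
Variable I : iwasawa g K.
Variable mK : {measure set (borel G) -> \bar R}.
Variables (p : nat) (gamma : G -> 'M[R[i]]_p) (q : nat) (kappa : G -> 'M[R[i]]_q).
Hypothesis K_subgroup : subgroup K.
Hypothesis K_compact : compact K.
Hypothesis K_haar : haar_measure K mK.
Hypothesis gamma_unitary : unitary_rep K gamma.
Hypothesis kappa_unitary : unitary_rep (iw_M I) kappa.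
Local Notation C := R[i].
Local Notation V := 'cV[R[i]]_q.
Local Notation Re := complex.Re.
Local Notation Im := complex.Im.
Local Notation M := (iw_M I).
Local Notation cs := (continuous_section I kappa).
Local Notation iso := (isotypic I mK kappa).

Let KM x y : K x -> K y -> K (x * y)%g.
Proof. by case: K_subgroup => _ h _; exact: h. Qed.
Let KV x : K x -> K (x^-1)%g.
Proof. by case: K_subgroup => _ _; exact. Qed.

Lemma isotypic_continuous mu phi : iso mu phi -> cs phi.
Proof.
move=> [N [J [w [JCK _ _ phiE]]]].
apply: (eq_continuous_section K_subgroup (psi := fun k => \sum_i 1 *: J i (w i) k)).
  by move=> k Kk; rewrite phiE //; apply: eq_bigr => i _; rewrite scale1r.
apply: (continuous_section_sum (fun=> 1) (phi := fun i => J i (w i))) => i.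
by have [[_ _ eqv] cJ _] := JCK i (w i).
Qed.

Lemma isotypic0 mu : iso mu (fun=> 0).
Proof.
exists 0%N, (fun _ _ _ => 0), (fun _ => 0).
by split; [case|case|case|move=> x _; rewrite big_ord0].
Qed.

Lemma isotypic_lin mu a phi psi : iso mu phi -> iso mu psi ->
  iso mu (fun k => a *: phi k + psi k).
Proof.
move=> [N1 [J1 [w1 [CK1 lin1 eqv1 E1]]]] [N2 [J2 [w2 [CK2 lin2 eqv2 E2]]]].
pose J (i : 'I_(N1 + N2)) := match fintype.split i with inl i => J1 i | inr i => J2 i end.
pose w (i : 'I_(N1 + N2)) := match fintype.split i with inl i => a *: w1 i | inr i => w2 i end.
have lin0 i v x : K x -> J1 i (a *: v) x = a *: J1 i v x.
  move=> Kx; have J0 : J1 i 0 x = 0.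
    have := lin1 i 1 0 0 x Kx; rewrite scale1r addr0 scale1r.
    by move/eqP; rewrite -subr_eq0 opprD addrA subrr sub0r oppr_eq0 => /eqP.
  by have := lin1 i a v 0 x Kx; rewrite addr0 J0 addr0.
exists (N1 + N2)%N, J, w; split.
- by move=> i v; rewrite /J; case: fintype.split.
- by move=> i c u v x Kx; rewrite /J; case: fintype.split => j; [exact: lin1|exact: lin2].
- by move=> i k v x Kk Kx; rewrite /J; case: fintype.split => j; [exact: eqv1|exact: eqv2].
move=> x Kx; rewrite E1 // E2 // big_split_ord /= scaler_sumr.
congr (_ + _); apply: eq_bigr => i _; rewrite /J /w.
  by rewrite (unsplitK (inl i)) lin0.
by rewrite (unsplitK (inr i)).
Qed.

Lemma isotypic_sum mu n (a : 'I_n -> C) (phi : 'I_n -> G -> V) :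
  (forall i, iso mu (phi i)) -> iso mu (fun k => \sum_i a i *: phi i k).
Proof.
elim: n a phi => [|n IH] a phi iphi.
  rewrite (_ : (fun k => _) = fun=> 0); first exact: isotypic0.
  by apply/funext => k; rewrite big_ord0.
rewrite (_ : (fun k => _) = (fun k => a ord0 *: phi ord0 k +
    \sum_(i < n) a (lift ord0 i) *: phi (lift ord0 i) k)).
  apply: isotypic_lin; first exact: iphi.
  by apply: (IH (fun i => a (lift ord0 i)) (fun i => phi (lift ord0 i))).
by apply/funext => k; rewrite big_ord_recl.
Qed.

Lemma isotypic_translate mu a phi : K a -> iso mu phi ->
  iso mu (fun k => phi (a * k)%g).
Proof.
move=> Ka [N [J [w [CK lin eqv E]]]].
exists N, J, (fun i => irr_rep (repr mu) (a^-1)%g *m w i); split=> // x Kx.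
rewrite E; last exact: KM.
by apply: eq_bigr => i _; rewrite eqv ?invgK //; exact: KV.
Qed.

Lemma isotypic_columns mu a (B : 'M[C]_p) (Phi : G -> 'M[C]_(q, p)) : K a ->
  columns_in (iso mu) Phi -> columns_in (iso mu) (fun k => Phi (a * k)%g *m B^T).
Proof.
move=> Ka iPhi j.
have -> : (fun k => col j (Phi (a * k)%g *m B^T)) =
    (fun k => \sum_l B j l *: col l (Phi (a * k)%g)).
  apply/funext => k; apply/matrixP => r c; rewrite !mxE summxE.
  by apply: eq_bigr => l _; rewrite !mxE mulrC.
apply: (isotypic_sum (B j) (phi := fun l k => col l (Phi (a * k)%g))) => l.
exact: (isotypic_translate Ka (iPhi l)).
Qed.

Let cs_ccont (Phi : G -> 'M[C]_(q, p)) : columns_in cs Phi ->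
  forall i j, ccont ((fun k => Phi k i j) : subspace K -> C).
Proof.
move=> cPhi i j; have [cj _] := cPhi j.
have := (continuous_mxP _).1 cj i 0.
by rewrite /ccont /from_subspace; under eq_fun do rewrite mxE;
  under [X in _ /\ continuous X -> _]eq_fun do rewrite mxE.
Qed.

Let cdot_ccont (Phi Psi : G -> 'M[C]_(q, p)) : columns_in cs Phi ->
  columns_in cs Psi -> ccont ((fun k => cdot (Phi k) (Psi k)) : subspace K -> C).
Proof.
move=> cPhi cPsi; apply: ccont_sum => i; apply: ccont_sum => j.
by apply: ccontM; [apply: ccont_conj|]; exact: cs_ccont.
Qed.

Let iso_cs mu (Phi : G -> 'M[C]_(q, p)) :
  columns_in (iso mu) Phi -> columns_in cs Phi.
Proof. by move=> iPhi j; exact: isotypic_continuous (iPhi j). Qed.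

Variable T : 'M[C]_(q, p).
Local Notation is_delta := (is_delta I mK kappa T).
Local Notation delta_T := (delta_T I mK kappa T).

(** Translation and [B] are moved onto the test section, which stays in the isotypic space. Its
    value at [a^-1] is [kappa a] times its value at 1 because [a] lies in [M], and the hypothesis on
    [T] absorbs both factors. *)
Lemma is_delta_translate mu a (B : 'M[C]_p) D : M a ->
  adjmx (kappa a) *m T *m B^T = T ->
  is_delta mu D -> is_delta mu (fun k => D (a * k)%g *m B^T).
Proof.
move=> Ma TE [iD pair]; have Ka := iw_M_sub Ma.
split=> [|Phi iPhi]; first exact: isotypic_columns.
pose B' : 'M[C]_p := (adjmx B^T)^T.
pose Psi k := Phi (a^-1 * k)%g *m B'^T.
have iPsi : columns_in (iso mu) Psi by apply: isotypic_columns => //; exact: KV.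
have [cr ci] := cdot_ccont (iso_cs iD) (iso_cs iPsi).
have mr := within_continuous_borel_measurable (K_borel K_compact) cr.
have mi := within_continuous_borel_measurable (K_borel K_compact) ci.
transitivity (cintegral mK K (fun k : borel G => cdot (D k) (Psi k))).
  rewrite /cintegral; congr (_ +i* _).
    rewrite -[RHS](haar_mean_measurable_mull K_subgroup K_compact K_haar Ka mr).
    by apply: eq_Rintegral => k _; rewrite /Psi mulKg /B' trmxK cdot_mulr.
  rewrite -[RHS](haar_mean_measurable_mull K_subgroup K_compact K_haar Ka mi).
  by apply: eq_Rintegral => k _; rewrite /Psi mulKg /B' trmxK cdot_mulr.
rewrite pair // /Psi /B' trmxK mulg1.
have MV : M (a^-1)%g by have [_ _] := iw_M_subgroup I K_subgroup; exact.
have -> : Phi (a^-1)%g = kappa a *m Phi 1%g.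
  apply/matrixP => i j.
  have [_ eqv] := iso_cs iPhi j.
  have := eqv 1%g _ ltac:(by case: K_subgroup) MV; rewrite mul1g.
  rewrite (unitary_rep_invmx kappa_unitary MV).
  rewrite (unitary_repV (iw_M_subgroup I K_subgroup) kappa_unitary Ma) adjmxK.
  move=> /(congr1 (fun A : V => A i 0)); rewrite !mxE => ->.
  by apply: eq_bigr => l _; rewrite !mxE.
by rewrite -mulmxA -[kappa a in LHS]adjmxK -cdot_mull -cdot_mulr TE.
Qed.

(** The difference [E] is itself a test section, and [D] and [D'] have the same pairing with it, so
    [E] has L^2 norm 0. *)
Lemma is_delta_unique mu D D' : is_delta mu D -> is_delta mu D' ->
  forall j, null_section K mK (fun k => col j (D k) - col j (D' k)).
Proof.
move=> [iD pair] [iD' pair'] j.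
pose E k := D k - D' k.
have iE : columns_in (iso mu) E.
  move=> l; rewrite (_ : (fun k => _) = (fun k => -1 *: col l (D' k) + col l (D k))).
    exact: isotypic_lin.
  by apply/funext => k; apply/matrixP => r c; rewrite !mxE mulN1r addrC.
have [c1 _] := cdot_ccont (iso_cs iD) (iso_cs iE).
have [c2 _] := cdot_ccont (iso_cs iD') (iso_cs iE).
have [c3 _] := cdot_ccont (iso_cs iE) (iso_cs iE).
have i1 := within_haar_integrable K_subgroup K_compact K_haar c1.
have i2 := within_haar_integrable K_subgroup K_compact K_haar c2.
have i3 := within_haar_integrable K_subgroup K_compact K_haar c3.
have mKK := K_borel K_compact.
have EE : \int[mK]_(k in (K : set (borel G))) Re (cdot (E k) (E k)) = 0.
  transitivity (\int[mK]_(k in (K : set (borel G)))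
      (Re (cdot (D k) (E k)) - Re (cdot (D' k) (E k)))).
    apply: eq_Rintegral => k _; rewrite /E !cdotE adjmxB mulmxBl linearB /=.
    by case: (\tr _) => ? ?; case: (\tr _).
  rewrite (RintegralB mKK i1 i2).
  have := pair _ iE; have := pair' _ iE; rewrite /cintegral.
  by move=> /(congr1 (@complex.Re R)) /= -> /(congr1 (@complex.Re R)) /= ->; rewrite subrr.
have EE' : (\int[mK]_(k in (K : set (borel G))) (Re (cdot (E k) (E k)))%:E = 0)%E.
  by rewrite -[LHS]fineK ?integrable_fin_num // [fine _]EE.
have cj : {within K, continuous (fun k => cnorm (col j (E k)) ^+ 2)}.
  by apply: within_cnorm_sqr; have [] := iso_cs iE j.
rewrite /null_section; apply/eqP; rewrite eq_le; apply/andP; split; last first.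
  by apply: integral_ge0 => k _; rewrite lee_fin sqr_ge0.
rewrite -[leRHS]EE'; apply: ge0_le_integral => //.
- by move=> k _; rewrite lee_fin sqr_ge0.
- apply/measurable_EFinP; apply: within_continuous_borel_measurable => //.
  rewrite (_ : (fun k => _) = (fun k => cnorm (col j (E k)) ^+ 2)) //.
  by apply/funext => k; rewrite /E linearB.
- by apply/measurable_EFinP; exact: within_continuous_borel_measurable.
move=> k _; rewrite lee_fin -linearB -/(E k) cnorm_sqr !Re_cdot.
apply: ler_sum => i _; rewrite big_ord1 mxE (bigD1 j) //= lerDl.
by apply: sumr_ge0 => l _; exact: sqr_ge0.
Qed.

(** The second case is the default of [xget]; continuity and invariance are immediate for it. *)
Lemma delta_T_spec mu : is_delta mu (delta_T mu) \/ delta_T mu = fun=> 0.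
Proof.
rewrite /Defs.delta_T; case: xgetP => [D _ h|_]; first by left.
by right.
Qed.

Lemma delta_T_continuous mu : columns_in cs (delta_T mu).
Proof.
have [[iD _]|->] := delta_T_spec mu; first exact: iso_cs.
move=> j; rewrite (_ : (fun k => _) = fun=> 0); first exact: continuous_section0.
by apply/funext => k; rewrite linear0.
Qed.

Lemma delta_T_fixed mu a (B : 'M[C]_p) : M a ->
  adjmx (kappa a) *m T *m B^T = T -> translate_fixed K mK a B (delta_T mu).
Proof.
move=> Ma TE; have [isd|->] := delta_T_spec mu => j.
  exact: is_delta_unique (is_delta_translate Ma TE isd) isd j.
by apply: null_section0 => k _; rewrite mul0mx linear0 subr0.
Qed.

Hypothesis T_invariant : M_invariant I kappa gamma T.

Let kappa_T m : M m -> T *m (gamma m)^T = adjmx (kappa m) *m T.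
Proof.
move=> Mm; rewrite -[in RHS](T_invariant Mm) !mulmxA.
by rewrite (unitary_rep_adjmx (iw_M_subgroup I K_subgroup) kappa_unitary Mm) mul1mx.
Qed.

Lemma psi_T_continuous : columns_in cs (psi_T gamma T).
Proof.
have [_ gM gU gc] := gamma_unitary.
move=> j; split.
  apply/continuous_mxP => i l.
  have h : ccont ((fun k => \sum_r T i r * gamma k j r) : subspace K -> C).
    apply: ccont_sum => r; apply: ccontM; first exact: ccont_cst.
    exact: (continuous_mxP _).1.
  rewrite (_ : (fun k => _) = (fun k => \sum_r T i r * gamma k j r)) //.
  apply/funext => k; rewrite /psi_T /from_subspace !mxE.
  by apply: eq_bigr => r _; rewrite mxE.
move=> k m Kk Mm; rewrite /psi_T gM //; last exact: iw_M_sub Mm.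
rewrite trmx_mul mulmxA (kappa_T Mm) (unitary_rep_invmx kappa_unitary Mm).
rewrite -!mulmxA; apply/matrixP => i l; rewrite [LHS]mxE [LHS]mxE [RHS]mxE.
by apply: eq_bigr => r _; congr (_ * _); rewrite [RHS]mxE.
Qed.

Lemma psi_T_fixed m : K m -> translate_fixed K mK m (invmx (gamma m)) (psi_T gamma T).
Proof.
move=> Km j; apply: null_section0 => k Kk; rewrite /psi_T.
have [_ gM gU _] := gamma_unitary.
have gu : gamma m \in unitmx by have /mulmx1_unit[] := gU m Km.
by rewrite gM // trmx_mul mulmxA -!mulmxA -trmx_mul mulVmx // trmx1 mulmx1 subrr.
Qed.

Lemma translate_fixed1 (Phi : G -> 'M[C]_(q, p)) : translate_fixed K mK 1%g 1%:M Phi.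
Proof.
by move=> j; apply: null_section0 => k _; rewrite mul1g trmx1 mulmx1 subrr.
Qed.

End Delta.

Theorem proposition4p2 (R : realType) (G : lieGroup R) (g : lieAlgebra G)
    (K Gam : set G) (I : iwasawa g K)
    (mK : {measure set (borel G) -> \bar R})
    (nu : {measure set (borel (coset_space Gam)) -> \bar R})
    (p : nat) (gamma : G -> 'M[R[i]]_p)
    (q : nat) (kappa : G -> 'M[R[i]]_q)
    (G_semisimple : semisimple g)
    (K_maximal : maximal_compact K)
    (Gam_discrete : discrete_torsion_free Gam)
    (Gam_cocompact : cocompact Gam)
    (mK_haar : haar_measure K mK)
    (nu_invariant : invariant_measure nu)
    (gamma_unitary : unitary_rep K gamma)
    (kappa_unitary : unitary_rep (iw_M I) kappa)
    (kappa_irreducible : irreducible_rep (iw_M I) kappa)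
    (l : adual I)
    (l_in_L : in_L mK kappa nu l)
    (l_regular : regular l)
    (T : 'M[R[i]]_(q, p))
    (T_invariant : M_invariant I kappa gamma T)
    (T_norm : cnorm T = 1)
    (s : (coset_space Gam -> 'M[R[i]]_p) -> R[i])
    (s_in_V : in_V mK kappa nu gamma l T s) :
  (forall m f, iw_M I m -> in_A f -> s (K_act gamma m f) = s f) /\
  [/\ P_T T *m P_T T = P_T T,
      adjmx (P_T T) = P_T T,
      (forall m, iw_M I m -> gamma m *m P_T T = P_T T *m gamma m)
    & forall f, in_A f -> s (fun x => P_T T *m f x *m P_T T) = s f].
Proof.
have [K_subgroup K_compact _] := K_maximal.
have [Gam_subgroup _ _] := Gam_discrete.
have [s_state [lam [xi [[emb _ _ _] sE]]]] := s_in_V.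
have Pid := P_T_idempotent K_subgroup gamma_unitary kappa_unitary
  kappa_irreducible T_invariant T_norm.
have Padj := P_T_self_adjoint T.
have psi_cont := psi_T_continuous K_subgroup gamma_unitary kappa_unitary T_invariant.
have delta_cont mu := @delta_T_continuous R G g K I mK p q kappa K_subgroup T mu.
split=> [m f Mm Af|]; last split=> //.
- have Km := iw_M_sub Mm.
  have ga := unitary_rep_invmx gamma_unitary Km.
  have actE (h : coset_space Gam -> 'M[R[i]]_p) : K_act gamma m h =
      (fun x => adjmx (invmx (gamma m)) *m h (rtrans m x) *m invmx (gamma m)).
    by apply/funext => x; rewrite /K_act ga adjmxK.
  have act_A (h : coset_space Gam -> 'M[R[i]]_p) : in_A h -> in_A (K_act gamma m h).
    move=> Ah; rewrite actE; apply: in_AM; last exact: in_A_cst.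
    apply: in_AM; first exact: in_A_cst.
    by move=> x; apply: continuous_comp; [exact: rtrans_continuous|exact: Ah].
  have act_AK (h : coset_space Gam -> 'M[R[i]]_p) : in_AK K h -> in_AK K (K_act gamma m h).
    move=> [Ah [N [b span]]]; split; first exact: act_A.
    exists N, (fun i x => gamma m *m b i x *m invmx (gamma m)).
    move=> _ [k Kk ->].
    have Kkm : K (k * m)%g by case: K_subgroup => _ KM _; exact: KM.
    have [c cE] := span (fun x => h (rtrans (k * m)%g x)) (ex_intro2 _ _ _ Kkm erefl).
    exists c => x _; rewrite /K_act rtransM // cE // mulmx_sumr mulmx_suml.
    by apply: eq_bigr => i _; rewrite -scalemxAr -scalemxAl.
  have kappaT : adjmx (kappa m) *m T *m (invmx (gamma m))^T = T.
    rewrite -[in LHS](T_invariant m Mm) !mulmxA.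
    rewrite (unitary_rep_adjmx (iw_M_subgroup I K_subgroup) kappa_unitary Mm) mul1mx.
    have [_ _ gU _] := gamma_unitary.
    have gu : gamma m \in unitmx by have /mulmx1_unit[] := gU m Km.
    by rewrite -mulmxA -trmx_mul mulVmx // trmx1 mulmx1.
  have on_AK (h : coset_space Gam -> 'M[R[i]]_p) : in_AK K h -> s (K_act gamma m h) = s h.
    move=> AKh; rewrite (sE _ (act_AK h AKh)) (sE _ AKh).
    (* The two sequences agree for every [mu] and every [n], so their limits and sums do. *)
    apply: eq_fsbigr => mu _.
    apply: (f_equal (fun u : nat -> R[i] => lim (u @ \oo))); apply/funext => n; rewrite actE.
    have fix_psi := psi_T_fixed mK gamma_unitary T Km.
    have fix_delta := delta_T_fixed K_subgroup K_compact mK_haar kappa_unitary mu Mm kappaT.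
    exact: (sigma_xi_fixed K_subgroup K_compact mK_haar Gam_subgroup nu_invariant (emb n) Km
      psi_cont (delta_cont mu) fix_psi fix_delta (proj1 AKh)).
  have act_lin (a : R[i]) (h h' : coset_space Gam -> 'M[R[i]]_p) : K_act gamma m (fun x => a *: h x + h' x) =
      (fun x => a *: K_act gamma m h x + K_act gamma m h' x).
    by apply/funext => x; rewrite /K_act mulmxDr mulmxDl -scalemxAr -scalemxAl.
  pose L h := complex.Re (s (K_act gamma m h) - s h).
  (* Real parts suffice: applied to ['i *: f], the claim gives the imaginary part for [f]. *)
  suff L0 h : in_A h -> L h = 0.
    apply/eqP; rewrite -subr_eq0; apply/eqP; apply: eq_ReIm; first exact: L0.
    have := L0 _ (@in_AZ _ _ _ _ 'i%C _ Af); rewrite /L.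
    have -> : K_act gamma m (fun x => 'i%C *: f x) = (fun x => 'i%C *: K_act gamma m f x).
      by apply/funext => x; rewrite /K_act -scalemxAr -scalemxAl.
    rewrite (stateZ s_state _ Af) (stateZ s_state _ (act_A _ Af)) -mulrBr.
    by rewrite Re_mulc /=; lra.
  (* One [p * p] from [cnorm_mulmx_le] for each of the two terms of [L]; conjugation by the unitary
     [gamma m] preserves the bound. *)
  apply: (vanishing_on_AK (L := L) (c0 := 2 * (p%:R * p%:R)) K_subgroup K_compact mK_haar Gam_subgroup Gam_cocompact).
  + move=> a h1 h2 Ah1 Ah2; rewrite /L act_lin.
    have [lin _ _ _] := s_state.
    rewrite (lin _ _ _ (act_A _ Ah1) (act_A _ Ah2)) (lin _ _ _ Ah1 Ah2).
    by move: (s (K_act gamma m h1)) (s (K_act gamma m h2)) (s h1) (s h2) => [? ?] [? ?] [? ?] [? ?] /=; ring.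
  + move=> h1 B Ah1 h1B.
    have [_ _ _ bnd] := s_state.
    have cb x (v : 'cV[R[i]]_p) : cnorm (h1 x *m v) <= p%:R * p%:R * B * cnorm v.
      exact: cnorm_mulmx_le.
    have ub := unitary_rep_adjmx K_subgroup gamma_unitary Km.
    have [_ _ gU _] := gamma_unitary.
    have cb' x (v : 'cV[R[i]]_p) : cnorm (K_act gamma m h1 x *m v) <= p%:R * p%:R * B * cnorm v.
      rewrite /K_act ga -!mulmxA cnorm_unitary //; apply: le_trans (cb _ _) _.
      by rewrite cnorm_unitary // adjmxK; exact: gU.
    have b1 := bnd _ _ Ah1 cb; have b2 := bnd _ _ (act_A _ Ah1) cb'.
    rewrite normE lecR in b1; rewrite normE lecR in b2.
    rewrite /L; apply: le_trans (le_Re_norm _) _.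
    have : complex.Re `|s (K_act gamma m h1) - s h1| <=
        complex.Re `|s (K_act gamma m h1)| + complex.Re `|s h1|.
      by have := ler_normB (s (K_act gamma m h1)) (s h1); rewrite lecE Re_addc => /andP[].
    by move: b1 b2; lra.
  + by move=> h1 AKh1; rewrite /L on_AK // subrr.
- exact: (P_T_commute K_subgroup gamma_unitary kappa_unitary T_invariant).
move=> f Af; apply: (state_compress s_state) => //.
have const_AK (A : 'M[R[i]]_p) : in_AK K (fun _ : coset_space Gam => A).
  split; first exact: in_A_cst.
  exists 1%N, (fun _ _ => A) => _ [k _ ->]; exists (fun=> 1) => x _.
  by rewrite big_ord1 scale1r.
have [_ _ <- _] := s_state.
rewrite (sE _ (const_AK _)) (sE _ (const_AK _)).
have K1 : K 1%g by case: K_subgroup.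
have M1 : iw_M I 1%g by case: (iw_M_subgroup I K_subgroup).
have TP : adjmx (kappa 1%g) *m T *m (P_T T)^T = T.
  have [k1 _ _ _] := kappa_unitary.
  rewrite k1 adjmx1 mul1mx.
  exact: (P_T_absorb K_subgroup gamma_unitary kappa_unitary kappa_irreducible T_invariant T_norm).
apply: eq_fsbigr => mu _.
apply: (f_equal (fun u : nat -> R[i] => lim (u @ \oo))); apply/funext => n.
(* The instance [a = 1], [B = P_T]; on the [psi_T] side it is paired with [B = 1]. *)
have fix_delta := delta_T_fixed K_subgroup K_compact mK_haar kappa_unitary mu M1 TP.
have := @sigma_xi_fixed _ _ _ _ _ _ _ _ _ _ _ K_subgroup K_compact mK_haar Gam_subgroup
  nu_invariant _ _ (emb n) _ _ _ _ _ _ K1 psi_cont (delta_cont mu)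
  (@translate_fixed1 _ _ _ _ _ _ _) fix_delta (@in_A_cst R G Gam p 1%:M).
rewrite (_ : (fun x => _) = (fun=> P_T T)) //.
by apply/funext => x; rewrite adjmx1 !mul1mx.
Qed.
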